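(* Let $1\le p<\infty$. Then (i) there exist a constant $c>0$ and a sequence $\{f_N\}_{N=1}^\infty$ of functions in $B^{1/p}_{p,\infty}(\mathbb R)$ such that $\|f_N\|_{B^{1/p,\mathrm{dyad}}_{p,\infty}}=1$ and $\|f_N\|_{B^{1/p}_{p,\infty}}\ge c\,N$ for all $N\geq 1$; (ii) $B^{1/p,\mathrm{dyad}}_{p,\infty}(\mathbb R)\setminus B^{1/p}_{p,\infty}(\mathbb R)\ne\emptyset$.
   Context: Function spaces. Let $\eta_0\in C_c^\infty(\mathbb R)$ be supported in $\{|\xi|<3/4\}$ with $\eta_0(\xi)=1$ for $|\xi|\le 1/2$. For $f\in\mathcal S'(\mathbb R)$ let $\widehat{\Delta_0f}=\eta_0\widehat f$ and $\widehat{\Delta_kf}(\xi)=(\eta_0(2^{-k}\xi)-\eta_0(2^{-k+1}\xi))\widehat f(\xi)$, $k\ge1$. For $s\in\mathbb R$, $0<p,q\le\infty$, $B^s_{p,q}(\mathbb R)$ is the Besov space with $\|f\|_{B^s_{p,q}}=\big(\sum_{k\ge0}(2^{ks}\|\Delta_kf\|_p)^q\big)^{1/q}$ (supremum if $q=\infty$). The reference space of distributions is $\mathscr B:=B^{-1}_{\infty,1}(\mathbb R)$. Pairing. For a bounded interval $I$ and $f\in\mathscr B$ set $\langle f,\mathbf 1_I\rangle:=\sum_{k\ge0}\int_I\Delta_kf(x)\,dx$ (this series converges absolutely and defines a bounded linear functional on $\mathscr B$, extending $f\mapsto\int_If$); extend by linearity to finite linear combinations of indicator functions of bounded intervals. Haar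 system: $h=\mathbf 1_{[0,1/2)}-\mathbf 1_{[1/2,1)}$, $h_{j,\mu}(x)=h(2^jx-\mu)$ for $j\ge0$, $\mu\in\mathbb Z$, and $h_{-1,\mu}=\mathbf 1_{[\mu,\mu+1)}$. Dyadic Besov space: $B^{1/p,\mathrm{dyad}}_{p,\infty}(\mathbb R)=\{f\in\mathscr B:\|f\|_{B^{1/p,\mathrm{dyad}}_{p,\infty}}<\infty\}$, where $$\|f\|_{B^{1/p,\mathrm{dyad}}_{p,\infty}}=\sup_{j\ge-1}\Big(\sum_{\mu\in\mathbb Z}|2^j\langle f,h_{j,\mu}\rangle|^p\Big)^{1/p}.$$ *)

(* Defs.v *)
Set Warnings "-notation-overridden,-notation-incompatible-prefix,-ambiguous-paths".
From HB Require Import structures.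
From mathcomp Require Import all_boot all_order all_algebra.
From mathcomp Require Import complex.
From mathcomp Require Import all_classical all_reals all_analysis.
From mathcomp Require Import ring lra.

Set Implicit Arguments.
Unset Strict Implicit.
Unset Printing Implicit Defensive.

Import Order.TTheory GRing.Theory Num.Theory.
Import numFieldNormedType.Exports.
Import ComplexField.Normc.

Local Open Scope classical_set_scope.
Local Open Scope ring_scope.
Local Open Scope complex_scope.

Section ComplexValued.
Context {R : realType}.
Local Notation C := R[i].
Local Notation mu := (@lebesgue_measure R).

Definition ccontinuous (g : R -> C) : Prop :=
  continuous (@complex.Re R \o g) /\ continuous (@complex.Im R \o g).

Definition csmooth (g : R -> C) : Prop := forall (n : nat) (x : R),
  derivable (derive1n n (@complex.Re R \o g)) x 1 /\
  derivable (derive1n n (@complex.Im R \o g)) x 1.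

Definition cderive (n : nat) (g : R -> C) (x : R) : C :=
  derive1n n (@complex.Re R \o g) x +i* derive1n n (@complex.Im R \o g) x.

Definition cintegrable (D : set R) (g : R -> C) : Prop :=
  mu.-integrable D (EFin \o (@complex.Re R \o g)) /\
  mu.-integrable D (EFin \o (@complex.Im R \o g)).

Definition cintegral (D : set R) (g : R -> C) : C :=
  Rintegral mu D (@complex.Re R \o g) +i* Rintegral mu D (@complex.Im R \o g).

Definition cseries (u : nat -> C) : C :=
  limn (series (@complex.Re R \o u)) +i* limn (series (@complex.Im R \o u)).

Definition cnorm (p : \bar R) (g : R -> C) : \bar R :=
  Lnorm mu p (fun x => (normc (g x))%:E).

Definition cexpi (t : R) : C := cos t +i* sin t.

End ComplexValued.

Section TemperedDistributions.
Context {R : realType}.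
Local Notation C := R[i].

Definition schwartz_seminorm (m n : nat) (phi : R -> C) : R :=
  sup [set `|x| ^+ m * normc (cderive n phi x) | x in [set: R]].

Definition schwartz (phi : R -> C) : Prop :=
  csmooth phi /\
  forall m n : nat,
    has_ubound [set `|x| ^+ m * normc (cderive n phi x) | x in [set: R]].

(* An element of S'(R) is encoded by any total extension of a functional on
   Schwartz functions; every definition below only evaluates it on Schwartz
   functions. *)
Definition tdistribution := (R -> C) -> C.

Definition tempered (f : tdistribution) : Prop :=
  (forall (a : C) (phi psi : R -> C), schwartz phi -> schwartz psi ->
     f (fun x => a * phi x + psi x) = a * f phi + f psi) /\
  exists (N : nat) (A : R), forall phi : R -> C, schwartz phi ->
    normc (f phi) <= A * \sum_(m < N.+1) \sum_(n < N.+1) schwartz_seminorm m n phi.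

(* Convention: the Fourier transform has kernel e^(-2 pi i x xi). *)
Definition fourier (phi : R -> C) (xi : R) : C :=
  cintegral setT (fun x => cexpi (- (2 * pi * x * xi)) * phi x).

Definition inv_fourier (phi : R -> C) (x : R) : C :=
  cintegral setT (fun xi => cexpi (2 * pi * x * xi) * phi xi).

Definition dist_fourier (f : tdistribution) : tdistribution :=
  fun phi => f (fourier phi).

Definition dist_inv_fourier (f : tdistribution) : tdistribution :=
  fun phi => f (inv_fourier phi).

Definition dist_mul (m : R -> C) (f : tdistribution) : tdistribution :=
  fun phi => f (fun x => m x * phi x).

Definition represents (g : R -> C) (f : tdistribution) : Prop :=
  forall phi : R -> C, schwartz phi ->
    cintegrable setT (fun x => g x * phi x) /\
    f phi = cintegral setT (fun x => g x * phi x).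

End TemperedDistributions.

Section BesovSpaces.
Context {R : realType}.
Local Notation C := R[i].

(* Complex-valued cutoffs are allowed; smoothness and the condition on the
   closed support give an element of C_c^oo(R). *)
Definition lp_cutoff (eta0 : R -> C) : Prop :=
  [/\ csmooth eta0,
      closure [set xi | eta0 xi != 0] `<=` [set xi | `|xi| < 3 / 4] &
      forall xi : R, `|xi| <= 1 / 2 -> eta0 xi = 1].

Variable eta0 : R -> C.
Implicit Types (f : @tdistribution R).

Definition lp_multiplier (k : nat) (xi : R) : C :=
  if k is k'.+1 then eta0 (2 ^- k'.+1 * xi) - eta0 (2 ^- k' * xi) else eta0 xi.

Definition lp_dist (k : nat) f : tdistribution :=
  dist_inv_fourier (dist_mul (lp_multiplier k) (dist_fourier f)).

(* [lp_dist k f] has a compactly supported Fourier transform, so by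
   Paley-Wiener-Schwartz it is represented by a unique continuous function;
   the default value of [xget] is never taken when [f] is tempered. *)
Definition lp_piece (k : nat) f : R -> C :=
  xget (fun=> 0) [set g | ccontinuous g /\ represents g (lp_dist k f)].

Definition besov_norm (s : R) (p q : \bar R) f : \bar R :=
  let a k := ((2 `^ (k%:R * s))%:E * cnorm p (lp_piece k f))%E in
  if q is r%:E then ((\sum_(0 <= k <oo) a k `^ r) `^ r^-1)%E
  else ereal_sup [set a k | k in [set: nat]].

Definition besov (s : R) (p q : \bar R) : set tdistribution :=
  [set f | tempered f /\ (besov_norm s p q f < +oo)%E].

Definition refspace : set tdistribution := besov (-1) +oo%E 1%E.

(* Meant for bounded [I]; for [f] in [refspace] the series converges
   absolutely. *)
Definition pairing_ind f (I : interval R) : C :=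
  cseries (fun k => cintegral [set` I] (lp_piece k f)).

(* Formal linear combinations of indicators of intervals, on which the linear
   extension of [pairing_ind] is defined; [haar_fun] and [haar_funN1] below
   identify the functions denoted by the Haar combinations. *)
Definition step := seq (C * interval R).

Definition step_fun (s : step) (x : R) : C :=
  \sum_(cI <- s) cI.1 * (x \in cI.2)%:R.

Definition pairing f (s : step) : C :=
  \sum_(cI <- s) cI.1 * pairing_ind f cI.2.

Definition haar (j mu : int) : step :=
  if j == -1 then [:: (1, `[mu%:~R, mu%:~R + 1[)]
  else [:: (1, `[2 ^ (- j) * mu%:~R, 2 ^ (- j) * (mu%:~R + 1 / 2)[);
           (-1, `[2 ^ (- j) * (mu%:~R + 1 / 2), 2 ^ (- j) * (mu%:~R + 1)[)].

Definition dyad_norm (p : R) f : \bar R :=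
  ereal_sup [set ((\esum_(mu in [set: int])
                     ((2 ^ j * normc (pairing f (haar j mu))) `^ p)%:E)
                  `^ p^-1)%E | j in [set j : int | -1 <= j]].

Definition besov_dyad (p : R) : set tdistribution :=
  [set f | refspace f /\ (dyad_norm p f < +oo)%E].

End BesovSpaces.

Section HaarFunctions.
Context {R : realType}.

Definition haar_mother (x : R) : R[i] :=
  (0 <= x < 1 / 2)%R%:R - (1 / 2 <= x < 1)%R%:R.

Lemma haar_fun (j mu : int) (x : R) : 0 <= j ->
  step_fun (haar j mu) x = haar_mother (2 ^ j * x - mu%:~R).
Proof.
move=> j0; rewrite /haar ifF; last by apply/negbTE; rewrite gt_eqF// (lt_le_trans _ j0).
have e0 : 0 < (2 : R) ^ j by rewrite exprz_gt0.
have le1 (a y : R) : (2 ^ (- j) * a <= y) = (a <= 2 ^ j * y).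
  by rewrite -invr_expz mulrC ler_pdivrMr// mulrC.
have lt1 (a y : R) : (y < 2 ^ (- j) * a) = (2 ^ j * y < a).
  by rewrite -invr_expz [X in _ < X]mulrC ltr_pdivlMr// mulrC.
rewrite /step_fun /haar_mother !big_cons big_nil addr0 /= mulN1r !mul1r.
rewrite !in_itv /= !le1 !lt1 !lerBrDr !ltrBlDr add0r.
by rewrite ![_ + mu%:~R]addrC.
Qed.

Lemma haar_funN1 (mu : int) (x : R) :
  step_fun (haar (-1) mu) x = (mu%:~R <= x < mu%:~R + 1)%R%:R.
Proof. by rewrite /haar eqxx /step_fun big_cons big_nil addr0 mul1r in_itv. Qed.

End HaarFunctions.

(* Main.v *)
Set Warnings "-notation-overridden,-notation-incompatible-prefix,-ambiguous-paths".
Require Import Defs.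
From mathcomp Require Import all_boot all_order all_algebra.
From mathcomp Require Import complex.
From mathcomp Require Import all_classical all_reals all_analysis.
From mathcomp Require Import measurable_realfun ess_sup_inf.
From mathcomp Require Import zify ring lra.

(** The dyadic norm sees a function through its Haar coefficients only, one
    frequency level at a time. For the sum of the Haar functions [h_{i,0}],
    [i < n], the normalized coefficients are 1 at the positions [(j, 0)] with
    [j < n] and 0 elsewhere, so the dyadic norm is 1 for every [n >= 1]
    ([dyad_norm_haar]).

    All these Haar functions jump by one unit at the same point, the origin,
    and there the jumps add up. The response of a Littlewood-Paley kernel of
    order [k] to a unit jump at the origin is [Psi (2 ^ k * y)], where the
    profile [Psi], called [lp_step], is continuous and not identically zero
    ([lp_step_neq0]). The other breakpoints of the first [k] Haar functions are
    at distances [2 ^ l * 2 ^- k], and their responses near the origin are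
    summable in [l], because [Psi] decays. The remaining Haar functions are
    small in the mean. Hence the piece of order [k] of a sum of [n] Haar
    functions is [min (k, n) * Psi (2 ^ k * y)] up to a bounded error when
    [2 ^ k * y] is bounded ([lp_conv_haar_near]). Its [L^p] norm is therefore at
    least of order [min (k, n) * 2 ^ (- k / p)], minus a bounded multiple of
    [2 ^ (- k / p)], and the Besov norm, which carries the weight [2 ^ (k / p)],
    is at least [c * n - D] ([besov_norm_haar_ge]). Taking [n] to be a large
    multiple of [N] absorbs [D] and gives the first part. Each finite sum is in
    the Besov space, since it is a step function ([besov_haar_sum]).

    For the second part, the sum of all the [h_{i,0}] converges in the mean. Its
    coefficients are those of the partial sums in the limit, so its dyadic norm
    is 1; its pieces grow linearly in [k], which the weight [2 ^- k] of the
    reference space tolerates ([refspace_haar_fun]) and boundedness in the Besov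
    norm does not.

    To make these computations apply to the distributions, the pieces of an
    integrable function are identified with convolutions
    ([lp_piece_fun_dist]): Fubini's theorem shows that the convolution
    represents the distribution, and a continuous representative is unique. The
    kernel of a cutoff is handled through its real and imaginary parts. The only
    facts used on them are continuity, a decay of order 4, and their integrals 1
    and 0, which are the real and imaginary parts of the value of the cutoff at
    the origin. The integrals follow from Fourier inversion at one point
    ([cos_transform_integral]). They also show that the sums of the pieces,
    integrated over an interval, converge to the integral of the function
    ([cvg_sum_lp_conv]), which evaluates the pairings with Haar functions. *)

Set Implicit Arguments.
Unset Strict Implicit.
Unset Printing Implicit Defensive.

Import Order.TTheory GRing.Theory Num.Theory.
Import numFieldNormedType.Exports.
Import ComplexField.Normc.

Local Open Scope classical_set_scope.
Local Open Scope ring_scope.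

(** * Integrals of real functions *)

Section IntegrationTools.
Context {R : realType}.
Local Notation mu := (@lebesgue_measure R).
Implicit Types (f g h A B : R -> R) (D : set R).

Lemma integrable_dominated f g : measurable_fun setT f ->
  (forall x, `|f x| <= g x) -> mu.-integrable setT (EFin \o g) ->
  mu.-integrable setT (EFin \o f).
Proof.
move=> mf fg ig; apply: (le_integrable _ _ _ ig) => //.
  exact/measurable_EFinP.
by move=> x _ /=; rewrite lee_fin (le_trans (fg x))// ler_norm.
Qed.

Lemma integrable_measurable f : mu.-integrable setT (EFin \o f) ->
  measurable_fun setT f.
Proof. by move=> /measurable_int/measurable_EFinP. Qed.

Lemma integrable_mul_bounded f g (M : R) : measurable_fun setT f ->
  (forall x, `|f x| <= M) -> mu.-integrable setT (EFin \o g) ->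
  mu.-integrable setT (EFin \o (fun x => g x * f x)).
Proof.
move=> mf fM ig.
have iM : mu.-integrable setT (EFin \o (fun x => M * `|g x|)).
  have := integrableZl measurableT M (integrable_norm ig).
  by apply: eq_integrable => // x _ /=; rewrite EFinM.
apply: integrable_dominated iM.
  by apply: measurable_funM => //; exact: integrable_measurable.
by move=> x; rewrite normrM mulrC ler_wpM2r.
Qed.

Lemma Rintegral_indic D f : measurable D ->
  Rintegral mu D f = Rintegral mu setT (fun x => \1_D x * f x).
Proof.
move=> mD; rewrite Rintegral_mkcond; apply: eq_Rintegral => x _.
by rewrite patchE indicE; case: ifPn => _; rewrite ?mul1r ?mul0r.
Qed.

Lemma integrable_indicM D f : measurable D ->
  mu.-integrable D (EFin \o f) ->
  mu.-integrable setT (EFin \o (fun x => \1_D x * f x)).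
Proof.
move=> mD iD; have := (@integrable_mkcond _ _ _ mu D (EFin \o f) mD).1 iD.
apply: eq_integrable => // x _ /=.
by rewrite patchE indicE /=; case: ifPn => _ /=; rewrite ?mul1r ?mul0r.
Qed.

Lemma normr_Rintegral_le f g : measurable_fun setT f ->
  (forall x, `|f x| <= g x) -> mu.-integrable setT (EFin \o g) ->
  `|Rintegral mu setT f| <= Rintegral mu setT g.
Proof.
move=> mf fg ig; have intf := integrable_dominated mf fg ig.
apply: (le_trans (le_normr_Rintegral _ intf)) => //.
by apply: le_Rintegral => //; exact: integrable_norm.
Qed.

Lemma Rintegral_dominated_cvg (f_ : nat -> R -> R) f g :
  (forall n, measurable_fun setT (f_ n)) -> measurable_fun setT f ->
  {ae mu, forall x, f_ ^~ x @ \oo --> f x} ->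
  mu.-integrable setT (EFin \o g) ->
  (forall n x, `|f_ n x| <= g x) ->
  Rintegral mu setT (f_ n) @[n --> \oo] --> Rintegral mu setT f.
Proof.
move=> mf_ mf cf ig fg.
have fT n : measurable_fun setT (EFin \o f_ n) by exact/measurable_EFinP.
have mfE : measurable_fun setT (EFin \o f) by exact/measurable_EFinP.
have cvE : {ae mu, forall x, setT x -> (EFin \o f_ n) x @[n --> \oo] --> (EFin \o f) x}.
  case: cf => N [mN N0 subN]; exists N; split => // x /=.
  move=> /not_implyP[_ nfx]; apply: subN => /= fx; apply: nfx.
  by apply: cvg_EFin => //; exact: nearW.
have dom : {ae mu, forall x n, setT x -> (`|(EFin \o f_ n) x| <= (EFin \o g) x)%E}.
  by apply: aeW => x n _ /=; rewrite lee_fin fg.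
have [intf _ cvf] := @dominated_convergence _ _ _ mu _ measurableT _ _ _ fT mfE cvE ig dom.
by apply: fine_cvg; rewrite fineK//; exact: integrable_fin_num.
Qed.

Section Fubini.
Variables (h : R * R -> R) (A B : R -> R).
Hypotheses (mh : measurable_fun setT h)
  (iA : mu.-integrable setT (EFin \o A)) (iB : mu.-integrable setT (EFin \o B))
  (hAB : forall x y, `|h (x, y)| <= A x * B y).

Let mhE : measurable_fun setT (EFin \o h). Proof. exact/measurable_EFinP. Qed.

Let slice1 x : measurable_fun setT (fun y => h (x, y)).
Proof. by apply: measurableT_comp => //; exact: pair1_measurable. Qed.

Let slice2 y : measurable_fun setT (fun x => h (x, y)).
Proof. by apply: measurableT_comp => //; exact: pair2_measurable. Qed.

Lemma integrable_slice1 x : mu.-integrable setT (EFin \o (fun y => h (x, y))).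
Proof.
apply: integrable_dominated (slice1 x) (hAB x) _.
by apply: eq_integrable (integrableZl measurableT (A x) iB) => // y _; rewrite /= EFinM.
Qed.

Lemma integrable_slice2 y : mu.-integrable setT (EFin \o (fun x => h (x, y))).
Proof.
apply: integrable_dominated (slice2 y) (fun x => hAB x y) _.
by apply: eq_integrable (integrableZr measurableT (B y) iA) => // x _; rewrite /= EFinM.
Qed.

(** The majorant [A x * B y] has a finite iterated integral, and Tonelli's
    theorem turns this into integrability on the plane. *)
Lemma integrable_product_dominated :
  (mu \x mu)%E.-integrable setT (EFin \o h).
Proof.
apply/integrable12ltyP => //.
apply: (@le_lt_trans _ _ (\int[mu]_x (`|A x| * fine (\int[mu]_y `|B y|%:E))%:E)%E).
  have fB : (\int[mu]_y `|B y|%:E)%E \is a fin_num.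
    by apply: integrable_fin_num => //; exact: integrable_norm.
  apply: ge0_le_integral => //.
  - by move=> x _; exact: integral_ge0.
  - have mabs : measurable_fun setT (fun xy => `|(h xy)%:E|%E).
      by apply: measurableT_comp.
    exact: (@measurable_fun_fubini_tonelli_F _ _ _ _ _ mu _ mabs
      (fun xy => abse_ge0 _)).
  - apply/measurable_EFinP; apply: measurable_funM => //.
    by apply: measurableT_comp => //; exact: integrable_measurable.
  - move=> x _ /=; rewrite EFinM fineK// -ge0_integralZl//; last first.
      apply/measurable_EFinP/measurableT_comp => //; exact: integrable_measurable.
    apply: ge0_le_integral => //.
    + by do 2 apply: measurableT_comp => //; exact: slice1.
    + apply/measurable_EFinP/measurable_funM => //.
      by apply/measurableT_comp => //; exact: integrable_measurable.
    + move=> y _; rewrite -EFinM lee_fin -normrM.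
      by rewrite (le_trans (hAB x y))// ler_norm.
have iAB := integrableZr measurableT (fine (\int[mu]_y `|B y|%:E)%E) (integrable_norm iA).
apply: le_lt_trans (integrable_lty measurableT iAB).
by rewrite le_eqVlt; apply/orP; left; apply/eqP; apply: eq_integral => x _ /=; rewrite EFinM.
Qed.

Let Fin1 x : (\int[mu]_y (EFin \o h) (x, y))%E = (\int[mu]_y h (x, y))%:E.
Proof. by rewrite /Rintegral fineK//; exact: (integrable_fin_num _ (integrable_slice1 x)). Qed.

Let Fin2 y : (\int[mu]_x (EFin \o h) (x, y))%E = (\int[mu]_x h (x, y))%:E.
Proof. by rewrite /Rintegral fineK//; exact: (integrable_fin_num _ (integrable_slice2 y)). Qed.

Lemma Rintegral_swap :
  \int[mu]_x (\int[mu]_y h (x, y)) = \int[mu]_y (\int[mu]_x h (x, y)).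
Proof.
rewrite /Rintegral; congr fine.
transitivity (\int[mu]_x \int[mu]_y (EFin \o h) (x, y))%E.
  by apply: eq_integral => x _; exact/esym/Fin1.
rewrite (Fubini integrable_product_dominated).
by apply: eq_integral => y _; exact: Fin2.
Qed.

End Fubini.

End IntegrationTools.

(** * Calculus on intervals *)

Section CalculusTools.
Context {R : realType}.
Local Notation mu := (@lebesgue_measure R).
Implicit Types (f g F G : R -> R) (a b x : R).

Lemma derivable_continuous f : (forall x, derivable f x 1) -> continuous f.
Proof. by move=> df x; apply/differentiable_continuous/derivable1_diffP. Qed.

Lemma derivable_LRcontinuous f a b : (forall x, derivable f x 1) ->
  derivable_oo_LRcontinuous f a b.
Proof.
move=> df; have cf := derivable_continuous df.
split; first by move=> x _; exact: df.
- by apply: cvg_at_right_filter; exact: cf.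
- by apply: cvg_at_left_filter; exact: cf.
Qed.

Lemma Rintegral_derive f F a b : a <= b -> continuous f ->
  (forall x, is_derive x 1 F (f x)) ->
  \int[mu]_(x in `[a, b]) f x = F b - F a.
Proof.
rewrite le_eqVlt => /predU1P[-> _ _|ab cf dF].
  by rewrite set_itv1 Rintegral_set1 subrr.
rewrite /Rintegral (@continuous_FTC2 _ f F a b) //.
- exact: continuous_subspaceT.
- by apply: derivable_LRcontinuous => x; case: (dF x).
- by move=> x _; rewrite derive1E derive_val.
Qed.

Lemma continuous_integrable_itv f a b : continuous f ->
  mu.-integrable `[a, b] (EFin \o f).
Proof.
move=> cf; apply: continuous_compact_integrable; first exact: segment_compact.
exact: continuous_subspaceT.
Qed.

(** The reflection preserves the Lebesgue measure and changes the sign of the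
    integrand, so the integral is its own opposite. *)
Lemma Rintegral_odd f : mu.-integrable setT (EFin \o f) ->
  (forall x, f (- x) = - f x) -> Rintegral mu setT f = 0.
Proof.
move=> intf odd.
have mN : measurable_fun [set: measurableTypeR R] (-%R : R -> measurableTypeR R).
  exact: (@oppr_measurable R).
have iN : mu.-integrable setT ((EFin \o f) \o (-%R : R -> measurableTypeR R)).
  apply: eq_integrable (integrableN intf) => // x _.
  by rewrite /= odd.
have := integral_pushforward mN (measurable_int mu intf) iN measurableT.
rewrite [X in X = _](eq_measure_integral mu); last first.
  by move=> A mA _; exact: lebesgue_measureN.
rewrite preimage_setT => fN.
have : Rintegral mu setT f = Rintegral mu setT (fun x => -1 * f x).
  rewrite /Rintegral; congr fine; apply: (etrans fN).
  by apply: eq_integral => x _; rewrite /= odd mulN1r.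
rewrite RintegralZl// mulN1r => /eqP.
by rewrite -subr_eq0 opprK -mulr2n mulrn_eq0 /= => /eqP.
Qed.

End CalculusTools.

(** * Bump functions *)

Section Bumps.
Context {R : realType}.
Local Notation mu := (@lebesgue_measure R).
Implicit Types (a b g G : R -> R).

Definition smooth a := forall (n : nat) (x : R), derivable (derive1n n a) x 1.

(** The radius [3 / 4] is the one of the Littlewood-Paley cutoffs, whose real and
    imaginary parts are the bumps of interest. *)
Definition bump a := smooth a /\ forall x, 3 / 4 < `|x| -> a x = 0.

Lemma smooth_derivable a : smooth a -> forall x, derivable a x 1.
Proof. by move=> sa x; exact: (sa 0%N). Qed.

Lemma derive1n_derive1 a n : derive1n n (derive1 a) = derive1n n.+1 a.
Proof. by rewrite /derive1n -iterSr. Qed.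

Lemma smooth_derive1 a : smooth a -> smooth (derive1 a).
Proof. by move=> sa n x; rewrite derive1n_derive1. Qed.

Lemma bump_derive1 a : bump a -> bump (derive1 a).
Proof.
move=> [sa a0]; split; first exact: smooth_derive1.
move=> x x34; rewrite derive1E.
have nx : \forall y \near x, a y = (cst 0 : R -> R) y.
  have : \forall y \near x, 3 / 4 < `|y|.
    have cn : continuous (fun y : R => `|y|) by exact: norm_continuous.
    exact: (cvgr_gt _ (cn x)).
  by apply: filterS => y /a0.
by rewrite (near_eq_derive _ nx)// derive_cst.
Qed.

Lemma bump_derivable a : bump a -> forall x, derivable a x 1.
Proof. by move=> [/smooth_derivable]. Qed.

Lemma bump_continuous a : bump a -> continuous a.
Proof. by move=> /bump_derivable; exact: derivable_continuous. Qed.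

Lemma bump_eq0 a x : bump a -> 1 <= `|x| -> a x = 0.
Proof. by move=> [_ a0] x1; apply: a0; apply: lt_le_trans x1; lra. Qed.

Lemma bump_bounded a : bump a -> exists M, forall x, `|a x| <= M.
Proof.
move=> ba; have ca := bump_continuous ba.
have cn : continuous (fun x => `|a x|).
  by move=> x; apply: cvg_norm; exact: ca.
have [|c _ cM] := @EVT_max R (fun x => `|a x|) (-1) 1 _ (continuous_subspaceT cn); first by lra.
exists `|a c| => x; have [x1|x1] := leP 1 `|x|.
  by rewrite (bump_eq0 ba x1) normr0.
apply: cM; rewrite in_itv/=; move: x1; rewrite ltr_norml => /andP[? ?]; lra.
Qed.

Lemma bump_support a : bump a -> a = (fun x => \1_`[-1, 1] x * a x).
Proof.
move=> ba; apply/funext => x; rewrite indicE mem_setE in_itv /= -ler_norml.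
have [x1|/ltW x1] := leP `|x| 1; first by rewrite mul1r.
by rewrite mul0r; exact: bump_eq0 ba x1.
Qed.

Lemma bump_mul_integrable a g : bump a -> continuous g ->
  mu.-integrable setT (EFin \o (fun x => g x * a x)).
Proof.
move=> ba cg.
rewrite (_ : (fun x => g x * a x) = (fun x => \1_`[-1, 1] x * (g x * a x))).
  apply: integrable_indicM => //; apply: continuous_integrable_itv.
  by move=> x; apply: cvgM; [exact: cg|exact: bump_continuous].
by apply/funext => x; rewrite {1}(bump_support ba) mulrCA.
Qed.

Lemma bump_integrable a : bump a -> mu.-integrable setT (EFin \o a).
Proof.
move=> ba; have := bump_mul_integrable ba (@cst_continuous _ _ (1 : R)).
by apply: eq_integrable => // x _ /=; rewrite mul1r.
Qed.

Lemma bump_mul_integral a g : bump a ->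
  Rintegral mu setT (fun x => g x * a x) = \int[mu]_(x in `[-1, 1]) (g x * a x).
Proof.
move=> ba; rewrite [RHS]Rintegral_indic//; apply: eq_Rintegral => x _.
by rewrite {1}(bump_support ba) mulrCA.
Qed.

(** The boundary terms at [-1] and [1] are outside the support. *)
Lemma bump_integration_by_parts a G g : bump a -> continuous g ->
  (forall x : R, is_derive x 1 G (g x)) ->
  Rintegral mu setT (fun x => g x * a x) = - Rintegral mu setT (fun x => G x * (derive1 a) x).
Proof.
move=> ba cg dG; have ba' := bump_derive1 ba.
rewrite !bump_mul_integral//.
have dG1 x : derivable G x 1 by case: (dG x).
under eq_Rintegral do rewrite mulrC.
rewrite (@Rintegration_by_parts _ a G (derive1 a) g (-1) 1) //.
- rewrite !(bump_eq0 ba) ?normrN ?normr1// !mul0r subr0 sub0r.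
  by congr (- _); apply: eq_Rintegral => x _; rewrite mulrC.
- by apply: continuous_subspaceT; exact: bump_continuous.
- exact/derivable_LRcontinuous/bump_derivable.
- exact: continuous_subspaceT.
- exact: derivable_LRcontinuous.
- by move=> x _; rewrite derive1E derive_val.
Qed.

End Bumps.

(** * Cosine and sine transforms of bumps *)

Section TrigTransforms.
Context {R : realType}.
Local Notation mu := (@lebesgue_measure R).
Implicit Types (a b f : R -> R) (c d x xi : R).

Lemma is_derive_affine c d x : is_derive x 1 (fun y : R => c * y + d) c.
Proof.
have -> : (fun y => c * y + d) = (c \*: id) + cst d by apply/funext.
by apply: is_derive_eq; rewrite addr0 /GRing.scale/= mulr1.
Qed.

Lemma is_derive_comp_affine f df c d x : is_derive (c * x + d) 1 f df ->
  is_derive x 1 (fun y => f (c * y + d)) (df * c).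
Proof.
move=> fdf; have H := is_derive_affine c d x.
exact: (@is_derive1_comp _ f (fun y => c * y + d)).
Qed.

Lemma is_derive_cosM c x : is_derive x 1 (fun y => cos (c * y)) (- sin (c * x) * c).
Proof.
have -> : (fun y => cos (c * y)) = (fun y => cos (c * y + 0)).
  by apply/funext => y; rewrite addr0.
by rewrite -(addr0 (c * x)); apply: is_derive_comp_affine; exact: is_derive_cos.
Qed.

Lemma is_derive_sinM c x : is_derive x 1 (fun y => sin (c * y)) (cos (c * x) * c).
Proof.
have -> : (fun y => sin (c * y)) = (fun y => sin (c * y + 0)).
  by apply/funext => y; rewrite addr0.
by rewrite -(addr0 (c * x)); apply: is_derive_comp_affine; exact: is_derive_sin.
Qed.

Lemma continuous_cosM c : continuous (fun y => cos (c * y)).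
Proof. by apply: derivable_continuous => x; case: (is_derive_cosM c x). Qed.

Lemma continuous_sinM c : continuous (fun y => sin (c * y)).
Proof. by apply: derivable_continuous => x; case: (is_derive_sinM c x). Qed.

Lemma cos_norm_le1 x : `|cos x| <= 1.
Proof. by rewrite ler_norml cos_geN1 cos_le1. Qed.

Lemma sin_norm_le1 x : `|sin x| <= 1.
Proof. by rewrite ler_norml sin_geN1 sin_le1. Qed.

(** The Fourier transform is split into a cosine and a sine part so that the
    analysis takes place over the reals. *)
Definition cos_transform a x :=
  Rintegral mu setT (fun xi => cos (2 * pi * x * xi) * a xi).
Definition sin_transform a x :=
  Rintegral mu setT (fun xi => sin (2 * pi * x * xi) * a xi).

Lemma cos_integrable a x : bump a ->
  mu.-integrable setT (EFin \o (fun xi => cos (2 * pi * x * xi) * a xi)).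
Proof. by move=> ba; apply: bump_mul_integrable => //; exact: continuous_cosM. Qed.

Lemma sin_integrable a x : bump a ->
  mu.-integrable setT (EFin \o (fun xi => sin (2 * pi * x * xi) * a xi)).
Proof. by move=> ba; apply: bump_mul_integrable => //; exact: continuous_sinM. Qed.

Let norm_integrable a : bump a -> mu.-integrable setT (EFin \o (fun xi => `|a xi|)).
Proof. by move=> ba; exact: integrable_norm (bump_integrable ba). Qed.

Lemma cos_transform_le a x : bump a ->
  `|cos_transform a x| <= Rintegral mu setT (fun xi => `|a xi|).
Proof.
move=> ba; apply: normr_Rintegral_le (norm_integrable ba).
  exact: integrable_measurable (cos_integrable x ba).
by move=> xi; rewrite normrM ler_piMl// cos_norm_le1.
Qed.

Lemma sin_transform_le a x : bump a ->
  `|sin_transform a x| <= Rintegral mu setT (fun xi => `|a xi|).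
Proof.
move=> ba; apply: normr_Rintegral_le (norm_integrable ba).
  exact: integrable_measurable (sin_integrable x ba).
by move=> xi; rewrite normrM ler_piMl// sin_norm_le1.
Qed.

Lemma cos_transform_derive a x : bump a ->
  2 * pi * x * cos_transform a x = - sin_transform (derive1 a) x.
Proof.
move=> ba; rewrite -RintegralZl//; last exact: cos_integrable.
have cg : continuous (fun xi => cos (2 * pi * x * xi) * (2 * pi * x)).
  by move=> xi; apply: cvgMr_tmp; exact: continuous_cosM.
have := bump_integration_by_parts ba cg (is_derive_sinM (2 * pi * x)).
by rewrite /sin_transform => <-; apply: eq_Rintegral => xi _; ring.
Qed.

Lemma sin_transform_derive a x : bump a ->
  2 * pi * x * sin_transform a x = cos_transform (derive1 a) x.
Proof.
move=> ba; rewrite -RintegralZl//; last exact: sin_integrable.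
have cg : continuous (fun xi => - sin (2 * pi * x * xi) * (2 * pi * x)).
  by move=> xi; apply: cvgMr_tmp; apply: cvgN; exact: continuous_sinM.
have := bump_integration_by_parts ba cg (is_derive_cosM (2 * pi * x)).
rewrite -/(cos_transform _ _) => /(congr1 -%R); rewrite opprK => <-.
rewrite -mulN1r -RintegralZl//; last exact: bump_mul_integrable.
by apply: eq_Rintegral => xi _; ring.
Qed.

Let sqr_le_twopi x : x ^+ 2 <= (2 * pi * x) ^+ 2.
Proof.
rewrite exprMn ler_peMl ?sqr_ge0// exprn_ege1//.
by have := @pi_ge2 R; lra.
Qed.

(** [oneDsqr x ^+ 2] expands into [1 + 2 * x ^+ 2 + x ^+ 4], and each of the three
    products with [T] is controlled by one of the bounds. *)
Let decay_from_moments (m0 m2 m4 T x : R) : 0 <= T -> T <= m0 ->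
  (2 * pi * x) ^+ 2 * T <= m2 -> (2 * pi * x) ^+ 2 * ((2 * pi * x) ^+ 2 * T) <= m4 ->
  T <= (m0 + 2 * m2 + m4) / oneDsqr x ^+ 2.
Proof.
move=> T0 h0 h2 h4; rewrite ler_pdivlMr ?exprn_gt0// /oneDsqr.
have h := sqr_le_twopi x.
set y := (2 * pi * x) ^+ 2 in h h2 h4.
have hx := sqr_ge0 x.
have k2 : x ^+ 2 * T <= y * T by rewrite ler_wpM2r.
have k4 : x ^+ 2 * (x ^+ 2 * T) <= y * (y * T).
  by apply: ler_pM => //; exact: mulr_ge0.
nra.
Qed.

Lemma cos_transform_derive2 a x : bump a ->
  (2 * pi * x) ^+ 2 * `|cos_transform a x| = `|cos_transform (derive1 (derive1 a)) x|.
Proof.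
move=> ba; have b1 := bump_derive1 ba.
rewrite -sin_transform_derive// -[sin_transform _ _]opprK -cos_transform_derive//.
by rewrite mulrN normrN mulrA -expr2 normrM (ger0_norm (sqr_ge0 _)).
Qed.

Lemma sin_transform_derive2 a x : bump a ->
  (2 * pi * x) ^+ 2 * `|sin_transform a x| = `|sin_transform (derive1 (derive1 a)) x|.
Proof.
move=> ba; have b1 := bump_derive1 ba.
rewrite -[RHS]normrN -cos_transform_derive// -sin_transform_derive//.
by rewrite mulrA -expr2 normrM (ger0_norm (sqr_ge0 _)).
Qed.

(** Two derivatives of the bump gain a factor [(2 * pi * x) ^- 2], so that four of
    them give a decay of order 4. *)
Lemma cos_transform_decay a : bump a ->
  exists C, forall x, `|cos_transform a x| <= C / oneDsqr x ^+ 2.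
Proof.
move=> ba; have b2 := bump_derive1 (bump_derive1 ba).
have b4 := bump_derive1 (bump_derive1 b2).
pose I b := Rintegral mu setT (fun xi => `|b xi|).
exists (I a + 2 * I (derive1 (derive1 a)) + I (derive1 (derive1 (derive1 (derive1 a))))) => x.
apply: decay_from_moments => //; rewrite ?cos_transform_derive2//;
  exact: cos_transform_le.
Qed.

Lemma sin_transform_decay a : bump a ->
  exists C, forall x, `|sin_transform a x| <= C / oneDsqr x ^+ 2.
Proof.
move=> ba; have b2 := bump_derive1 (bump_derive1 ba).
have b4 := bump_derive1 (bump_derive1 b2).
pose I b := Rintegral mu setT (fun xi => `|b xi|).
exists (I a + 2 * I (derive1 (derive1 a)) + I (derive1 (derive1 (derive1 (derive1 a))))) => x.
apply: decay_from_moments => //; rewrite ?sin_transform_derive2//;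
  exact: sin_transform_le.
Qed.

Let continuous_scale xi : continuous (fun x => 2 * pi * x * xi).
Proof.
by move=> x; apply: cvgMr_tmp; apply: cvgMl_tmp; exact: cvg_id.
Qed.

Lemma cos_transform_continuous a : bump a -> continuous (cos_transform a).
Proof.
move=> ba x; pose f x xi := cos (2 * pi * x * xi) * a xi.
have cf : {ae mu, forall xi, setT xi -> {in `]x - 1, x + 1[%classic, continuous (f ^~ xi)}}.
  apply: aeW => xi _ y _; rewrite /f; apply: cvgMr_tmp.
  apply: (@continuous_comp _ _ _ (fun x => 2 * pi * x * xi) cos).
    exact: continuous_scale.
  exact: continuous_cos.
have f_ub y : `]x - 1, x + 1[%classic y ->
    {ae mu, forall xi, setT xi -> `|f y xi| <= `|a xi|}.
  by move=> _; apply: aeW => xi _; rewrite normrM ler_piMl// cos_norm_le1.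
apply: (continuity_under_integral measurableT (fun y _ => cos_integrable y ba)
  cf (norm_integrable ba) f_ub).
by rewrite inE/= in_itv/=; apply/andP; split; lra.
Qed.

Lemma sin_transform_continuous a : bump a -> continuous (sin_transform a).
Proof.
move=> ba x; pose f x xi := sin (2 * pi * x * xi) * a xi.
have cf : {ae mu, forall xi, setT xi -> {in `]x - 1, x + 1[%classic, continuous (f ^~ xi)}}.
  apply: aeW => xi _ y _; rewrite /f; apply: cvgMr_tmp.
  apply: (@continuous_comp _ _ _ (fun x => 2 * pi * x * xi) sin).
    exact: continuous_scale.
  exact: continuous_sin.
have f_ub y : `]x - 1, x + 1[%classic y ->
    {ae mu, forall xi, setT xi -> `|f y xi| <= `|a xi|}.
  by move=> _; apply: aeW => xi _; rewrite normrM ler_piMl// sin_norm_le1.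
apply: (continuity_under_integral measurableT (fun y _ => sin_integrable y ba)
  cf (norm_integrable ba) f_ub).
by rewrite inE/= in_itv/=; apply/andP; split; lra.
Qed.

End TrigTransforms.

(** * The damped cosine integral *)

Section Inversion.
Context {R : realType}.
Local Notation mu := (@lebesgue_measure R).
Implicit Types (a : R -> R) (b c e x xi : R).

Lemma integral_oneDsqrV : (\int[mu]_x (oneDsqr x)^-1%:E = pi%:E)%E.
Proof.
rewrite ge0_symfun_integralT//=.
- rewrite -set_itvcy integral0y_oneDsqr -EFinM.
  by congr EFin; rewrite mulrC divfK.
- exact: continuous_oneDsqrV.
- by move=> x /=; rewrite /oneDsqr sqrrN.
Qed.

Lemma integrable_oneDsqrV : mu.-integrable setT (EFin \o (fun x => (oneDsqr x)^-1)).
Proof.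
apply/integrableP; split.
  apply/measurable_EFinP; apply: continuous_measurable_fun.
  exact: continuous_oneDsqrV.
under eq_integral do rewrite /= ger0_norm ?invr_ge0//.
by rewrite integral_oneDsqrV ltry.
Qed.

Lemma integral_oneDsqrV_affine c b : 0 < c ->
  (\int[mu]_x (oneDsqr (c * x - b))^-1%:E = (c^-1 * pi)%:E)%E.
Proof.
move=> c0.
have dF x : is_derive x 1 (fun y => c * y - b) c by exact: is_derive_affine.
have F'E : derive1 (fun y => c * y - b) = cst c.
  by apply/funext => x; rewrite derive1E derive_val.
have := @increasing_ge0_integration_by_substitutionT R (fun y => c * y - b)
  (fun x => (oneDsqr x)^-1).
rewrite integral_oneDsqrV F'E => H.
have {}H : (pi%:E = c%:E * \int[mu]_x (oneDsqr (c * x - b))^-1%:E)%E.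
  rewrite H//.
  - rewrite -ge0_integralZl//; last 2 first.
    + apply/measurable_EFinP; apply: continuous_measurable_fun.
      move=> y; apply: (@continuous_comp _ _ _ (fun y : R => c * y - b) (fun x => (oneDsqr x)^-1)).
        by apply: derivable_continuous => z; case: (dF z).
      exact: continuous_oneDsqrV.
    + by rewrite lee_fin ltW.
    by apply: eq_integral => x _; rewrite -EFinM mulrC.
  - by move=> x y xy; rewrite ltrD2r ltr_pM2l.
  - by move=> x; exact: cvg_cst.
  - exact: is_cvg_cst.
  - exact: is_cvg_cst.
  - apply/cvgrNyPle => A; near=> x.
    rewrite lerBlDr mulrC -ler_pdivlMr//; near: x.
  - apply/cvgryPge => A; near=> x.
    rewrite lerBrDr mulrC -ler_pdivrMr//; near: x.
  - exact: continuous_oneDsqrV.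
by rewrite EFinM H muleA -EFinM mulVf ?gt_eqF// mul1e.
Unshelve. all: by end_near. Qed.

Definition damping e x := expR (- e * `|x|).

Lemma continuous_damping e : continuous (damping e).
Proof.
move=> x; apply: (@continuous_comp _ _ _ (fun x => - e * `|x|) expR).
  by apply: cvgMl_tmp; exact: norm_continuous.
exact: continuous_expR.
Qed.

Section DampedCosine.
Variables (e b : R).
Hypothesis e0 : 0 < e.

Let D : R := e ^+ 2 + b ^+ 2.

Let D0 : D != 0. Proof. by rewrite gt_eqF// ltr_pwDl ?sqr_ge0// exprn_gt0. Qed.

Let primitive x : R :=
  expR (- e * x) * (- e^-1 + (b * sin (b * x) - e * cos (b * x)) / D).

Let is_derive_primitive x :
  is_derive x 1 primitive (expR (- e * x) * (1 + cos (b * x))).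
Proof.
have dE : is_derive x 1 (fun x => expR (- e * x)) (expR (- e * x) * (- e)).
  have -> : (fun x => expR (- e * x)) = (fun x => expR (- e * x + 0)).
    by apply/funext => y; rewrite addr0.
  by rewrite -(addr0 (- e * x)); apply: is_derive_comp_affine; exact: is_derive_expR.
have dC := is_derive_cosM b x; have dS := is_derive_sinM b x.
have -> : primitive = (fun x => expR (- e * x)) *
    (cst (- e^-1) + D^-1 \*: (b \*: (fun x => sin (b * x)) - e \*: (fun x => cos (b * x)))).
  by apply/funext => y; rewrite /primitive/= !fctE /GRing.scale/= [X in _ * (_ + X)]mulrC.
apply: is_derive_eq; rewrite !fctE /GRing.scale/=.
have ne0 : e != 0 by rewrite gt_eqF.
have D0' : e ^+ 2 + b ^+ 2 != 0 by exact: D0.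
have sE (k u : R) : k *: (u : R^o) = k * u by [].
by rewrite /D !sE; field; rewrite ne0 D0'.
Qed.

Let cvg_primitive : primitive x @[x --> +oo] --> (0 : R).
Proof.
pose M := e^-1 + (`|b| + e) / D.
have Dp : 0 < D by rewrite /D ltr_pwDl ?sqr_ge0// exprn_gt0.
have cE : (expR (- e * x) * M) @[x --> +oo] --> (0 : R).
  rewrite -[X in _ --> X](mul0r M); apply: cvgMr_tmp.
  have : expR (- y) @[y --> +oo] --> (0 : R) by exact: cvgr_expR.
  have : (e * x) @[x --> +oo] --> +oo.
    apply/cvgryPge => A; near=> x.
    rewrite mulrC -ler_pdivrMr//; near: x.
  move=> h1 h2; have := cvg_comp _ _ h1 h2.
  by apply: cvg_trans; apply: near_eq_cvg; near=> x; rewrite /= mulNr.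
have cE' : (- (expR (- e * x) * M)) @[x --> +oo] --> (0 : R).
  by rewrite -oppr0; apply: cvgN.
apply: (squeeze_cvgr _ cE' cE); near=> x.
rewrite -ler_norml normrM ger0_norm ?expR_ge0// ler_wpM2l ?expR_ge0//.
rewrite (le_trans (ler_normD _ _))// normrN ger0_norm ?invr_ge0 ?(ltW e0)// lerD2l.
rewrite normrM [X in _ * X]ger0_norm ?invr_ge0 ?(ltW Dp)//.
rewrite ler_wpM2r ?invr_ge0 ?(ltW Dp)// (le_trans (ler_normB _ _))// !normrM.
apply: lerD; first by rewrite ler_piMr// sin_norm_le1.
by rewrite (ger0_norm (ltW e0)) ler_piMr ?(ltW e0)// cos_norm_le1.
Unshelve. all: by end_near. Qed.

Let integral_damping_half :
  (\int[mu]_(x in `[0%R, +oo[) (expR (- e * x) * (1 + cos (b * x)))%:E =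
   (e^-1 + e / D)%:E)%E.
Proof.
have cC : continuous (fun y => cos (b * y)) by exact: continuous_cosM.
rewrite (@ge0_continuous_FTC2y _ _ primitive 0 0).
- have -> : primitive 0 = - (e^-1 + e / D).
    by rewrite /primitive !mulr0 expR0 sin0 cos0 mul1r mulr0 sub0r mulr1 mulNr opprD.
  by rewrite -EFinN opprK add0e.
- move=> x _; rewrite mulr_ge0 ?expR_ge0//; have := cos_geN1 (b * x); lra.
- apply: continuous_subspaceT => x; apply: cvgM.
    apply: (@continuous_comp _ _ _ (fun x => - e * x) expR).
      by apply: cvgMl_tmp; exact: cvg_id.
    exact: continuous_expR.
  by apply: cvgD; [exact: cvg_cst|exact: cC].
- exact: cvg_primitive.
- by move=> x _; case: (is_derive_primitive x).
- apply: cvg_at_right_filter; apply: derivable_continuous => x.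
  by case: (is_derive_primitive x).
- by move=> x _; rewrite derive1E; have := is_derive_primitive x => ?; rewrite derive_val.
Qed.

(** Adding 1 to the cosine keeps the integrand nonnegative, so that the
    fundamental theorem of calculus applies on the half-line; the integral of the
    cosine alone is then a difference with the case [b = 0]. *)
Lemma integral_damping1Dcos :
  (\int[mu]_x (damping e x * (1 + cos (b * x)))%:E = (2 * (e^-1 + e / D))%:E)%E.
Proof.
have cC : continuous (fun y => cos (b * y)) by exact: continuous_cosM.
rewrite ge0_symfun_integralT//=.
- rewrite -set_itvcy EFinM -integral_damping_half; congr (_ * _)%E.
  apply: eq_integral => x; rewrite inE/= in_itv/= andbT => x0.
  by rewrite /damping ger0_norm.
- move=> x; rewrite mulr_ge0 ?expR_ge0//; have := cos_geN1 (b * x); lra.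
- move=> x; apply: cvgM; first exact: continuous_damping.
  by apply: cvgD; [exact: cvg_cst|exact: cC].
- by move=> x /=; rewrite /damping normrN mulrN cosN.
Qed.

End DampedCosine.

Lemma integral_damping e : 0 < e -> (\int[mu]_x (damping e x)%:E = (2 * e^-1)%:E)%E.
Proof.
move=> e0; have := integral_damping1Dcos 0 e0.
have -> : (\int[mu]_x (damping e x * (1 + cos (0 * x)))%:E =
           2%:E * \int[mu]_x (damping e x)%:E)%E.
  rewrite -ge0_integralZl//.
  - by apply: eq_integral => x _; rewrite mul0r cos0 -EFinM mulrC.
  - apply/measurable_EFinP; apply: continuous_measurable_fun.
    exact: continuous_damping.
  - by move=> x _; rewrite lee_fin expR_ge0.
rewrite expr0n/= addr0 expr2 invfM mulrA divff ?gt_eqF// mul1r => h.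
have : ((2^-1)%:E * (2%:E * \int[mu]_x (damping e x)%:E) = (2^-1)%:E * (2 * (e^-1 + e^-1))%:E)%E.
  by rewrite h.
rewrite muleA -!EFinM mulVf// mul1e => ->; congr EFin.
by rewrite mulrA mulVf// mul1r mulr_natl mulr2n.
Qed.

Lemma integrable_damping e : 0 < e -> mu.-integrable setT (EFin \o damping e).
Proof.
move=> e0; apply/integrableP; split.
  apply/measurable_EFinP; apply: continuous_measurable_fun.
  exact: continuous_damping.
under eq_integral do rewrite /= ger0_norm ?expR_ge0//.
by rewrite integral_damping// ltry.
Qed.

Lemma Rintegral_damping_cos e b : 0 < e ->
  Rintegral mu setT (fun x => damping e x * cos (b * x)) = 2 * e / (e ^+ 2 + b ^+ 2).
Proof.
move=> e0.
have iC : mu.-integrable setT (EFin \o (fun x => damping e x * cos (b * x))).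
  apply: integrable_mul_bounded (integrable_damping e0).
    by apply: continuous_measurable_fun; exact: continuous_cosM.
  by move=> x; exact: cos_norm_le1.
have := integral_damping1Dcos b e0; move=> /(congr1 fine) /=.
rewrite -/(Rintegral mu setT (fun x => damping e x * (1 + cos (b * x)))).
under eq_Rintegral do rewrite mulrDr mulr1.
rewrite RintegralD//; last exact: integrable_damping.
rewrite {1}/Rintegral integral_damping//= mulrDr => /addrI ->.
by rewrite mulrA.
Qed.

End Inversion.

(** * Fourier inversion at the origin *)

Section InversionAtZero.
Context {R : realType}.
Local Notation mu := (@lebesgue_measure R).
Implicit Types (a : R -> R) (b c e x xi : R).

Lemma bounded_decay_integrable (f : R -> R) C : continuous f ->
  (forall x, `|f x| <= C / oneDsqr x ^+ 2) -> mu.-integrable setT (EFin \o f).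
Proof.
move=> cf fC.
have C0 : 0 <= C.
  have := fC 0; rewrite /oneDsqr expr0n/= addr0 expr1n divr1.
  exact: le_trans (normr_ge0 _).
apply: (@integrable_dominated _ _ (fun x => C * (oneDsqr x)^-1)).
- exact: continuous_measurable_fun.
- move=> x; rewrite (le_trans (fC x))// ler_wpM2l// lef_pV2 ?posrE ?exprn_gt0//.
  by rewrite expr2 ler_peMl.
- by apply: eq_integrable (integrableZl measurableT C integrable_oneDsqrV) => // x _; rewrite /= EFinM.
Qed.

Lemma cos_transform_integrable a : bump a ->
  mu.-integrable setT (EFin \o cos_transform a).
Proof.
move=> ba; have [C hC] := cos_transform_decay ba.
exact: bounded_decay_integrable (cos_transform_continuous ba) hC.
Qed.

Lemma sin_transform_integrable a : bump a ->
  mu.-integrable setT (EFin \o sin_transform a).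
Proof.
move=> ba; have [C hC] := sin_transform_decay ba.
exact: bounded_decay_integrable (sin_transform_continuous ba) hC.
Qed.

Lemma sin_transform_integral a : bump a -> Rintegral mu setT (sin_transform a) = 0.
Proof.
move=> ba; apply: Rintegral_odd; first exact: sin_transform_integrable.
move=> x; rewrite /sin_transform -[RHS]mulN1r -RintegralZl//; last exact: sin_integrable.
by apply: eq_Rintegral => xi _; rewrite mulrN mulNr sinN; ring.
Qed.

Let measurable_phase : measurable_fun setT (fun z : R * R => 2 * pi * z.1 * z.2).
Proof.
apply: measurable_funM; last exact: measurable_snd.
by apply: measurable_funM => //; exact: measurable_fst.
Qed.

(** By Fubini's theorem, damping the transform amounts to averaging the bump
    against a Poisson kernel. *)
Lemma damped_cos_transform a e : bump a -> 0 < e ->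
  Rintegral mu setT (fun x => damping e x * cos_transform a x) =
  Rintegral mu setT (fun xi => 2 * e / (e ^+ 2 + (2 * pi * xi) ^+ 2) * a xi).
Proof.
move=> ba e0.
pose h (z : R * R) := damping e z.1 * (cos (2 * pi * z.1 * z.2) * a z.2).
have md := continuous_measurable_fun (@continuous_damping R e).
have ma := continuous_measurable_fun (bump_continuous ba).
have mh : measurable_fun setT h.
  apply: measurable_funM; first exact: (measurableT_comp md measurable_fst).
  apply: measurable_funM; last exact: (measurableT_comp ma measurable_snd).
  apply: measurableT_comp measurable_phase.
  by apply: continuous_measurable_fun; exact: continuous_cos.
have hAB x xi : `|h (x, xi)| <= damping e x * `|a xi|.
  rewrite /h /= normrM ger0_norm ?expR_ge0// ler_wpM2l ?expR_ge0//.
  by rewrite normrM ler_piMl// cos_norm_le1.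
have := Rintegral_swap mh (integrable_damping e0) (integrable_norm (bump_integrable ba)) hAB.
rewrite /h /= => hswap.
transitivity (\int[mu]_x \int[mu]_y (damping e x * (cos (2 * pi * x * y) * a y))).
  apply: eq_Rintegral => x _; rewrite RintegralZl//; exact: cos_integrable.
rewrite hswap; apply: eq_Rintegral => xi _.
rewrite -Rintegral_damping_cos// -RintegralZr//.
  by apply: eq_Rintegral => x _; rewrite mulrA; congr (_ * cos _ * _); ring.
apply: integrable_mul_bounded (integrable_damping e0).
  by apply: continuous_measurable_fun; exact: continuous_cosM.
by move=> x; exact: cos_norm_le1.
Qed.

Let is_derive_poisson e xi : 0 < e ->
  is_derive xi 1 (fun y => pi^-1 * atan (2 * pi / e * y))
    (2 * e / (e ^+ 2 + (2 * pi * xi) ^+ 2)).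
Proof.
move=> e0; have e_neq0 : e != 0 by rewrite gt_eqF.
have pi_neq0 : (pi : R) != 0 by rewrite gt_eqF ?pi_gt0.
pose c := 2 * pi / e.
have dA : is_derive xi 1 (fun y => atan (c * y)) ((1 + (c * xi) ^+ 2)^-1 * c).
  have -> : (fun y => atan (c * y)) = (fun y => atan (c * y + 0)).
    by apply/funext => y; rewrite addr0.
  by rewrite -(addr0 (c * xi)); apply: is_derive_comp_affine; exact: is_derive1_atan.
have -> : (fun y => pi^-1 * atan (2 * pi / e * y)) = pi^-1 \*: (fun y => atan (c * y)).
  by apply/funext.
apply: is_derive_eq.
have sE (k u : R) : k *: (u : R^o) = k * u by [].
have d1 : e ^+ 2 + (2 * pi * xi) ^+ 2 != 0.
  by rewrite gt_eqF// ltr_pwDl ?sqr_ge0// exprn_gt0.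
have d2 : 1 + (2 * pi / e * xi) ^+ 2 != 0 by rewrite gt_eqF// ltr_pwDl ?sqr_ge0.
rewrite sE /c; move: pi_neq0 d1 d2; move: (@pi R) => q q0 d1 d2.
by field; rewrite e_neq0 q0 d1.
Qed.

(** The primitive of the Poisson kernel is an arctangent: it is bounded, and tends
    to half the sign function as [e] tends to 0. After this integration by parts
    the limit is a matter of dominated convergence. *)
Lemma damped_cos_transform_parts a e : bump a -> 0 < e ->
  Rintegral mu setT (fun x => damping e x * cos_transform a x) =
  - Rintegral mu setT (fun xi => pi^-1 * atan (2 * pi / e * xi) * derive1 a xi).
Proof.
move=> ba e0; rewrite damped_cos_transform//.
apply: bump_integration_by_parts => //; last by move=> x; exact: is_derive_poisson.
move=> x; apply: cvgMl_tmp; apply: cvgV.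
  by rewrite gt_eqF// ltr_pwDl ?sqr_ge0// exprn_gt0.
apply: cvgD; first exact: cvg_cst.
have c1 : continuous (fun x : R => 2 * pi * x).
  by move=> y; apply: cvgMl_tmp; exact: cvg_id.
by apply: (@continuous_comp _ _ _ (fun x => 2 * pi * x) (fun y => y ^+ 2));
  [exact: c1|exact: exprn_continuous].
Qed.

Lemma Rintegral_sg_derive1 a : bump a ->
  Rintegral mu setT (fun xi => Num.sg xi * derive1 a xi) = - (2 * a 0).
Proof.
move=> ba; have ba' := bump_derive1 ba; have ca' := bump_continuous ba'.
have da x : is_derive x 1 a (derive1 a x).
  by rewrite derive1E; apply: DeriveDef => //; exact: bump_derivable.
transitivity (Rintegral mu setT (fun x => \1_`[0, 1] x * derive1 a x - \1_`[-1, 0] x * derive1 a x)).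
  apply: eq_Rintegral => x _; rewrite -mulrBl !indicE !mem_setE !in_itv/=.
  have [x1|x1] := leP 1 `|x|; first by rewrite (bump_eq0 ba' x1) !mulr0.
  move: x1; rewrite ltr_norml => /andP[x1 x2]; congr (_ * _).
  rewrite (ltW x1) (ltW x2) andbT /=.
  by case: sgrP => x0; rewrite ?x0 ?lexx ?(ltW x0) ?subrr ?sub0r ?subr0// leNgt x0/= ?subr0 ?sub0r.
rewrite RintegralB//; last 2 first.
  by apply: integrable_indicM => //; exact: continuous_integrable_itv.
  by apply: integrable_indicM => //; exact: continuous_integrable_itv.
rewrite -!Rintegral_indic// (Rintegral_derive ler01 ca' da) (Rintegral_derive (lerN10 R) ca' da).
have -> : a 1 = 0 by apply: (bump_eq0 ba); rewrite normr1.
have -> : a (-1) = 0 by apply: (bump_eq0 ba); rewrite normrN normr1.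
lra.
Qed.

Let cvg_atan_sg x : pi^-1 * atan (2 * pi / n.+1%:R^-1 * x) @[n --> \oo] -->
  2^-1 * Num.sg x.
Proof.
have pi_neq0 : (pi : R) != 0 by rewrite gt_eqF ?pi_gt0.
have -> : 2^-1 * Num.sg x = pi^-1 * (pi / 2 * Num.sg x).
  by rewrite !mulrA mulVf// mul1r.
apply: cvgMl_tmp.
have H y : 0 < y -> atan (2 * pi / n.+1%:R^-1 * y) @[n --> \oo] --> (pi / 2 : R).
  move=> y0.
  suff h : 2 * pi / n.+1%:R^-1 * y @[n --> \oo] --> +oo.
    exact: cvg_comp h (@cvgy_atan R).
  apply/cvgryPge => A; near=> n.
  rewrite invrK mulrAC -ler_pdivrMl ?mulr_gt0 ?pi_gt0// -[n.+1%:R]natr1 -lerBlDr.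
  by near: n; exact: nbhs_infty_ger.
case: sgrP => x0.
- have aE : (fun n : nat => atan (2 * pi / n.+1%:R^-1 * x)) = (fun=> 0).
    by apply/funext => n; rewrite x0 mulr0 atan0.
  by rewrite aE mulr0; apply: cvg_near_cst; exact: nearW.
- by rewrite mulr1; exact: H.
- rewrite mulrN1; have Nx : 0 < - x by rewrite oppr_gt0.
  have -> : (fun n : nat => atan (2 * pi / n.+1%:R^-1 * x)) =
            (fun n => - atan (2 * pi / n.+1%:R^-1 * - x)).
    by apply/funext => n; rewrite mulrN atanN opprK.
  exact: cvgN (H _ Nx).
Unshelve. all: by end_near. Qed.

Let measurable_sg : measurable_fun setT (@Num.sg R).
Proof.
have -> : @Num.sg R = (fun x => \1_`]0, +oo[ x - \1_`]-oo, 0[ x).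
  apply/funext => x; rewrite !indicE !mem_setE !in_itv/= andbT.
  by case: sgrP => x0; rewrite ?x0 ?ltxx ?subrr ?subr0 ?sub0r// ltNge (ltW x0)/= ?subr0 ?sub0r.
by apply: measurable_funB; exact: measurable_indic.
Qed.

Let cvg_damping x : damping n.+1%:R^-1 x @[n --> \oo] --> (1 : R).
Proof.
have h : (- n.+1%:R^-1 * `|x|) @[n --> \oo] --> (0 : R).
  rewrite -(mul0r `|x|); apply: cvgMr_tmp; rewrite -oppr0; apply: cvgN.
  exact: cvg_harmonic.
have := cvg_comp _ _ h (@continuous_expR R 0); rewrite expR0; exact.
Qed.

(** Fourier inversion at the origin: both sides of [damped_cos_transform_parts]
    have a limit as the damping disappears, and the right-hand one is
    [- \int (sg / 2) * a'], that is [a 0]. *)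
Lemma cos_transform_integral a : bump a -> Rintegral mu setT (cos_transform a) = a 0.
Proof.
move=> ba; have ba' := bump_derive1 ba.
have ic := cos_transform_integrable ba.
have mc := integrable_measurable ic.
have ia' := bump_integrable ba'.
have c1 : Rintegral mu setT (fun x => damping n.+1%:R^-1 x * cos_transform a x)
    @[n --> \oo] --> Rintegral mu setT (cos_transform a).
  apply: Rintegral_dominated_cvg (integrable_norm ic) _ => //.
  - move=> n; apply: measurable_funM => //; apply: continuous_measurable_fun.
    exact: continuous_damping.
  - apply: aeW => x; rewrite -[X in _ --> X]mul1r; apply: cvgMr_tmp.
    exact: cvg_damping.
  - move=> n x; rewrite normrM ger0_norm ?expR_ge0// ler_piMl//.
    by rewrite -expR0 ler_expR mulNr oppr_le0 mulr_ge0.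
have c2 : Rintegral mu setT (fun x => damping n.+1%:R^-1 x * cos_transform a x)
    @[n --> \oo] --> - Rintegral mu setT (fun xi => 2^-1 * Num.sg xi * derive1 a xi).
  have -> : (fun n => Rintegral mu setT (fun x => damping n.+1%:R^-1 x * cos_transform a x)) =
     (fun n => - Rintegral mu setT (fun xi => pi^-1 * atan (2 * pi / n.+1%:R^-1 * xi) * derive1 a xi)).
    by apply/funext => n; rewrite damped_cos_transform_parts.
  apply: cvgN; apply: Rintegral_dominated_cvg (integrable_norm ia') _.
  - move=> n; apply: measurable_funM; last exact: integrable_measurable.
    apply: measurable_funM => //; apply: continuous_measurable_fun => x.
    apply: (@continuous_comp _ _ _ (fun x => 2 * pi / n.+1%:R^-1 * x) atan).
      by apply: cvgMl_tmp; exact: cvg_id.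
    exact: continuous_atan.
  - apply: measurable_funM; last exact: integrable_measurable.
    by apply: measurable_funM; [exact: measurable_cst|exact: measurable_sg].
  - by apply: aeW => x; apply: cvgMr_tmp; exact: cvg_atan_sg.
  - move=> n x; rewrite normrM ler_piMl// normrM ger0_norm ?invr_ge0 ?pi_ge0//.
    rewrite mulrC ler_pdivrMr ?pi_gt0// mul1r ler_norml.
    have := @pi_gt0 R; set t := (_ * x) => p0.
    have := atan_gtNpi2 t; have := atan_ltpi2 t => ? ?.
    by apply/andP; split; lra.
rewrite (cvg_unique _ c1 c2) //.
under eq_Rintegral do rewrite -mulrA.
rewrite RintegralZl//; last first.
  have sg1 x : `|Num.sg x : R| <= 1 by rewrite normr_sg; case: eqP.
  have := integrable_mul_bounded measurable_sg sg1 ia'.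
  by apply: eq_integrable => // x _ /=; rewrite mulrC.
by rewrite Rintegral_sg_derive1// mulrN opprK mulrA mulVf// mul1r.
Qed.

End InversionAtZero.

(** * Integrable kernels and their primitives *)

Section Kernel.
Context {R : realType}.
Local Notation mu := (@lebesgue_measure R).
Variables (phi : R -> R) (C q : R).
Hypotheses (phi_cont : continuous phi)
  (phi_decay : forall x, `|phi x| <= C / oneDsqr x ^+ 2)
  (phi_int : Rintegral mu setT phi = q).
Implicit Types (x y u s t c : R) (k : nat) (F : R -> R).

Lemma kernel_C_ge0 : 0 <= C.
Proof.
have := phi_decay 0; rewrite /oneDsqr expr0n/= addr0 expr1n divr1.
exact: le_trans (normr_ge0 _).
Qed.
Let C0 := kernel_C_ge0.

Lemma kernel_bounded x : `|phi x| <= C.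
Proof. by rewrite (le_trans (phi_decay x))// ler_piMr// invf_le1 ?exprn_gt0// exprn_ege1. Qed.

Lemma kernel_integrable : mu.-integrable setT (EFin \o phi).
Proof. exact: bounded_decay_integrable phi_cont phi_decay. Qed.

Lemma kernel_integrable_on (D : set R) : measurable D -> mu.-integrable D (EFin \o phi).
Proof. by move=> mD; apply: integrableS kernel_integrable. Qed.

Definition cumul x := \int[mu]_(t in `]-oo, x]) phi t.

Lemma is_derive_cumul x : is_derive x 1 cumul (phi x).
Proof.
have x1 : x < x + 1 by lra.
have itf : mu.-integrable `]-oo, x + 1] (EFin \o phi) by exact: kernel_integrable_on.
have [d1 d2] := continuous_FTC1 x1 itf (ltNyr _) (@phi_cont x).
by apply: DeriveDef => //; rewrite -derive1E.
Qed.

Lemma cumul_continuous : continuous cumul.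
Proof. by apply: derivable_continuous => x; case: (is_derive_cumul x). Qed.

(** One of the two factors [(oneDsqr t)^-1] of the decay is bounded by its value at
    [x], and the other one is integrated, which gives [pi]. *)
Lemma kernel_tail (D : set R) x : measurable D ->
  (forall t, D t -> x ^+ 2 <= t ^+ 2) ->
  `|Rintegral mu D phi| <= C * pi / oneDsqr x.
Proof.
move=> mD Dx; rewrite Rintegral_indic//.
have ig : mu.-integrable setT (EFin \o (fun t => C / oneDsqr x * (oneDsqr t)^-1)).
  by apply: eq_integrable (integrableZl measurableT (C / oneDsqr x) integrable_oneDsqrV) => // t _; rewrite /= EFinM.
have -> : C * pi / oneDsqr x = Rintegral mu setT (fun t => C / oneDsqr x * (oneDsqr t)^-1).
  rewrite RintegralZl//; last exact: integrable_oneDsqrV.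
  by rewrite /Rintegral integral_oneDsqrV/= mulrAC.
apply: normr_Rintegral_le ig => //.
  by apply: measurable_funM => //; exact: continuous_measurable_fun.
move=> t; rewrite indicE; case: (boolP (t \in D)) => tD; last first.
  by rewrite mul0r normr0 mulr_ge0 ?invr_ge0// divr_ge0.
rewrite mul1r (le_trans (phi_decay t))// expr2 invfM mulrA ler_wpM2r ?invr_ge0//.
rewrite ler_wpM2l// lef_pV2 ?posrE// lerD2l.
by apply: Dx; rewrite -inE.
Qed.

Lemma cumul_bounded x : `|cumul x| <= C * pi.
Proof.
have := @kernel_tail `]-oo, x] 0; rewrite /oneDsqr expr0n/= addr0 divr1; apply => //.
by move=> t _; exact: sqr_ge0.
Qed.

Lemma cumul_left x : x <= 0 -> `|cumul x| <= C * pi / oneDsqr x.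
Proof.
move=> x0; apply: kernel_tail => // t /=; rewrite in_itv/= => tx; nra.
Qed.

Lemma cumul_right x : 0 <= x -> `|cumul x - q| <= C * pi / oneDsqr x.
Proof.
move=> x0; have -> : cumul x - q = - \int[mu]_(t in `]x, +oo[) phi t.
  have : q = cumul x + \int[mu]_(t in `]x, +oo[) phi t.
    rewrite -phi_int /cumul -Rintegral_setU//; first last.
    - rewrite disj_set2E; apply/eqP/seteqP; split => // t /=.
      by rewrite !in_itv/= andbT => -[? ?]; lra.
    - by apply: kernel_integrable_on; exact: measurableU.
    congr Rintegral; apply/seteqP; split => // t _ /=; rewrite !in_itv/= andbT.
    by have [?|?] := leP t x; [left|right].
  by move=> ->; lra.
rewrite normrN; apply: kernel_tail => // t /=; rewrite in_itv/= andbT => xt; nra.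
Qed.

Lemma cumul_dyadic_cvg x : x != 0 ->
  cumul (2 ^+ n * x) @[n --> \oo] --> q * (0 < x)%R%:R.
Proof.
move=> x0; have x2 : 0 < x ^+ 2 by rewrite exprn_even_gt0.
have Cpi : 0 <= C * pi by rewrite mulr_ge0// pi_ge0.
pose b n : R := C * pi / x ^+ 2 * 2^-1 ^+ n.
have b0 : b n @[n --> \oo] --> (0 : R).
  by apply: cvg_geometric; rewrite ger0_norm// invf_lt1// ltr1n.
have hb n : C * pi / oneDsqr (2 ^+ n * x) <= b n.
  rewrite /b exprVn -!mulrA ler_wpM2l// ler_wpM2l ?pi_ge0// -invfM.
  have p2 : (0 : R) < 2 ^+ n by rewrite exprn_gt0.
  rewrite lef_pV2 ?posrE ?(mulr_gt0 x2 p2)// mulrC /oneDsqr exprMn.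
  rewrite (@le_trans _ _ ((2 ^+ n) ^+ 2 * x ^+ 2))// ?lerDr//.
  by rewrite ler_wpM2r ?(ltW x2)// expr2 ler_peMl ?exprn_ge0// exprn_ege1// ler1n.
have h n : `|cumul (2 ^+ n * x) - q * (0 < x)%R%:R| <= b n.
  rewrite (le_trans _ (hb n))//; have [xp|xn] := ltP 0 x.
    by rewrite mulr1; apply: cumul_right; rewrite mulr_ge0 ?exprn_ge0// ltW.
  by rewrite mulr0 subr0; apply: cumul_left; rewrite mulr_ge0_le0 ?exprn_ge0.
apply/subr_cvg0; apply: norm_cvg0.
apply: (squeeze_cvgr _ (cvg_cst (0 : R)) b0).
by near=> n; rewrite normr_ge0 h.
Unshelve. all: by end_near. Qed.

Lemma kernel_integral_left c y s t : 0 < c -> s <= t ->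
  \int[mu]_(x in `[s, t]) (c * phi (c * (y - x))) =
  cumul (c * (y - s)) - cumul (c * (y - t)).
Proof.
move=> c0 st.
pose G x := - cumul (- c * x + c * y).
have gE x : c * phi (c * (y - x)) = c * phi (- c * x + c * y).
  by congr (_ * phi _); ring.
have dG x : is_derive x 1 G (c * phi (c * (y - x))).
  have h := is_derive_comp_affine (is_derive_cumul (- c * x + c * y)).
  have -> : c * phi (c * (y - x)) = - (phi (- c * x + c * y) * - c) by rewrite gE; ring.
  exact: is_deriveN.
rewrite (Rintegral_derive st _ dG).
  by rewrite /G addrC opprK; congr (cumul _ - cumul _); ring.
move=> x; apply: cvgMl_tmp.
apply: (@continuous_comp _ _ _ (fun x => c * (y - x)) phi); last exact: phi_cont.
by apply: cvgMl_tmp; apply: cvgB; [exact: cvg_cst|exact: cvg_id].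
Qed.

Lemma kernel_integral_right c x s t : 0 < c -> s <= t ->
  \int[mu]_(y in `[s, t]) (c * phi (c * (y - x))) =
  cumul (c * (t - x)) - cumul (c * (s - x)).
Proof.
move=> c0 st.
pose G y := cumul (c * y + - (c * x)).
have dG y : is_derive y 1 G (c * phi (c * (y - x))).
  have h := is_derive_comp_affine (is_derive_cumul (c * y + - (c * x))).
  have -> : c * phi (c * (y - x)) = phi (c * y + - (c * x)) * c by rewrite mulrC mulrBr.
  exact: h.
rewrite (Rintegral_derive st _ dG); first by rewrite /G -!mulrBr.
move=> y; apply: cvgMl_tmp.
apply: (@continuous_comp _ _ _ (fun y => c * (y - x)) phi); last exact: phi_cont.
by apply: cvgMl_tmp; apply: cvgB; [exact: cvg_id|exact: cvg_cst].
Qed.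

(** * Littlewood-Paley kernels *)

Definition dilation k x := 2 ^+ k * phi (2 ^+ k * x).

(** When [phi] is the inverse Fourier transform of a cutoff, these are the inverse
    transforms of the Littlewood-Paley multipliers; the order 0 is special. *)
Definition lp_kernel k x : R :=
  if k is k'.+1 then dilation k x - dilation k' x else phi x.

Lemma sum_lp_kernel n x : \sum_(0 <= k < n.+1) lp_kernel k x = dilation n x.
Proof.
elim: n => [|n IH]; first by rewrite big_nat1 /dilation expr0 !mul1r.
by rewrite big_nat_recr//= IH addrC subrK.
Qed.

Lemma dilation_continuous k : continuous (dilation k).
Proof.
move=> x; apply: cvgMl_tmp.
apply: (@continuous_comp _ _ _ (fun x => 2 ^+ k * x) phi); last exact: phi_cont.
by apply: cvgMl_tmp; exact: cvg_id.
Qed.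

Lemma lp_kernel_continuous k : continuous (lp_kernel k).
Proof.
case: k => [|k] x /=; first exact: phi_cont.
by apply: cvgB; exact: dilation_continuous.
Qed.

Lemma dilation_bounded k x : `|dilation k x| <= 2 ^+ k * C.
Proof. by rewrite normrM ger0_norm ?exprn_ge0// ler_wpM2l ?exprn_ge0// kernel_bounded. Qed.

Lemma lp_kernel_bounded k x : `|lp_kernel k x| <= 2 * 2 ^+ k * C.
Proof.
case: k => [|k] /=.
  by rewrite (le_trans (kernel_bounded x))// expr0 mulr1 ler_peMl//; lra.
rewrite (le_trans (ler_normB _ _))//.
have h1 := dilation_bounded k.+1 x; have h2 := dilation_bounded k x.
have h3 : 0 <= 2 ^+ k * C by rewrite mulr_ge0// exprn_ge0.
by move: h1; rewrite exprS; nra.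
Qed.

(** The profile of the response to a unit jump at the origin: by [lp_conv_step],
    convolving an indicator with [lp_kernel k.+1] gives one copy of it, dilated by
    [2 ^+ k.+1], for each jump. *)
Definition lp_step u := cumul u - cumul (u / 2).

Lemma lp_step_continuous : continuous lp_step.
Proof.
move=> x; apply: cvgB; first exact: cumul_continuous.
apply: (@continuous_comp _ _ _ (fun x => x / 2) cumul); last exact: cumul_continuous.
by apply: cvgMr_tmp; exact: cvg_id.
Qed.

(** Both values of [cumul] are close to the same limit, which is 0 or [q] according
    to the sign of [u]. Halving the argument costs a factor 4, whence [5 = 1 + 4]. *)
Lemma lp_step_decay u : `|lp_step u| <= 5 * (C * pi) / oneDsqr u.
Proof.
have Cpi : 0 <= C * pi by rewrite mulr_ge0// pi_ge0.
have hu : C * pi / oneDsqr (u / 2) <= 4 * (C * pi) / oneDsqr u.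
  rewrite ler_pdivrMr// mulrAC ler_pdivlMr// /oneDsqr exprMn.
  have -> : (2^-1 : R) ^+ 2 = 4^-1 by rewrite exprVn; congr _^-1; ring.
  have := sqr_ge0 u; nra.
have hs : 5 * (C * pi) / oneDsqr u = C * pi / oneDsqr u + 4 * (C * pi) / oneDsqr u.
  by rewrite -mulrDl; congr (_ / _); ring.
rewrite hs; have [u0|/ltW u0] := leP u 0.
  rewrite (le_trans (ler_normB _ _))// lerD//; first exact: cumul_left.
  by rewrite (le_trans _ hu)//; apply: cumul_left; lra.
have -> : lp_step u = (cumul u - q) - (cumul (u / 2) - q) by rewrite /lp_step; lra.
rewrite (le_trans (ler_normB _ _))// lerD//; first exact: cumul_right.
by rewrite (le_trans _ hu)//; apply: cumul_right; lra.
Qed.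

Lemma lp_kernel_integral k y s t : s <= t ->
  \int[mu]_(x in `[s, t]) lp_kernel k.+1 (y - x) =
  lp_step (2 ^+ k.+1 * (y - s)) - lp_step (2 ^+ k.+1 * (y - t)).
Proof.
move=> st.
have ci m : continuous (fun x => dilation m (y - x)).
  move=> x; apply: (@continuous_comp _ _ _ (fun x => y - x) (dilation m)).
    by apply: cvgB; [exact: cvg_cst|exact: cvg_id].
  exact: dilation_continuous.
rewrite RintegralB//; try exact: continuous_integrable_itv.
rewrite !kernel_integral_left ?exprn_gt0// /lp_step.
have h (z : R) : 2 ^+ k.+1 * z / 2 = 2 ^+ k * z.
  by rewrite exprS; field.
rewrite !h; lra.
Qed.

(** If [lp_step] vanished identically, [cumul] would be constant along the
    dyadic rays [2 ^+ n * x], hence equal to its limits 0 on the left and [q]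
    on the right of the origin, and could not be continuous there. *)
Lemma lp_step_neq0 : q != 0 -> exists u, lp_step u != 0.
Proof.
move=> q0; apply: contrapT => /forallNP h.
have h0 u : cumul u = cumul (u / 2).
  by apply/eqP; rewrite -subr_eq0; apply/negPn/negP => /h.
have hn n u : cumul u = cumul (2 ^+ n * u).
  elim: n => [|n ->]; first by rewrite expr0 mul1r.
  by rewrite (h0 (2 ^+ n.+1 * u)); congr cumul; rewrite exprS; field.
have cstE u : u != 0 -> cumul u = q * (0 < u)%R%:R.
  move=> u0; apply: (cvg_unique _ _ (cumul_dyadic_cvg u0)) => //.
  by apply: cvg_near_cst; apply: nearW => n; rewrite -hn.
have cl u : u < 0 -> cumul u = 0.
  by move=> u0; rewrite cstE ?lt_eqF// ltNge (ltW u0) mulr0.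
have cr u : 0 < u -> cumul u = q.
  by move=> u0; rewrite cstE ?gt_eqF// u0 mulr1.
have c0 := @cumul_continuous 0.
have c0l : cumul 0 = 0.
  apply: (cvg_unique _ (cvg_at_left_filter c0)) => //.
  apply: cvg_near_cst; near=> z; apply: cl; near: z; exact: nbhs_left_lt.
have c0r : cumul 0 = q.
  apply: (cvg_unique _ (cvg_at_right_filter c0)) => //.
  apply: cvg_near_cst; near=> z; apply: cr; near: z; exact: nbhs_right_gt.
by move: q0; rewrite -c0r c0l eqxx.
Unshelve. all: by end_near. Qed.

End Kernel.

(** * Convolution with Littlewood-Paley kernels *)

Section Convolution.
Context {R : realType}.
Local Notation mu := (@lebesgue_measure R).
Variables (phi : R -> R) (C q : R).
Hypotheses (phi_cont : continuous phi)
  (phi_decay : forall x, `|phi x| <= C / oneDsqr x ^+ 2)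
  (phi_int : Rintegral mu setT phi = q).
Implicit Types (x y u s t c : R) (k : nat) (F G : R -> R).

Let C0 : 0 <= C := kernel_C_ge0 phi_decay.

Definition lp_conv F k y := Rintegral mu setT (fun x => F x * lp_kernel phi k (y - x)).

Let shift_continuous (K : R -> R) y : continuous K -> continuous (fun x => K (y - x)).
Proof.
move=> cK x; apply: (@continuous_comp _ _ _ (fun x => y - x) K); last exact: cK.
by apply: cvgB; [exact: cvg_cst|exact: cvg_id].
Qed.

Let shift_continuous2 (K : R -> R) x : continuous K -> continuous (fun y => K (y - x)).
Proof.
move=> cK y; apply: (@continuous_comp _ _ _ (fun y => y - x) K); last exact: cK.
by apply: cvgB; [exact: cvg_id|exact: cvg_cst].
Qed.

Let kerc k := lp_kernel_continuous phi_cont (k := k).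

Lemma lp_conv_integrand F k y : mu.-integrable setT (EFin \o F) ->
  mu.-integrable setT (EFin \o (fun x => F x * lp_kernel phi k (y - x))).
Proof.
apply: integrable_mul_bounded.
  by apply: continuous_measurable_fun; apply: shift_continuous; exact: kerc.
by move=> x; exact: lp_kernel_bounded phi_decay _ _.
Qed.

Lemma lp_conv_bounded F k y : mu.-integrable setT (EFin \o F) ->
  `|lp_conv F k y| <= 2 * 2 ^+ k * C * Rintegral mu setT (fun x => `|F x|).
Proof.
move=> iF; rewrite -RintegralZl//; last exact: integrable_norm.
apply: normr_Rintegral_le.
- exact: integrable_measurable (lp_conv_integrand k y iF).
- by move=> x; rewrite normrM mulrC ler_wpM2r// lp_kernel_bounded.
- have := integrableZl measurableT (2 * 2 ^+ k * C) (integrable_norm iF).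
  by apply: eq_integrable => // x _ /=; rewrite EFinM.
Qed.

Lemma lp_conv_continuous F k : mu.-integrable setT (EFin \o F) ->
  continuous (lp_conv F k).
Proof.
move=> iF y; pose f y x := F x * lp_kernel phi k (y - x).
pose g x := 2 * 2 ^+ k * C * `|F x|.
have ig : mu.-integrable setT (EFin \o g).
  have := integrableZl measurableT (2 * 2 ^+ k * C) (integrable_norm iF).
  by apply: eq_integrable => // x _ /=; rewrite EFinM.
have cf : {ae mu, forall x, setT x -> {in `]y - 1, y + 1[%classic, continuous (f ^~ x)}}.
  apply: aeW => x _ z _; rewrite /f; apply: cvgMl_tmp.
  by apply: shift_continuous2; exact: kerc.
have f_ub z : `]y - 1, y + 1[%classic z ->
    {ae mu, forall x, setT x -> `|f z x| <= g x}.
  by move=> _; apply: aeW => x _; rewrite normrM mulrC ler_wpM2r// lp_kernel_bounded.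
apply: (continuity_under_integral measurableT (fun z _ => lp_conv_integrand k z iF)
  cf ig f_ub).
by rewrite inE/= in_itv/=; apply/andP; split; lra.
Qed.

Lemma lp_convB F G k y : mu.-integrable setT (EFin \o F) ->
  mu.-integrable setT (EFin \o G) ->
  lp_conv (fun x => F x - G x) k y = lp_conv F k y - lp_conv G k y.
Proof.
move=> iF iG; rewrite -RintegralB//; try exact: lp_conv_integrand.
by apply: eq_Rintegral => x _; rewrite mulrBl.
Qed.

Lemma lp_convD F G k y : mu.-integrable setT (EFin \o F) ->
  mu.-integrable setT (EFin \o G) ->
  lp_conv (fun x => F x + G x) k y = lp_conv F k y + lp_conv G k y.
Proof.
move=> iF iG; rewrite -RintegralD//; try exact: lp_conv_integrand.
by apply: eq_Rintegral => x _; rewrite mulrDl.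
Qed.

Lemma lp_convZ F (c : R) k y : mu.-integrable setT (EFin \o F) ->
  lp_conv (fun x => c * F x) k y = c * lp_conv F k y.
Proof.
move=> iF; rewrite -RintegralZl//; last exact: lp_conv_integrand.
by apply: eq_Rintegral => x _; rewrite mulrA.
Qed.

Lemma sum_lp_conv F n y : mu.-integrable setT (EFin \o F) ->
  \sum_(0 <= k < n.+1) lp_conv F k y =
  Rintegral mu setT (fun x => F x * dilation phi n (y - x)).
Proof.
move=> iF; transitivity (Rintegral mu setT (fun x =>
    \sum_(0 <= k < n.+1) (F x * lp_kernel phi k (y - x)))); last first.
  by apply: eq_Rintegral => x _; rewrite -mulr_sumr sum_lp_kernel.
elim: (n.+1) => [|m IH].
  rewrite big_geq//; under eq_Rintegral do rewrite big_geq//.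
  by rewrite Rintegral_cst// mul0r.
rewrite big_nat_recr//= IH -RintegralD//.
- by apply: eq_Rintegral => x _; rewrite [in RHS]big_nat_recr.
- have := @integrable_sum _ _ _ mu setT measurableT _ (index_iota 0 m) xpredT
    (fun k x => (F x * lp_kernel phi k (y - x))%:E)
    (fun k _ => lp_conv_integrand k y iF).
  by apply: eq_integrable => // x _ /=; rewrite sumEFin.
- exact: lp_conv_integrand.
Qed.

Let dilc n := dilation_continuous phi_cont (k := n).

(** The kernels telescope to a single dilate, and by Fubini's theorem its integral
    over [[s, t]] can be taken first: it is a difference of values of [cumul]. *)
Lemma Rintegral_sum_lp_conv F n s t : mu.-integrable setT (EFin \o F) -> s <= t ->
  \sum_(0 <= k < n.+1) \int[mu]_(y in `[s, t]) lp_conv F k y =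
  Rintegral mu setT (fun x => F x *
    (cumul phi (2 ^+ n * (t - x)) - cumul phi (2 ^+ n * (s - x)))).
Proof.
move=> iF st.
transitivity (\int[mu]_(y in `[s, t]) (\sum_(0 <= k < n.+1) lp_conv F k y)).
  have ii k : mu.-integrable `[s, t] (EFin \o lp_conv F k).
    by apply: continuous_integrable_itv; exact: lp_conv_continuous.
  elim: (n.+1) => [|m IH].
    rewrite big_geq//; under [RHS]eq_Rintegral do rewrite big_geq//.
    by rewrite Rintegral_cst// mul0r.
  rewrite big_nat_recr//= IH -RintegralD//.
    by apply: eq_Rintegral => x _; rewrite [in RHS]big_nat_recr.
  have := @integrable_sum _ _ _ mu `[s, t] (measurable_itv _) _ (index_iota 0 m) xpredT
    (fun k x => (lp_conv F k x)%:E) (fun k _ => ii k).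
  by apply: eq_integrable => // x _ /=; rewrite sumEFin.
under eq_Rintegral do rewrite sum_lp_conv//.
rewrite Rintegral_indic//.
pose h (z : R * R) := \1_`[s, t] z.1 * (F z.2 * dilation phi n (z.1 - z.2)).
have mF := integrable_measurable iF.
have mh : measurable_fun setT h.
  apply: measurable_funM.
    by apply: (measurableT_comp _ measurable_fst); exact: measurable_indic.
  apply: measurable_funM; first exact: (measurableT_comp mF measurable_snd).
  have mB : measurable_fun setT (fun z : R * R => z.1 - z.2).
    by apply: measurable_funB; [exact: measurable_fst|exact: measurable_snd].
  exact: (measurableT_comp (continuous_measurable_fun (@dilc n)) mB).
have hAB y x : `|h (y, x)| <= (2 ^+ n * C * \1_`[s, t] y) * `|F x|.
  rewrite /h /= normrM normrM ger0_norm// mulrA mulrAC ler_wpM2r//.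
  by rewrite mulrC ler_wpM2r// dilation_bounded.
have iI : mu.-integrable setT (EFin \o (fun y => 2 ^+ n * C * \1_`[s, t] y)).
  have := integrableZl measurableT (2 ^+ n * C) (@integrable_indic_itv R s t true false).
  by apply: eq_integrable => // x _ /=; rewrite EFinM.
have := Rintegral_swap mh iI (integrable_norm iF) hAB; rewrite /h /= => hs.
transitivity (\int[mu]_y \int[mu]_x (\1_`[s, t] y * (F x * dilation phi n (y - x)))).
  apply: eq_Rintegral => y _; rewrite RintegralZl//.
  apply: integrable_mul_bounded iF.
    by apply: continuous_measurable_fun; apply: shift_continuous; exact: dilc.
  by move=> x; exact: dilation_bounded phi_decay _ _.
rewrite hs; apply: eq_Rintegral => x _.
rewrite -(kernel_integral_right phi_cont phi_decay) ?exprn_gt0//.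
rewrite Rintegral_indic// -RintegralZl//.
  by apply: eq_Rintegral => y _; rewrite /dilation mulrCA.
apply: integrable_indicM => //; apply: continuous_integrable_itv.
exact: (@shift_continuous2 (dilation phi n) x (@dilc n)).
Qed.

(** As [n] grows the difference of values of [cumul] tends to [q] inside [[s, t]] and
    to 0 outside; the two endpoints form a null set. *)
Lemma cvg_sum_lp_conv F s t : mu.-integrable setT (EFin \o F) -> s <= t ->
  (\sum_(0 <= k < n) \int[mu]_(y in `[s, t]) lp_conv F k y) @[n --> \oo] -->
  q * \int[mu]_(x in `[s, t]) F x.
Proof.
move=> iF st; rewrite -(cvg_shiftS _).
have mF := integrable_measurable iF.
have -> : (fun n : nat => \sum_(0 <= k < n.+1) \int[mu]_(y in `[s, t]) lp_conv F k y) =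
   (fun n => Rintegral mu setT (fun x => F x *
    (cumul phi (2 ^+ n * (t - x)) - cumul phi (2 ^+ n * (s - x))))).
  by apply/funext => n; exact: Rintegral_sum_lp_conv.
have -> : q * \int[mu]_(x in `[s, t]) F x = Rintegral mu setT (fun x => F x * (q * \1_`[s, t] x)).
  rewrite Rintegral_indic// -RintegralZl//.
    by apply: eq_Rintegral => x _; ring.
  by apply: integrable_indicM => //; apply: integrableS iF.
have ig : mu.-integrable setT (EFin \o (fun x => C * pi * 2 * `|F x|)).
  have := integrableZl measurableT (C * pi * 2) (integrable_norm iF).
  by apply: eq_integrable => // x _ /=; rewrite EFinM.
have cc w n : continuous (fun x => cumul phi (2 ^+ n * (w - x))).
  move=> x; apply: (@continuous_comp _ _ _ (fun x => 2 ^+ n * (w - x)) (cumul phi)).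
    by apply: cvgMl_tmp; apply: cvgB; [exact: cvg_cst|exact: cvg_id].
  exact: cumul_continuous phi_cont phi_decay _.
apply: Rintegral_dominated_cvg ig _.
- move=> n; apply: measurable_funM => //; apply: continuous_measurable_fun => x.
  by apply: cvgB; exact: cc.
- apply: measurable_funM => //; apply: measurable_funM; first exact: measurable_cst.
  exact: measurable_indic.
- exists ([set s] `|` [set t]); split.
  + by apply: measurableU; exact: measurable_set1.
  + apply/eqP; rewrite eq_le measure_ge0 andbT.
    rewrite (le_trans (measureU2 _ _ _))//=.
    by rewrite [X in (X + _ <= _)%E]lebesgue_measure_set1 [X in (_ + X <= _)%E]lebesgue_measure_set1 adde0.
  + move=> x /=; apply: contra_notP => /not_orP[/eqP xs /eqP xt].
    apply: cvgMl_tmp.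
    have -> : q * \1_`[s, t] x = q * (0 < t - x)%R%:R - q * (0 < s - x)%R%:R.
      rewrite -mulrBr indicE mem_setE in_itv/= !subr_gt0 (lt_neqAle x t) xt /=.
      by have [xs'|xs'] := leP s x; [rewrite subr0|rewrite (le_trans (ltW xs') st) subrr].
    by apply: cvgB; apply: (cumul_dyadic_cvg phi_cont phi_decay phi_int);
      rewrite subr_eq0 eq_sym.
- move=> n x; rewrite normrM mulrC ler_wpM2r// (le_trans (ler_normB _ _))//.
  rewrite [leRHS]mulr_natr mulr2n.
  by rewrite lerD// (cumul_bounded phi_cont phi_decay).
Qed.

Lemma lp_conv_step k y c : 0 <= c ->
  lp_conv (\1_`]0, c[ : R -> R) k.+1 y =
  lp_step phi (2 ^+ k.+1 * y) - lp_step phi (2 ^+ k.+1 * (y - c)).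
Proof.
move=> c0.
have := @lp_kernel_integral _ phi C phi_cont phi_decay k y 0 c c0; rewrite subr0 => <-.
rewrite /lp_conv -Rintegral_indic//.
have ii (I : interval R) : [set` I] `<=` `[0, c] ->
    mu.-integrable [set` I] (EFin \o (fun x => lp_kernel phi k.+1 (y - x))).
  move=> Ic; have cK : continuous (fun x => lp_kernel phi k.+1 (y - x)).
    by apply: shift_continuous; exact: kerc.
  exact: (@integrableS _ _ _ mu `[0, c] _ _ (measurable_itv _) (measurable_itv _) Ic
    (continuous_integrable_itv _ _ cK)).
rewrite Rintegral_itv_bndo_bndc; last by apply: ii; exact: subset_itv_oo_cc.
by rewrite Rintegral_itv_obnd_cbnd//; apply: ii; exact: subset_itv_oc_cc.
Qed.

End Convolution.

(** * Sums of Haar functions at the origin *)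

Section HaarSums.
Context {R : realType}.
Local Notation mu := (@lebesgue_measure R).
Implicit Types (x y s t c d : R) (i j k m n : nat) (F : R -> R).

Definition low_indic c : R -> R := \1_`]0, c[.

(** The Haar function [h_{i,0}], up to its values at the three breakpoints: it is 1
    on the left half of [[0, 2 ^- i]] and -1 on the right half. *)
Definition haar_origin i x := 2 * low_indic (2 ^- i.+1) x - low_indic (2 ^- i) x.

Definition haar_sum n x := \sum_(0 <= i < n) haar_origin i x.

Definition clip c x := Num.min (Num.max x 0) c.

Lemma pow_gt0 i : (0 : R) < 2 ^- i. Proof. by rewrite invr_gt0 exprn_gt0. Qed.

Lemma pow_half i : (2 : R) ^- i = 2 * 2 ^- i.+1.
Proof. by rewrite exprS invfM mulrA divff ?mul1r. Qed.

Lemma low_indic_integrable c : mu.-integrable setT (EFin \o low_indic c).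
Proof. exact: integrable_indic_itv. Qed.

Lemma low_indic_cumul c x : 0 <= c -> \int[mu]_(t in `]-oo, x]) low_indic c t = clip c x.
Proof.
move=> c0; rewrite Rintegral_indic//.
have -> : (fun t => \1_(`]-oo, x] : set R) t * low_indic c t) =
          \1_((`]-oo, x] : set R) `&` `]0, c[).
  by apply/funext => t; rewrite /low_indic indicI.
rewrite /Rintegral integral_indic//; last exact: measurableI.
rewrite setIT /clip; have [x0|x0] := leP x 0.
  have -> : (`]-oo, x] : set R) `&` `]0, c[ = set0.
    by apply/seteqP; split => // t /=; rewrite !in_itv/= => -[h1 /andP[h2 _]]; lra.
  by rewrite measure0 min_l.
have [xc|cx] := ltP x c.
  have -> : (`]-oo, x] : set R) `&` `]0, c[ = `]0, x]%classic.
    apply/seteqP; split => t /=; rewrite !in_itv/=; first by move=> [-> /andP[-> _]].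
    by move=> /andP[h1 h2]; rewrite h1 h2; split => //; lra.
  by rewrite [X in fine X]lebesgue_measure_itv/= lte_fin x0 oppr0 addr0.
have -> : (`]-oo, x] : set R) `&` `]0, c[ = `]0, c[%classic.
  apply/seteqP; split => t /=; rewrite !in_itv/=; first by move=> [_ ->].
  by move=> /andP[h1 h2]; rewrite h1 h2; split => //; lra.
rewrite [X in fine X]lebesgue_measure_itv/= lte_fin; case: ltP => [_|]; first by rewrite oppr0 addr0.
by move=> ?; apply/eqP; rewrite eq_le c0.
Qed.

Lemma low_indic_integral c s t : 0 <= c -> s <= t ->
  \int[mu]_(x in `[s, t]) low_indic c x = clip c t - clip c s.
Proof.
move=> c0 st; rewrite -!low_indic_cumul//.
have il (D : set R) : measurable D -> mu.-integrable D (EFin \o low_indic c).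
  by move=> mD; apply: integrableS (low_indic_integrable c).
rewrite Rintegral_itvB ?bnd_simp//; last exact: il.
by rewrite Rintegral_itv_obnd_cbnd//; exact: il.
Qed.

Lemma haar_origin_integrable i : mu.-integrable setT (EFin \o haar_origin i).
Proof.
have := integrableB measurableT (integrableZl measurableT 2 (low_indic_integrable (2 ^- i.+1)))
  (low_indic_integrable (2 ^- i)).
by apply: eq_integrable => // x _; rewrite /haar_origin /= EFinB EFinM.
Qed.

Lemma haar_sum_integrable n : mu.-integrable setT (EFin \o haar_sum n).
Proof.
have := @integrable_sum _ _ _ mu setT measurableT _ (index_iota 0 n) xpredT
  (fun i x => (haar_origin i x)%:E) (fun i _ => haar_origin_integrable i).
by apply: eq_integrable => // x _ /=; rewrite sumEFin.
Qed.

Lemma haar_sumS n x : haar_sum n.+1 x = haar_sum n x + haar_origin n x.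
Proof. by rewrite /haar_sum big_nat_recr. Qed.

(** The primitive of [haar_origin i], with [c = 2 ^- i]: a tent over [[0, c]]. *)
Definition tent c x := 2 * clip (c / 2) x - clip c x.

Lemma tent_left c x : 0 <= c -> x <= 0 -> tent c x = 0.
Proof.
move=> c0 x0; rewrite /tent /clip max_r// !min_l ?divr_ge0//; lra.
Qed.

Lemma tent_right c x : 0 <= c -> c <= x -> tent c x = 0.
Proof.
move=> c0 cx; rewrite /tent /clip max_l; last lra.
by rewrite !min_r//; [lra|lra].
Qed.

Lemma tent_up c x : 0 <= c -> 0 <= x -> x <= c / 2 -> tent c x = x.
Proof.
move=> c0 x0 xc; rewrite /tent /clip max_l// !min_l//; lra.
Qed.

Lemma tent_down c x : 0 <= c -> c / 2 <= x -> x <= c -> tent c x = c - x.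
Proof.
move=> c0 x0 xc; rewrite /tent /clip max_l; last lra.
rewrite min_r// min_l//; lra.
Qed.

Lemma haar_origin_integral i s t : s <= t ->
  \int[mu]_(x in `[s, t]) haar_origin i x = tent (2 ^- i) t - tent (2 ^- i) s.
Proof.
move=> st.
have il c : mu.-integrable `[s, t] (EFin \o low_indic c).
  by apply: integrableS (low_indic_integrable c).
have il2 c : mu.-integrable `[s, t] (EFin \o (fun x => 2 * low_indic c x)).
  have := @integrableZl _ _ _ mu `[s, t] (measurable_itv _) 2 _ (il c).
  by apply: eq_integrable => // x _; rewrite /= EFinM.
have p0 k : (0 : R) <= 2 ^- k by exact/ltW/pow_gt0.
rewrite RintegralB// RintegralZl// (low_indic_integral (p0 i.+1) st).
rewrite (low_indic_integral (p0 i) st).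
have -> : 2 ^- i.+1 = 2 ^- i / 2 :> R by rewrite [in RHS]pow_half mulrAC divff ?mul1r.
by rewrite /tent; lra.
Qed.

(** The pairing of [F] with the Haar function supported in [[s, s + 2 * d]]. *)
Definition haar_coef F s d :=
  \int[mu]_(x in `[s, s + d]) F x - \int[mu]_(x in `[s + d, s + 2 * d]) F x.

(** With [d = 2 ^- j.+1], the coefficient is a second difference of step [d] of the
    tent over [[0, 2 ^- i]]. If [i < j], the breakpoints of the tent are multiples of
    [2 * d], and the tent is affine on the interval of the difference. If [i > j], the
    tent vanishes at all multiples of [d]. If [i = j], the peak of the tent is the
    midpoint of the interval [z = 0], and the tent vanishes on the others. *)
Lemma haar_origin_coef i j (z : int) :
  haar_coef (haar_origin i) (2 ^- j * z%:~R) (2 ^- j.+1) =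
  2 ^- j * ((i == j) && (z == 0))%:R.
Proof.
pose d : R := 2 ^- j.+1.
have d0 : 0 < d by exact: pow_gt0.
have sE : 2 ^- j * z%:~R = 2 * d * z%:~R by rewrite pow_half.
rewrite /haar_coef -/d !haar_origin_integral ?sE; [|lra|lra].
rewrite [in RHS]pow_half -/d.
set c := 2 ^- i; have c0 : 0 < c by exact: pow_gt0.
set w := 2 * d * z%:~R.
have hz : (z < 0)%R \/ (z = 0) \/ (0 < z)%R by case: (ltgtP z 0) => ?; auto.
have zneg : (z < 0)%R -> z%:~R <= -1 :> R.
  by move=> z0; rewrite (_ : -1 = (-1)%:~R)// ler_int; lia.
have zpos : (0 < z)%R -> 1 <= z%:~R :> R.
  by move=> z0; rewrite (_ : 1 = 1%:~R)// ler_int; lia.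
case: hz => [z0|hz].
  (* the three values are taken left of the tent *)
  have := zneg z0 => zn; rewrite !tent_left ?(ltW c0)//; try (rewrite /w; nra).
  by rewrite (lt_eqF z0) andbF mulr0; lra.
have [ij|ji|ij] := ltngtP i j; last first.
- have cE : c = 2 * d by rewrite /c ij pow_half.
  case: hz => [z0|z0].
    have w0 : w = 0 by rewrite /w z0 mulr0.
    rewrite w0 z0 eqxx /= !add0r (@tent_left c 0) ?(ltW c0)//.
    rewrite (@tent_up c d) ?(ltW c0) ?(ltW d0)//; last by rewrite cE; lra.
    by rewrite (@tent_right c (2 * d)) ?(ltW c0) ?cE//; lra.
  have zp := zpos z0.
  rewrite !tent_right ?(ltW c0)//; try (rewrite /w cE; nra).
  by rewrite (gt_eqF z0) andbF mulr0; lra.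
- have cd : c <= d.
    rewrite /c /d lef_pV2 ?posrE ?exprn_gt0//.
    by rewrite ler_eXn2l ?ltr1n.
  rewrite /= mulr0.
  case: hz => [z0|z0].
    have w0 : w = 0 by rewrite /w z0 mulr0.
    rewrite w0 !add0r (@tent_left c 0) ?(ltW c0)//.
    rewrite !tent_right ?(ltW c0)//; lra.
  have zp := zpos z0.
  have wd : d <= w by rewrite /w; nra.
  rewrite (@tent_right c w) ?(ltW c0) ?(@tent_right c (w + d)) ?(ltW c0)
    ?(@tent_right c (w + 2 * d)) ?(ltW c0)//; lra.
- rewrite /= mulr0.
  (* [M] intervals of length [2 * d] cover each of the two slopes of the tent *)
  pose M : int := (2 ^ (j - i.+1))%N.
  have cE : c = 4 * d * M%:~R.
    have -> : M%:~R = 2 ^+ (j - i.+1) :> R by rewrite /M -natrX pmulrn.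
    have -> : d = 2 ^- (i + (j - i.+1)).+2.
      by rewrite /d; congr (_ ^- _); rewrite -[in LHS](subnKC ij) addSn.
    rewrite /c !exprS exprD.
    have p1 : (2 : R) ^+ i != 0 by rewrite expf_neq0.
    have p2 : (2 : R) ^+ (j - i.+1) != 0 by rewrite expf_neq0.
    by rewrite !invfM; field; rewrite p1 p2.
  have z0 : (0 <= z)%R by case: hz => [->//|/ltW].
  have zr : 0 <= z%:~R :> R by rewrite (_ : 0 = 0%:~R)// ler_int.
  have [h1|h1] := leP (z + 1) M.
    have r1 : z%:~R + 1 <= M%:~R :> R by rewrite -[1]/(1%:~R) -intrD ler_int.
    have w1 : 0 <= w by rewrite /w; nra.
    have w2 : w + 2 * d <= c / 2 by rewrite /w cE; nra.
    have -> : tent c w = w by apply: tent_up; lra.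
    have -> : tent c (w + d) = w + d by apply: tent_up; lra.
    have -> : tent c (w + 2 * d) = w + 2 * d by apply: tent_up; lra.
    lra.
  have g1 : M%:~R <= z%:~R :> R by rewrite ler_int; lia.
  have [h2|h2] := leP (z + 1) (2 * M).
    have r1 : z%:~R + 1 <= 2 * M%:~R :> R by rewrite -[1]/(1%:~R) -[2]/(2%:~R) -intrM -intrD ler_int.
    have w1 : c / 2 <= w by rewrite /w cE; nra.
    have w2 : w + 2 * d <= c by rewrite /w cE; nra.
    have -> : tent c w = c - w by apply: tent_down; lra.
    have -> : tent c (w + d) = c - (w + d) by apply: tent_down; lra.
    have -> : tent c (w + 2 * d) = c - (w + 2 * d) by apply: tent_down; lra.
    lra.
  have g2 : 2 * M%:~R <= z%:~R :> R by rewrite -[2]/(2%:~R) -intrM ler_int; lia.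
  have w1 : c <= w by rewrite /w cE; nra.
  have -> : tent c w = 0 by apply: tent_right; lra.
  have -> : tent c (w + d) = 0 by apply: tent_right; lra.
  have -> : tent c (w + 2 * d) = 0 by apply: tent_right; lra.
  lra.
Qed.

Lemma haar_origin_unit i (z : int) :
  \int[mu]_(x in `[z%:~R, z%:~R + 1]) haar_origin i x = 0.
Proof.
rewrite haar_origin_integral; last lra.
set c := 2 ^- i; have c0 : 0 < c by exact: pow_gt0.
have c1 : c <= 1 by rewrite /c invf_le1 ?exprn_gt0// exprn_ege1// ler1n.
have [z0|z0] := ltP z 0.
  have zn : z%:~R <= -1 :> R by rewrite (_ : -1 = (-1)%:~R)// ler_int; lia.
  by rewrite !tent_left ?(ltW c0) ?subrr//; lra.
have [->|z1] := eqVneq z 0.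
  by rewrite mulr0z add0r (@tent_right c 1) ?(@tent_left c 0) ?(ltW c0)// subrr.
have zp : 1 <= z%:~R :> R by rewrite (_ : 1 = 1%:~R)// ler_int; lia.
by rewrite !tent_right ?(ltW c0) ?subrr//; lra.
Qed.

End HaarSums.

(** * The limit of the Haar sums *)

Section HaarLimit.
Context {R : realType}.
Local Notation mu := (@lebesgue_measure R).
Implicit Types (x s t c : R) (i j m n : nat).

Let pow_le i j : (i <= j)%N -> (2 : R) ^- j <= 2 ^- i.
Proof. by move=> ij; rewrite lef_pV2 ?posrE ?exprn_gt0// ler_eXn2l// ltr1n. Qed.

Lemma haar_origin_le i x : `|haar_origin i x| <= low_indic (2 ^- i) x.
Proof.
rewrite /haar_origin /low_indic !indicE !mem_setE !in_itv/=.
have h := @pow_half R i; have p := @pow_gt0 R i.+1; rewrite h.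
have [x0|x0] := ltP 0 x; last by rewrite /= mulr0 subrr normr0.
have [x1|x1] := ltP x (2 ^- i.+1).
  rewrite (_ : x < 2 * 2 ^- i.+1); last lra.
  by rewrite /= mulr1 (_ : 2 - 1 = 1) ?normr1//; lra.
by rewrite /= mulr0 sub0r normrN ger0_norm.
Qed.

Lemma low_indic_integralT c : 0 <= c -> Rintegral mu setT (low_indic c) = c.
Proof.
move=> c0; rewrite /Rintegral integral_indic//= setIT [X in fine X]lebesgue_measure_itv/=.
rewrite lte_fin; case: ltP => [_|c1]; first by rewrite oppr0 addr0.
by apply/eqP; rewrite eq_le c0.
Qed.

Let haar_sum_diff_integrable m n :
  mu.-integrable setT (EFin \o (fun x => haar_sum m x - haar_sum n x)).
Proof.
have := @integrableB _ _ _ mu setT measurableT _ _ (haar_sum_integrable m) (haar_sum_integrable n).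
by apply: eq_integrable => // x _; rewrite /= EFinB.
Qed.

Lemma haar_sum_L1 m n : (n <= m)%N ->
  Rintegral mu setT (fun x => `|haar_sum m x - haar_sum n x|) <= 2 * 2 ^- n - 2 * 2 ^- m.
Proof.
elim: m => [|m IH].
  rewrite leqn0 => /eqP ->; under eq_Rintegral do rewrite subrr normr0.
  by rewrite Rintegral_cst// mul0r subrr.
rewrite leq_eqVlt => /predU1P[->|]; last rewrite ltnS => nm.
  by under eq_Rintegral do rewrite subrr normr0; rewrite Rintegral_cst// mul0r subrr.
have i1 := integrable_norm (haar_sum_diff_integrable m n).
have i2 := low_indic_integrable (2 ^- m : R).
have i3 : mu.-integrable setT (EFin \o (fun x => `|haar_sum m x - haar_sum n x| + low_indic (2 ^- m) x)).
  have := integrableD measurableT i1 i2.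
  by apply: eq_integrable => // x _; rewrite /= EFinD.
apply: (@le_trans _ _ (Rintegral mu setT (fun x => `|haar_sum m x - haar_sum n x| + low_indic (2 ^- m) x))).
  apply: le_Rintegral => //; first exact: integrable_norm (haar_sum_diff_integrable m.+1 n).
  move=> x _; rewrite haar_sumS addrAC (le_trans (ler_normD _ _))// lerD2l.
  exact: haar_origin_le.
rewrite RintegralD// low_indic_integralT; last exact/ltW/pow_gt0.
move: (IH nm) (@pow_half R m); move: (2 ^- m) (2 ^- m.+1) (2 ^- n) => a b e; lra.
Qed.

Lemma haar_sum_coef n j (z : int) :
  haar_coef (haar_sum n) (2 ^- j * z%:~R) (2 ^- j.+1) = 2 ^- j * ((j < n)%N && (z == 0))%:R :> R.
Proof.
have ii D (f : R -> R) : measurable D -> mu.-integrable setT (EFin \o f) ->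
    mu.-integrable D (EFin \o f).
  by move=> mD; exact: integrableS.
elim: n => [|n IH].
  have e0 : @haar_sum R 0 = cst 0 by apply/funext => x; rewrite /haar_sum big_geq.
  by rewrite e0 /haar_coef !Rintegral_cst// !mul0r subrr mulr0.
have -> : haar_sum n.+1 = (fun x => haar_sum n x + haar_origin n x) :> (R -> R).
  by apply/funext => x; rewrite haar_sumS.
have i1 := haar_sum_integrable n; have i2 := haar_origin_integrable n.
have hD s t : \int[mu]_(x in `[s, t]) (haar_sum n x + haar_origin n x) =
    \int[mu]_(x in `[s, t]) haar_sum n x + \int[mu]_(x in `[s, t]) haar_origin n x.
  by apply: RintegralD => //; exact: ii.
rewrite /haar_coef !hD.
have := haar_origin_coef n j z; move: IH; rewrite /haar_coef.
have -> : ((j < n.+1)%N && (z == 0))%:R = ((j < n)%N && (z == 0))%:R + ((n == j) && (z == 0))%:R :> R.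
  by rewrite ltnS leq_eqVlt eq_sym; case: ltngtP => //= _; case: (z == 0); rewrite /= ?addr0 ?add0r.
by rewrite mulrDr => <- <-; rewrite opprD addrACA.
Qed.

Lemma haar_sum_unit n (z : int) : \int[mu]_(x in `[z%:~R, z%:~R + 1]) haar_sum n x = 0.
Proof.
elim: n => [|n IH].
  have e0 : @haar_sum R 0 = cst 0 by apply/funext => x; rewrite /haar_sum big_geq.
  by rewrite e0 Rintegral_cst// mul0r.
have -> : haar_sum n.+1 = (fun x => haar_sum n x + haar_origin n x) :> (R -> R).
  by apply/funext => x; rewrite haar_sumS.
rewrite [LHS]RintegralD//; first by rewrite IH haar_origin_unit addr0.
  by apply: integrableS (haar_sum_integrable n).
by apply: integrableS (haar_origin_integrable n).
Qed.

(** At a given point only the Haar functions whose support is long enough to reach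
    it are nonzero. *)
Lemma haar_sum_stationary x : exists n0, forall n, (n0 <= n)%N -> haar_sum n x = haar_sum n0 x.
Proof.
have [n0 hn0] : exists n0, forall i, (n0 <= i)%N -> haar_origin i x = 0.
  have [x0|x0] := leP x 0.
    exists 0%N => i _; apply/eqP; rewrite -normr_le0.
    by rewrite (le_trans (haar_origin_le i x))// /low_indic indicE mem_setE in_itv/= ltNge x0.
  have [n0 hn] : exists n0, 2 ^- n0 <= x.
    exists (Num.bound x^-1); rewrite -[leRHS]invrK lef_pV2 ?posrE ?invr_gt0 ?exprn_gt0//.
    rewrite (le_trans (ltW (archi_boundP _))) ?invr_ge0 ?(ltW x0)//.
    by rewrite -natrX ler_nat ltnW// ltn_expl.
  exists n0 => i ni; apply/eqP; rewrite -normr_le0.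
  rewrite (le_trans (haar_origin_le i x))// /low_indic indicE mem_setE in_itv/= x0 /=.
  by rewrite ltNge (le_trans (pow_le ni) hn).
exists n0; elim=> [|n IH]; first by rewrite leqn0 => /eqP ->.
rewrite leq_eqVlt => /predU1P[->//|]; rewrite ltnS => nn.
by rewrite haar_sumS hn0// addr0 IH.
Qed.

Definition haar_series x := limn (haar_sum ^~ x).

Lemma haar_sum_cvg x : haar_sum n x @[n --> \oo] --> haar_series x.
Proof.
have [n0 hn0] := haar_sum_stationary x.
suff h : haar_sum n x @[n --> \oo] --> haar_sum n0 x by rewrite /haar_series (cvg_lim _ h).
by apply: cvg_near_cst; exists n0.
Qed.

Lemma haar_series_measurable : measurable_fun setT haar_series.
Proof.
apply: (@measurable_fun_cvg _ _ _ _ (fun n => haar_sum n)) => //.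
- by move=> n; exact: integrable_measurable (haar_sum_integrable n).
- by move=> x _; exact: haar_sum_cvg.
Qed.

(** The bound [haar_sum_L1] on the differences of partial sums passes to the limit by
    Fatou's lemma. *)
Lemma haar_series_L1 n :
  (\int[mu]_x `|haar_series x - haar_sum n x|%:E <= (2 * 2 ^- n)%:E)%E.
Proof.
have mS m := integrable_measurable (haar_sum_integrable m).
pose f m x : \bar R := `|haar_sum m x - haar_sum n x|%:E.
have mf m : measurable_fun setT (f m).
  apply/measurable_EFinP; apply: measurableT_comp => //.
  by apply: measurable_funB; exact: mS.
have cf x : f m x @[m --> \oo] --> `|haar_series x - haar_sum n x|%:E.
  apply: cvg_EFin; first exact: nearW.
  by apply: cvg_norm; apply: cvgB; [exact: haar_sum_cvg|exact: cvg_cst].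
have f0 m x : setT x -> (0 <= f m x)%E by move=> _; rewrite lee_fin.
have := @fatou _ _ _ mu setT measurableT f mf f0.
have -> : (\int[mu]_x limn_einf (f ^~ x) = \int[mu]_x `|haar_series x - haar_sum n x|%:E)%E.
  by apply: eq_integral => x _; rewrite (cvg_limn_einf_sup (cf x)).1.
move=> h; apply: (le_trans h).
rewrite limn_einf_lim; apply: lime_le; first exact: is_cvg_einfs.
apply: nearW => m; apply: (@le_trans _ _ (\int[mu]_x f (maxn m n) x)%E).
  by apply: ereal_inf_lbound; exists (maxn m n) => //=; rewrite leq_maxl.
have iN := integrable_norm (haar_sum_diff_integrable (maxn m n) n).
have -> : (\int[mu]_x f (maxn m n) x =
    (Rintegral mu setT (fun x => `|haar_sum (maxn m n) x - haar_sum n x|))%:E)%E.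
  by rewrite /Rintegral fineK//; exact: integrable_fin_num.
rewrite lee_fin (le_trans (haar_sum_L1 (leq_maxr m n)))//.
by have := @pow_gt0 R (maxn m n); lra.
Qed.

Lemma haar_series_integrable : mu.-integrable setT (EFin \o haar_series).
Proof.
apply/integrableP; split; first by apply/measurable_EFinP; exact: haar_series_measurable.
have := haar_series_L1 0.
have -> : (\int[mu]_x `|haar_series x - haar_sum 0 x|%:E = \int[mu]_x `|(EFin \o haar_series) x|)%E.
  by apply: eq_integral => x _; rewrite /haar_sum big_geq// subr0.
by move=> h; apply: le_lt_trans h _; rewrite ltry.
Qed.

(** The index [N : option nat] treats at once the partial sums, [Some N], and the full
    series, [None]. In both cases the function is within [2 * 2 ^- n] of
    [haar_sum (depth N n)] in the mean. *)
Definition depth (N : option nat) n := if N is Some N then minn n N else n.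

Definition in_depth (N : option nat) j := if N is Some N then (j < N)%N else true.

Definition haar_fun_of (N : option nat) : R -> R :=
  if N is Some N then haar_sum N else haar_series.

Lemma haar_fun_of_integrable N : mu.-integrable setT (EFin \o haar_fun_of N).
Proof. case: N => [N|]; [exact: haar_sum_integrable|exact: haar_series_integrable]. Qed.

Lemma haar_fun_of_L1 N n :
  Rintegral mu setT (fun x => `|haar_fun_of N x - haar_sum (depth N n) x|) <= 2 * 2 ^- n.
Proof.
case: N => [N|] /=; last first.
  by rewrite -lee_fin /Rintegral fineK; [exact: haar_series_L1|
    rewrite ge0_fin_numE ?integral_ge0// (le_lt_trans (haar_series_L1 n)) ?ltry].
have [nN|Nn] := leqP n N.
  rewrite (le_trans (haar_sum_L1 nN))//.
  by have := @pow_gt0 R N; lra.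
under eq_Rintegral do rewrite subrr normr0.
by rewrite Rintegral_cst// mul0r mulr_ge0// ltW.
Qed.

Lemma haar_fun_of_diff_integrable N n :
  mu.-integrable setT (EFin \o (fun x => haar_fun_of N x - haar_sum (depth N n) x)).
Proof.
have := @integrableB _ _ _ mu setT measurableT _ _ (haar_fun_of_integrable N) (haar_sum_integrable (depth N n)).
by apply: eq_integrable => // x _; rewrite /= EFinB.
Qed.

Let small_eq0 (v : R) c : (forall n, `|v| <= c * 2 ^- n) -> v = 0.
Proof.
move=> h; apply/eqP; rewrite -normr_le0.
have cv : (c * 2^-1 ^+ n) @[n --> \oo] --> (0 : R).
  by apply: cvg_geometric; rewrite ger0_norm// invf_lt1// ltr1n.
have : `|v| <= limn (fun n : nat => c * 2^-1 ^+ n).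
  apply: limr_ge; first by apply/cvg_ex; exists 0.
  by apply: nearW => n; rewrite exprVn.
by rewrite (cvg_lim _ cv).
Qed.

Let integral_approx N n s t :
  `|\int[mu]_(x in `[s, t]) haar_fun_of N x - \int[mu]_(x in `[s, t]) haar_sum (depth N n) x|
  <= 2 * 2 ^- n.
Proof.
have ii (f : R -> R) : mu.-integrable setT (EFin \o f) -> mu.-integrable `[s, t] (EFin \o f).
  exact: integrableS.
rewrite -RintegralB//; [|exact: ii (haar_fun_of_integrable N)|exact: ii (haar_sum_integrable _)].
have iD := haar_fun_of_diff_integrable N n.
rewrite Rintegral_indic// (le_trans _ (haar_fun_of_L1 N n))//.
apply: normr_Rintegral_le (integrable_norm iD).
  by apply: measurable_funM; [exact: measurable_indic|exact: integrable_measurable].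
by move=> x; rewrite normrM ler_piMl// indicE; case: (_ \in _); rewrite ?normr0 ?normr1.
Qed.

(** The coefficients are continuous for the convergence in the mean, and those of
    [haar_sum (depth N n)] do not change any more once [n > j]. *)
Lemma haar_fun_of_coef N j (z : int) :
  haar_coef (haar_fun_of N) (2 ^- j * z%:~R) (2 ^- j.+1) =
  2 ^- j * (in_depth N j && (z == 0))%:R.
Proof.
apply/eqP; rewrite -subr_eq0; apply/eqP; apply: (@small_eq0 _ 4).
suff h n : (j < n)%N -> `|haar_coef (haar_fun_of N) (2 ^- j * z%:~R) (2 ^- j.+1) -
    2 ^- j * (in_depth N j && (z == 0))%:R| <= 4 * 2 ^- n.
  move=> n; rewrite (le_trans (h (maxn n j.+1) _)) ?leq_maxr// ler_wpM2l// pow_le//.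
  exact: leq_maxl.
move=> jn; have -> : in_depth N j = (j < depth N n)%N.
  by case: N => [N|] /=; rewrite ?leq_min jn.
rewrite -haar_sum_coef /haar_coef.
set a := Rintegral _ _ _; set b := Rintegral _ _ _; set a' := Rintegral _ _ _; set b' := Rintegral _ _ _.
have -> : a - b - (a' - b') = (a - a') - (b - b') by lra.
rewrite (le_trans (ler_normB _ _))//.
have := integral_approx N n (2 ^- j * z%:~R) (2 ^- j * z%:~R + 2 ^- j.+1).
have := integral_approx N n (2 ^- j * z%:~R + 2 ^- j.+1) (2 ^- j * z%:~R + 2 * 2 ^- j.+1).
rewrite -/a -/b -/a' -/b'; lra.
Qed.

Lemma haar_fun_of_unit N (z : int) :
  \int[mu]_(x in `[z%:~R, z%:~R + 1]) haar_fun_of N x = 0.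
Proof.
apply: (@small_eq0 _ 2) => n.
by have := integral_approx N n z%:~R (z%:~R + 1); rewrite haar_sum_unit subr0.
Qed.

End HaarLimit.

(** * Littlewood-Paley pieces of the Haar sums *)

Section HaarPieces.
Context {R : realType}.
Local Notation mu := (@lebesgue_measure R).
Variables (phi : R -> R) (C B : R).
Hypotheses (phi_cont : continuous phi)
  (phi_decay : forall x, `|phi x| <= C / oneDsqr x ^+ 2)
  (step_decay : forall u, `|lp_step phi u| <= B / oneDsqr u).
Implicit Types (x y u v s t c d : R) (i j k m n : nat) (F : R -> R).

Let C0 : 0 <= C := kernel_C_ge0 phi_decay.
Let B0 : 0 <= B.
Proof.
have := step_decay 0; rewrite /oneDsqr expr0n/= addr0 divr1.
exact: le_trans (normr_ge0 _).
Qed.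

Local Notation Psi := (lp_step phi).
Local Notation conv := (lp_conv phi).

Let Psi_le u : `|Psi u| <= B * (oneDsqr u)^-1.
Proof. exact: step_decay. Qed.

Let Psi_leB u : `|Psi u| <= B.
Proof. by rewrite (le_trans (Psi_le u))// ler_piMr// oneDsqrV_le1. Qed.

Lemma peetre u v : (oneDsqr (u - v))^-1 <= 2 * oneDsqr u / oneDsqr v.
Proof.
rewrite ler_pdivlMr// mulrC ler_pdivrMr// /oneDsqr.
have := sqr_ge0 u; have := sqr_ge0 (u - v); have := sqr_ge0 (u + (u - v)).
by move=> h1 h2 h3; have := mulr_ge0 h2 h3; nra.
Qed.

Lemma lp_conv_haar_origin i k y : conv (haar_origin i) k.+1 y =
  Psi (2 ^+ k.+1 * y) - 2 * Psi (2 ^+ k.+1 * (y - 2 ^- i.+1)) +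
  Psi (2 ^+ k.+1 * (y - 2 ^- i)).
Proof.
have p0 n : (0 : R) <= 2 ^- n by rewrite invr_ge0 exprn_ge0.
have il c := @low_indic_integrable R c.
have i2 : mu.-integrable setT (EFin \o (fun x => 2 * low_indic (2 ^- i.+1) x)).
  have := @integrableZl _ _ _ mu setT measurableT 2 _ (il (2 ^- i.+1)).
  by apply: eq_integrable => // x _; rewrite /= EFinM.
rewrite (lp_convB phi_cont phi_decay)// (lp_convZ phi_cont phi_decay)//.
by rewrite !(lp_conv_step phi_cont phi_decay)//; lra.
Qed.

Lemma lp_conv_haar_sumS n k y : conv (haar_sum n.+1) k y =
  conv (haar_sum n) k y + conv (haar_origin n) k y.
Proof.
rewrite -(lp_convD phi_cont phi_decay); last 2 first.
- exact: haar_sum_integrable.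
- exact: haar_origin_integrable.
by congr lp_conv; apply/funext => x; rewrite haar_sumS.
Qed.

Lemma lp_conv_haar_sum0 k y : conv (haar_sum 0) k y = 0.
Proof.
rewrite /lp_conv; under eq_Rintegral do rewrite /haar_sum big_geq// mul0r.
by rewrite Rintegral_cst// mul0r.
Qed.

(** Seen at scale [2 ^- k.+1] near the origin, each of the first [k.+1] Haar
    functions is a unit jump, up to breakpoints so far away that their contributions
    form a convergent geometric series. *)
Lemma lp_conv_haar_sum_near m k y : (m <= k.+1)%N ->
  `|conv (haar_sum m) k.+1 y - m%:R * Psi (2 ^+ k.+1 * y)| <=
  10 * B * oneDsqr (2 ^+ k.+1 * y) * 2 ^- (k.+1 - m).
Proof.
set Y := 2 ^+ k.+1 * y; pose E := 2 * B * oneDsqr Y.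
have E0 : 0 <= E by rewrite !mulr_ge0.
have far n : `|Psi (Y - 2 ^+ n)| <= E * 2 ^- n.
  rewrite (le_trans (Psi_le _))// (le_trans (ler_wpM2l B0 (peetre _ _)))//.
  have -> : B * (2 * oneDsqr Y / oneDsqr (2 ^+ n)) = E * (oneDsqr (2 ^+ n))^-1.
    by rewrite /E; ring.
  rewrite ler_wpM2l// lef_pV2 ?posrE ?exprn_gt0// /oneDsqr.
  have : (1 : R) <= 2 ^+ n by rewrite exprn_ege1// ler1n.
  nra.
have -> : 10 * B * oneDsqr Y = 5 * E by rewrite /E; ring.
elim: m => [|m IH] mk.
  by rewrite lp_conv_haar_sum0 mul0r subrr normr0 mulr_ge0 ?invr_ge0 ?exprn_ge0// mulr_ge0.
have {}IH := IH (ltnW mk).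
have km : (k.+1 - m = (k.+1 - m.+1).+1)%N by rewrite subnS prednK// subn_gt0.
rewrite km in IH.
have shiftE i : (i <= k.+1)%N -> 2 ^+ k.+1 * (y - 2 ^- i) = Y - 2 ^+ (k.+1 - i).
  move=> ik; rewrite mulrBr -/Y; congr (_ - _).
  by rewrite -[in LHS](subnK ik) exprD mulfK// expf_neq0.
rewrite lp_conv_haar_sumS lp_conv_haar_origin -/Y !shiftE ?(ltnW mk)// km.
have h1 := far (k.+1 - m.+1)%N; have h2 := far (k.+1 - m.+1).+1.
move: IH h1 h2; set l := (k.+1 - m.+1)%N; rewrite !exprS !invfM.
set P := conv _ _ _; set p1 := Psi Y; set p2 := Psi (Y - 2 ^+ l).
set p3 := Psi (Y - 2 * 2 ^+ l); set e := (2 ^+ l)^-1.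
have e0 : 0 <= e by rewrite invr_ge0 exprn_ge0.
move=> IH h1 h2; rewrite -[m.+1%:R]natr1.
have -> : P + (p1 - 2 * p2 + p3) - (m%:R + 1) * p1 = (P - m%:R * p1) + (p3 - 2 * p2) by ring.
rewrite (le_trans (ler_normD _ _))//.
(* [p2] counts twice for [E * e] and [p3] once for [E * e / 2]; with the induction
   hypothesis [5 / 2 * (E * e)] the total is [5 * (E * e)] *)
have h3 : `|p3 - 2 * p2| <= `|p3| + 2 * `|p2|.
  by rewrite (le_trans (ler_normB _ _))// normrM ger0_norm.
have hE : E * (2^-1 * e) = E * e / 2 by ring.
have hE5 : 5 * E * (2^-1 * e) = 5 * (E * e) / 2 by ring.
have hE6 : 5 * E * e = 5 * (E * e) by ring.
rewrite hE in h2; rewrite hE5 in IH; rewrite hE6.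
have Ee : 0 <= E * e by rewrite mulr_ge0.
move: (E * e) (`|p3|) (`|p2|) (`|P - m%:R * p1|) (`|p3 - 2 * p2|) IH h1 h2 h3 Ee => z1 z2 z3 z4 z5.
by move=> *; lra.
Qed.

(** The Haar functions of order beyond [k] have a mean of size [2 ^- k], which makes up
    for the size [2 ^ k] of the kernel. *)
Let lp_conv_remainder N k y :
  `|conv (haar_fun_of N) k y - conv (haar_sum (depth N k)) k y| <= 4 * C.
Proof.
rewrite -(lp_convB phi_cont phi_decay); last 2 first.
- exact: haar_fun_of_integrable.
- exact: haar_sum_integrable.
have := lp_conv_bounded phi_cont phi_decay k y (haar_fun_of_diff_integrable N k).
move=> /le_trans; apply.
have -> : 4 * C = 2 * 2 ^+ k * C * (2 * 2 ^- k).
  have p1 : (2 : R) ^+ k != 0 by rewrite expf_neq0.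
  by field; rewrite p1.
by rewrite ler_wpM2l ?haar_fun_of_L1// !mulr_ge0// exprn_ge0.
Qed.

Lemma depth_le N k : (depth N k <= k)%N.
Proof. by case: N => [N|] //=; exact: geq_minl. Qed.

Lemma lp_conv_haar_near N k y :
  `|conv (haar_fun_of N) k.+1 y - (depth N k.+1)%:R * Psi (2 ^+ k.+1 * y)| <=
  10 * B * oneDsqr (2 ^+ k.+1 * y) + 4 * C.
Proof.
have h1 := lp_conv_haar_sum_near y (depth_le N k.+1).
have h2 := lp_conv_remainder N k.+1 y.
set a := conv (haar_fun_of N) _ _ in h2 *; set b := conv (haar_sum _) _ _ in h1 h2.
set c := _%:R * _ in h1 *.
have -> : a - c = (b - c) + (a - b) by lra.
rewrite (le_trans (ler_normD _ _))// lerD// (le_trans h1)// ler_piMr ?mulr_ge0//.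
by rewrite invf_le1 ?exprn_gt0// exprn_ege1// ler1n.
Qed.

(** Each Haar function contributes a bounded amount to a piece, and the piece of order
    [k] feels at most [k] of them, apart from a bounded remainder. *)
Lemma lp_conv_haar_growth N : exists A, forall k y,
  `|conv (haar_fun_of N) k y| <= A * k.+1%:R.
Proof.
pose L := Rintegral mu setT (fun x => `|haar_fun_of N x|).
have L0 : 0 <= L by apply: Rintegral_ge0.
exists (4 * B + 4 * C + 2 * C * L) => -[|k] y.
  rewrite mulr1 (le_trans (lp_conv_bounded phi_cont phi_decay _ _ (haar_fun_of_integrable N)))//.
  by rewrite expr0 mulr1 -/L; move: B0 C0 => ? ?; lra.
have hS m : `|conv (haar_sum m) k.+1 y| <= 4 * B * m%:R.
  elim: m => [|m IH]; first by rewrite lp_conv_haar_sum0 normr0 mulr0.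
  rewrite lp_conv_haar_sumS (le_trans (ler_normD _ _))// -[m.+1%:R]natr1 mulrDr lerD// mulr1.
  rewrite lp_conv_haar_origin; set p1 := Psi _; set p2 := Psi _; set p3 := Psi _.
  have h1 : `|p1| <= B by exact: Psi_leB.
  have h2 : `|p2| <= B by exact: Psi_leB.
  have h3 : `|p3| <= B by exact: Psi_leB.
  move: h1 h2 h3; rewrite !ler_norml; lra.
have h1 := hS (depth N k.+1); have h2 := lp_conv_remainder N k.+1 y.
have h3 : (depth N k.+1)%:R <= k.+2%:R :> R by rewrite ler_nat (leq_trans (depth_le _ _)).
set a := conv (haar_fun_of N) _ _ in h2 *; set b := conv (haar_sum _) _ _ in h1 h2.
have -> : a = b + (a - b) by lra.
rewrite (le_trans (ler_normD _ _))//.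
have CL : 0 <= 2 * C * L by rewrite !mulr_ge0.
have h4 : 4 * B * (depth N k.+1)%:R <= 4 * B * k.+2%:R by rewrite ler_wpM2l// mulr_ge0.
have k2 : (1 : R) <= k.+2%:R by rewrite ler1n.
have h5 : 4 * C <= 4 * C * k.+2%:R by rewrite ler_peMr// mulr_ge0.
have h6 : 0 <= 2 * C * L * k.+2%:R by rewrite mulr_ge0.
have -> : (4 * B + 4 * C + 2 * C * L) * k.+2%:R =
    4 * B * k.+2%:R + 4 * C * k.+2%:R + 2 * C * L * k.+2%:R by ring.
move: h1 h2 h4 h5 h6; move: (4 * B * _) (4 * B * _) (4 * C * _) (2 * C * L * _).
by move=> z1 z2 z3 z4 *; lra.
Qed.

(** A sequence of functions whose [k]-th term is uniformly bounded and carries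
    a mass of size [2 ^- k], as the [k]-th piece of a function of bounded
    variation does. *)
Definition dyadic_mass (v : nat -> R -> R) := exists M, forall k, exists G,
  [/\ measurable_fun setT G, forall y, `|v k y| <= G y, forall y, G y <= M &
      (\int[mu]_y (G y)%:E <= (M * 2 ^- k)%:E)%E].

Lemma dyadic_massD (v w : nat -> R -> R) :
  dyadic_mass v -> dyadic_mass w -> dyadic_mass (fun k y => v k y + w k y).
Proof.
move=> [M hv] [M' hw]; exists (M + M') => k.
have [G [mG vG GM iG]] := hv k; have [G' [mG' vG' GM' iG']] := hw k.
exists (fun y => G y + G' y); split.
- exact: measurable_funD.
- by move=> y; rewrite (le_trans (ler_normD _ _))// lerD.
- by move=> y; rewrite lerD.
- under eq_integral do rewrite EFinD.
  rewrite ge0_integralD//=.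
  + by rewrite mulrDl EFinD leeD.
  + by move=> y _; rewrite lee_fin (le_trans _ (vG y)).
  + exact/measurable_EFinP.
  + by move=> y _; rewrite lee_fin (le_trans _ (vG' y)).
  + exact/measurable_EFinP.
Qed.

(** A piece is a sum of three responses to jumps, each decaying away from its jump at
    scale [2 ^- k]. The piece of order 0 involves [phi] itself and inherits its decay,
    as the support of [haar_origin i] is inside the unit interval. *)
Let haar_origin_mass i : dyadic_mass (fun k y => conv (haar_origin i) k y).
Proof.
pose W (u : R) := (oneDsqr u)^-1.
have cW : continuous W by exact: continuous_oneDsqrV.
have mW (a b : R) : measurable_fun setT (fun y => W (a * y - b)).
  apply: (measurableT_comp (continuous_measurable_fun cW)).
  by apply: measurable_funB => //; apply: measurable_funM.
pose M := (4 * B + 4 * C) * (1 + pi).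
have [M1 M2 M3 M4] : [/\ 4 * B <= M, 4 * C <= M, 4 * B * pi <= M & 4 * C * pi <= M].
  have p0 := pi_ge0 R; have Bp := mulr_ge0 B0 p0; have Cp := mulr_ge0 C0 p0.
  rewrite /M; move: B0 C0 p0 Bp Cp; move: (@pi R) => z b0 c0 z0 bz cz.
  by split; nra.
exists M => -[|k].
  exists (fun y => 4 * C * W (1 * y - 0)); split.
  - by apply: measurable_funM.
  - move=> y; rewrite mul1r subr0.
    have pw x : `|haar_origin i x * lp_kernel phi 0 (y - x)| <= 4 * C * W y * low_indic (2 ^- i) x.
      rewrite normrM /=.
      have h1 := haar_origin_le i x.
      have h2 : low_indic (2 ^- i) x != 0 -> `|phi (y - x)| <= 4 * C * W y.
        rewrite /low_indic indicE mem_setE in_itv/= => hx.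
        have {}hx : 0 < x < 1.
          move: hx; rewrite pnatr_eq0 eqb0 negbK => /andP[x0 x1].
          by rewrite x0 (lt_le_trans x1)// invf_le1 ?exprn_gt0// exprn_ege1// ler1n.
        have hp := peetre (- x) (- y); rewrite opprK in hp.
        rewrite (le_trans (phi_decay _))//.
        have h3 : C / oneDsqr (y - x) ^+ 2 <= C * W (y - x).
          by rewrite ler_wpM2l// lef_pV2 ?posrE ?exprn_gt0// expr2 ler_peMl.
        rewrite (le_trans h3)// -mulrA mulrCA ler_wpM2l//.
        rewrite addrC in hp; rewrite (le_trans hp)//.
        have -> : oneDsqr (- y) = oneDsqr y by rewrite /oneDsqr sqrrN.
        by rewrite -/(W y) ler_wpM2r ?invr_ge0// /oneDsqr; nra.
      have [l0|l0] := eqVneq (low_indic (2 ^- i) x) 0.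
        move: h1; rewrite l0 mulr0 normr_le0 => /eqP ->.
        by rewrite normr0 mul0r.
      by rewrite mulrC ler_pM// h2.
    have iL : mu.-integrable setT (EFin \o (fun x => 4 * C * W y * low_indic (2 ^- i) x)).
      have := @integrableZl _ _ _ mu setT measurableT (4 * C * W y) _ (low_indic_integrable (2 ^- i)).
      by apply: eq_integrable => // x _; rewrite /= EFinM.
    have mh := integrable_measurable (lp_conv_integrand phi_cont phi_decay 0 y (haar_origin_integrable i)).
    rewrite (le_trans (normr_Rintegral_le mh pw iL))//.
    rewrite RintegralZl//; last exact: low_indic_integrable.
    rewrite low_indic_integralT ?invr_ge0 ?exprn_ge0//.
    rewrite ler_piMr ?mulr_ge0 ?invr_ge0//.
    by rewrite invf_le1 ?exprn_gt0// exprn_ege1// ler1n.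
  - move=> y; have w1 : W (1 * y - 0) <= 1 by exact: oneDsqrV_le1.
    by rewrite (le_trans _ M2)// ler_piMr// mulr_ge0.
  - under eq_integral do rewrite EFinM.
    rewrite ge0_integralZl//; last 3 first.
      by apply/measurable_EFinP; exact: mW.
      by move=> y _; rewrite lee_fin invr_ge0.
      by rewrite lee_fin mulr_ge0.
    by rewrite integral_oneDsqrV_affine// -EFinM lee_fin expr0 invr1 mul1r mulr1.
pose K : R := 2 ^+ k.+1; have K0 : 0 < K by rewrite exprn_gt0.
pose G y := B * W (K * y - 0) + (2 * B * W (K * y - K * 2 ^- i.+1) + B * W (K * y - K * 2 ^- i)).
exists G; split.
- by apply: measurable_funD; [|apply: measurable_funD]; apply: measurable_funM.
- move=> y; rewrite lp_conv_haar_origin !(mulrBr (2 ^+ k.+1)) /G subr0.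
  set p1 := Psi _; set p2 := Psi _; set p3 := Psi _.
  have h1 : `|p1| <= B * W (K * y) by exact: Psi_le.
  have h2 : `|p2| <= B * W (K * y - K * 2 ^- i.+1) by exact: Psi_le.
  have h3 : `|p3| <= B * W (K * y - K * 2 ^- i) by exact: Psi_le.
  by move: h1 h2 h3; rewrite -mulrA !ler_norml; lra.
- have w1 u : B * W u <= B by rewrite ler_piMr// oneDsqrV_le1.
  move=> y; rewrite /G -mulrA (le_trans _ M1)//.
  have := w1 (K * y - 0); have := w1 (K * y - K * 2 ^- i.+1); have := w1 (K * y - K * 2 ^- i).
  by lra.
- have iW (c b : R) : 0 <= c -> (\int[mu]_y (c * W (K * y - b))%:E = (c * (K^-1 * pi))%:E)%E.
    move=> c0; under eq_integral do rewrite EFinM.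
    rewrite ge0_integralZl//; last 2 first.
      by apply/measurable_EFinP; exact: mW.
      by move=> y _; rewrite lee_fin invr_ge0.
    by rewrite integral_oneDsqrV_affine.
  have mm (c b : R) : measurable_fun setT (fun y => (c * W (K * y - b))%:E).
    by apply/measurable_EFinP; apply: measurable_funM.
  have pp (c u : R) : 0 <= c -> (0 <= (c * W u)%:E)%E.
    by move=> c0; rewrite lee_fin mulr_ge0// invr_ge0.
  have B2 : 0 <= 2 * B by rewrite mulr_ge0.
  rewrite /G; under eq_integral do rewrite EFinD EFinD.
  rewrite ge0_integralD//=.
  + rewrite ge0_integralD//=.
    * rewrite !iW// -!EFinD lee_fin -/K.
      have -> : B * (K^-1 * pi) + (2 * B * (K^-1 * pi) + B * (K^-1 * pi)) = 4 * B * pi * K^-1 by ring.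
      by rewrite ler_wpM2r ?invr_ge0 ?(ltW K0).
    * by move=> y _; exact: pp.
    * exact: mm.
    * by move=> y _; exact: pp.
    * exact: mm.
  + by move=> y _; exact: pp.
  + exact: mm.
  + by move=> y _; rewrite adde_ge0// pp.
  + by apply: emeasurable_funD; exact: mm.
Qed.

Lemma haar_sum_mass n : dyadic_mass (fun k y => conv (haar_sum n) k y).
Proof.
elim: n => [|n IH].
  exists 0 => k; exists (cst 0); split => //.
  - by move=> y /=; rewrite lp_conv_haar_sum0 normr0.
  - by rewrite mul0r; under eq_integral do rewrite /=; rewrite integral0.
have -> : (fun k y => conv (haar_sum n.+1) k y) =
    (fun k y => conv (haar_sum n) k y + conv (haar_origin n) k y).
  by apply/funext => k; apply/funext => y; rewrite lp_conv_haar_sumS.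
exact: dyadic_massD IH (haar_origin_mass n).
Qed.

End HaarPieces.

(** * Complex-valued functions *)

Section ComplexTools.
Context {R : realType}.
Local Open Scope complex_scope.
Local Notation C := R[i].
Local Notation mu := (@lebesgue_measure R).
Local Notation Re := (@complex.Re R).
Local Notation Im := (@complex.Im R).
Implicit Types (z w : C) (f g : R -> C) (t : R).

Lemma complexE z : z = Re z +i* Im z. Proof. by case: z. Qed.

Lemma complex_ext z w : Re z = Re w -> Im z = Im w -> z = w.
Proof. by case: z w => [a b] [c d] /= -> ->. Qed.

Lemma cReM z w : Re (z * w) = Re z * Re w - Im z * Im w.
Proof. by case: z w => [a b] [c d]. Qed.

Lemma cImM z w : Im (z * w) = Re z * Im w + Im z * Re w.
Proof. by case: z w => [a b] [c d]. Qed.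

Lemma cReD z w : Re (z + w) = Re z + Re w.
Proof. by case: z w => [a b] [c d]. Qed.

Lemma cImD z w : Im (z + w) = Im z + Im w.
Proof. by case: z w => [a b] [c d]. Qed.

Lemma cReB z w : Re (z - w) = Re z - Re w.
Proof. by case: z w => [a b] [c d]. Qed.

Lemma cImB z w : Im (z - w) = Im z - Im w.
Proof. by case: z w => [a b] [c d]. Qed.

Lemma normr_Re_le z : `|Re z| <= normc z.
Proof. by case: z => a b /=; rewrite -sqrtr_sqr ler_wsqrtr// lerDl sqr_ge0. Qed.

Lemma normr_Im_le z : `|Im z| <= normc z.
Proof. by case: z => a b /=; rewrite -sqrtr_sqr ler_wsqrtr// lerDr sqr_ge0. Qed.

Lemma normc_le_ReIm z : normc z <= `|Re z| + `|Im z|.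
Proof.
case: z => a b /=; rewrite -[leRHS]ger0_norm// -sqrtr_sqr ler_wsqrtr//.
rewrite sqrrD !real_normK ?num_real// addrAC lerDl mulrn_wge0// mulr_ge0//.
Qed.

Lemma normc_ge0 z : 0 <= normc z.
Proof. by case: z => a b /=; exact: sqrtr_ge0. Qed.

Lemma cexpiD t x : cexpi (t + x) = cexpi t * cexpi x :> C.
Proof. by apply: complex_ext; rewrite ?cReM ?cImM /= ?cosD ?sinD// addrC. Qed.

Lemma normc_cexpi t : normc (cexpi t) = 1 :> R.
Proof. by rewrite /= cos2Dsin2 sqrtr1. Qed.

Lemma cintegralZl z f : cintegrable setT f ->
  cintegral setT (fun x => z * f x) = z * cintegral setT f.
Proof.
move=> [ir ii]; apply: complex_ext; rewrite ?cReM ?cImM /=.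
- rewrite -!RintegralZl// -RintegralB//.
  + by apply: eq_Rintegral => x _; rewrite /= cReM.
  + by apply: eq_integrable (@integrableZl _ _ _ mu _ measurableT (Re z) _ ir) => // x _; rewrite /= EFinM.
  + by apply: eq_integrable (@integrableZl _ _ _ mu _ measurableT (Im z) _ ii) => // x _; rewrite /= EFinM.
- rewrite -!RintegralZl// -RintegralD//.
  + by apply: eq_Rintegral => x _; rewrite /= cImM.
  + by apply: eq_integrable (@integrableZl _ _ _ mu _ measurableT (Re z) _ ii) => // x _; rewrite /= EFinM.
  + by apply: eq_integrable (@integrableZl _ _ _ mu _ measurableT (Im z) _ ir) => // x _; rewrite /= EFinM.
Qed.

Lemma cintegralD f g : cintegrable setT f -> cintegrable setT g ->
  cintegral setT (fun x => f x + g x) = cintegral setT f + cintegral setT g.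
Proof.
move=> [fr fi] [gr gi]; apply: complex_ext; rewrite ?cReD ?cImD /=.
- by rewrite -RintegralD//; apply: eq_Rintegral => x _; rewrite /= cReD.
- by rewrite -RintegralD//; apply: eq_Rintegral => x _; rewrite /= cImD.
Qed.

Definition cmeasurable d (T : measurableType d) (f : T -> C) :=
  measurable_fun setT (Re \o f) /\ measurable_fun setT (Im \o f).

Lemma cmeasurableM d (T : measurableType d) (f g : T -> C) :
  cmeasurable f -> cmeasurable g -> cmeasurable (fun x => f x * g x).
Proof.
move=> [fr fi] [gr gi]; split.
- have -> : Re \o (fun x => f x * g x) =
      (fun x => (Re \o f) x * (Re \o g) x - (Im \o f) x * (Im \o g) x).
    by apply/funext => x /=; rewrite cReM.
  by apply: measurable_funB; apply: measurable_funM.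
- have -> : Im \o (fun x => f x * g x) =
      (fun x => (Re \o f) x * (Im \o g) x + (Im \o f) x * (Re \o g) x).
    by apply/funext => x /=; rewrite cImM.
  by apply: measurable_funD; apply: measurable_funM.
Qed.

Lemma cmeasurable_comp d d' (T : measurableType d) (T' : measurableType d')
    (f : T' -> C) (u : T -> T') :
  cmeasurable f -> measurable_fun setT u -> cmeasurable (f \o u).
Proof.
move=> [fr fi] mu; split; first exact: (measurableT_comp fr mu).
exact: (measurableT_comp fi mu).
Qed.

Lemma ccontinuous_measurable f : ccontinuous f -> cmeasurable f.
Proof. by move=> [cr ci]; split; exact: continuous_measurable_fun. Qed.

Lemma cexpi_continuous : ccontinuous (@cexpi R).
Proof. by split; [exact: continuous_cos|exact: continuous_sin]. Qed.

Lemma cintegrable_dominated f (A : R -> R) : cmeasurable f ->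
  (forall x, normc (f x) <= A x) -> mu.-integrable setT (EFin \o A) ->
  cintegrable setT f.
Proof.
move=> [fr fi] fA iA; split; apply: integrable_dominated iA => // x.
- exact: le_trans (normr_Re_le _) (fA x).
- exact: le_trans (normr_Im_le _) (fA x).
Qed.

Lemma cintegral_swap (h : R * R -> C) (A B : R -> R) : cmeasurable h ->
  mu.-integrable setT (EFin \o A) -> mu.-integrable setT (EFin \o B) ->
  (forall x y, normc (h (x, y)) <= A x * B y) ->
  cintegral setT (fun x => cintegral setT (fun y => h (x, y))) =
  cintegral setT (fun y => cintegral setT (fun x => h (x, y))).
Proof.
move=> [hr hi] iA iB hAB; apply: complex_ext => /=.
- apply: (@Rintegral_swap _ (Re \o h) A B) => // x y.
  exact: le_trans (normr_Re_le _) (hAB x y).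
- apply: (@Rintegral_swap _ (Im \o h) A B) => // x y.
  exact: le_trans (normr_Im_le _) (hAB x y).
Qed.

End ComplexTools.

(** * The convolution kernels of a cutoff *)

Section CutoffKernel.
Context {R : realType}.
Local Open Scope complex_scope.
Local Notation C := R[i].
Local Notation mu := (@lebesgue_measure R).
Local Notation Re := (@complex.Re R).
Local Notation Im := (@complex.Im R).
Implicit Types (a b : R -> R) (x y c : R) (k : nat).

Let bump_dilation_support a (g : R -> R) c : bump a -> 1 <= c ->
  (fun xi => g xi * a (c^-1 * xi)) = (fun xi => \1_`[- c, c] xi * (g xi * a (c^-1 * xi))).
Proof.
move=> ba c1; have c0 : 0 < c by exact: lt_le_trans c1.
apply/funext => x; rewrite indicE mem_setE in_itv/=.
have [x1|x1] := leP 1 `|c^-1 * x|; first by rewrite (bump_eq0 ba x1) !mulr0.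
move: x1; rewrite normrM ger0_norm ?invr_ge0 ?(ltW c0)// mulrC ltr_pdivrMr// mul1r.
rewrite ltr_norml => /andP[h1 h2].
by rewrite (ltW h1) (ltW h2) mul1r.
Qed.

Let bump_dilation_continuous a (g : R -> R) c : bump a -> continuous g ->
  continuous (fun xi => g xi * a (c^-1 * xi)).
Proof.
move=> ba cg x; apply: cvgM; first exact: cg.
apply: (@continuous_comp _ _ _ (fun x => c^-1 * x) a); last exact: bump_continuous.
by apply: cvgMl_tmp; exact: cvg_id.
Qed.

Let bump_dilation_integrable a (g : R -> R) c : bump a -> continuous g -> 1 <= c ->
  mu.-integrable setT (EFin \o (fun xi => g xi * a (c^-1 * xi))).
Proof.
move=> ba cg c1; rewrite (bump_dilation_support g ba c1).
by apply: integrable_indicM => //; apply: continuous_integrable_itv; exact: bump_dilation_continuous.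
Qed.

Let bump_dilation_integral a (g : R -> R) c : bump a -> continuous g -> 1 <= c ->
  Rintegral mu setT (fun xi => g xi * a (c^-1 * xi)) =
  c * Rintegral mu setT (fun xi => g (c * xi) * a xi).
Proof.
move=> ba cg c1; have c0 : 0 < c by exact: lt_le_trans c1.
have cne : c != 0 by rewrite gt_eqF.
have dF x : is_derive x 1 (fun y : R => c * y) c.
  have -> : (fun y => c * y) = (fun y => c * y + 0) by apply/funext => y; rewrite addr0.
  exact: is_derive_affine.
have F'E : derive1 (fun y : R => c * y) = cst c.
  by apply/funext => x; rewrite derive1E derive_val.
have cG : continuous (fun xi => g xi * a (c^-1 * xi)) by exact: bump_dilation_continuous.
have cgc : continuous (fun xi => g (c * xi)).
  move=> x; apply: (@continuous_comp _ _ _ (fun x => c * x) g); last exact: cg.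
  by apply: cvgMl_tmp; exact: cvg_id.
have -> : Rintegral mu setT (fun xi => g xi * a (c^-1 * xi)) =
    \int[mu]_(xi in `[c * (-1), c * 1]) (g xi * a (c^-1 * xi)).
  by rewrite [in LHS](bump_dilation_support g ba c1) [RHS]Rintegral_indic// mulrN mulr1.
rewrite bump_mul_integral// -RintegralZl//; last first.
  apply: continuous_integrable_itv => x; apply: cvgM; first exact: cgc.
  exact: bump_continuous.
rewrite /Rintegral; congr fine.
have := @integration_by_substitution_increasing R (fun y => c * y)
  (fun xi => g xi * a (c^-1 * xi)) (-1) 1.
move=> -> //.
- apply: eq_integral => x _; rewrite F'E /= fctE /=.
  by congr EFin; rewrite /= mulKf// mulrC.
- by move=> x y _ _ xy; rewrite ltr_pM2l.
- by move=> x _; rewrite F'E; exact: cvg_cst.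
- by rewrite F'E; exact: is_cvg_cst.
- by rewrite F'E; exact: is_cvg_cst.
- by apply: derivable_LRcontinuous => x; case: (dF x).
- exact: continuous_subspaceT.
Qed.

Lemma cos_transform_dilation a c x : bump a -> 1 <= c ->
  cos_transform (fun xi => a (c^-1 * xi)) x = c * cos_transform a (c * x).
Proof.
move=> ba c1; rewrite /cos_transform bump_dilation_integral//; last exact: continuous_cosM.
by congr (_ * _); apply: eq_Rintegral => xi _; congr (cos _ * _); ring.
Qed.

Lemma sin_transform_dilation a c x : bump a -> 1 <= c ->
  sin_transform (fun xi => a (c^-1 * xi)) x = c * sin_transform a (c * x).
Proof.
move=> ba c1; rewrite /sin_transform bump_dilation_integral//; last exact: continuous_sinM.
by congr (_ * _); apply: eq_Rintegral => xi _; congr (sin _ * _); ring.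
Qed.

Variable eta0 : R -> C.
Hypothesis eta0_cutoff : lp_cutoff eta0.

Lemma bump_Re_cutoff : bump (Re \o eta0).
Proof.
have [sm sup one] := eta0_cutoff; split; first by move=> n x; exact: (sm n x).1.
move=> x x34 /=; have [->//|nz] := eqVneq (eta0 x) 0.
have /= h := sup x (@subset_closure _ [set xi | eta0 xi != 0] x nz); move: x34.
by rewrite ltNge (ltW h).
Qed.

Lemma bump_Im_cutoff : bump (Im \o eta0).
Proof.
have [sm sup one] := eta0_cutoff; split; first by move=> n x; exact: (sm n x).2.
move=> x x34 /=; have [->//|nz] := eqVneq (eta0 x) 0.
have /= h := sup x (@subset_closure _ [set xi | eta0 xi != 0] x nz); move: x34.
by rewrite ltNge (ltW h).
Qed.

Let a := Re \o eta0.
Let b := Im \o eta0.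
Let ba : bump a := bump_Re_cutoff.
Let bb : bump b := bump_Im_cutoff.

(** Real and imaginary part of the inverse Fourier transform of [eta0]. *)
Definition cutoff_Re x := cos_transform (Re \o eta0) x - sin_transform (Im \o eta0) x.
Definition cutoff_Im x := cos_transform (Im \o eta0) x + sin_transform (Re \o eta0) x.

Lemma cutoff_Re_continuous : continuous cutoff_Re.
Proof.
by move=> x; apply: cvgB; [exact: cos_transform_continuous|exact: sin_transform_continuous].
Qed.

Lemma cutoff_Im_continuous : continuous cutoff_Im.
Proof.
by move=> x; apply: cvgD; [exact: cos_transform_continuous|exact: sin_transform_continuous].
Qed.

Lemma cutoff_Re_decay : exists K, forall x, `|cutoff_Re x| <= K / oneDsqr x ^+ 2.
Proof.
have [K1 h1] := cos_transform_decay ba; have [K2 h2] := sin_transform_decay bb.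
exists (K1 + K2) => x; by rewrite mulrDl (le_trans (ler_normB _ _))// lerD.
Qed.

Lemma cutoff_Im_decay : exists K, forall x, `|cutoff_Im x| <= K / oneDsqr x ^+ 2.
Proof.
have [K1 h1] := cos_transform_decay bb; have [K2 h2] := sin_transform_decay ba.
exists (K1 + K2) => x; by rewrite mulrDl (le_trans (ler_normD _ _))// lerD.
Qed.

Let eta00 : eta0 0 = 1.
Proof. by have [_ _ one] := eta0_cutoff; apply: one; rewrite normr0 divr_ge0. Qed.

(** Sine transforms are odd, and a cosine transform integrates to the value at the
    origin of its bump. *)
Lemma cutoff_Re_integral : Rintegral mu setT cutoff_Re = 1.
Proof.
rewrite RintegralB//; [|exact: cos_transform_integrable|exact: sin_transform_integrable].
by rewrite cos_transform_integral// sin_transform_integral// subr0 /= eta00.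
Qed.

Lemma cutoff_Im_integral : Rintegral mu setT cutoff_Im = 0.
Proof.
rewrite RintegralD//; [|exact: cos_transform_integrable|exact: sin_transform_integrable].
by rewrite cos_transform_integral// sin_transform_integral// addr0 /= eta00.
Qed.

Let inv_fourier_dilation c x : 1 <= c ->
  inv_fourier (fun xi => eta0 (c^-1 * xi)) x =
  (c * cutoff_Re (c * x)) +i* (c * cutoff_Im (c * x)).
Proof.
move=> c1; have ccos := @continuous_cosM R (2 * pi * x).
have csin := @continuous_sinM R (2 * pi * x).
apply: complex_ext => /=.
- rewrite /cutoff_Re mulrBr -cos_transform_dilation// -sin_transform_dilation// -RintegralB//.
  + by apply: eq_Rintegral => xi _; rewrite /= cReM.
  + exact: bump_dilation_integrable.
  + exact: bump_dilation_integrable.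
- rewrite /cutoff_Im [RHS]mulrDr -cos_transform_dilation// -sin_transform_dilation// -RintegralD//.
  + by apply: eq_Rintegral => xi _; rewrite /= cImM.
  + exact: bump_dilation_integrable.
  + exact: bump_dilation_integrable.
Qed.

Let inv_fourier_dilation_integrable c x : 1 <= c ->
  cintegrable setT (fun xi => cexpi (2 * pi * x * xi) * eta0 (c^-1 * xi)).
Proof.
move=> c1; have ccos := @continuous_cosM R (2 * pi * x).
have csin := @continuous_sinM R (2 * pi * x).
split.
- have := @integrableB _ _ _ mu _ measurableT _ _
    (bump_dilation_integrable ba ccos c1) (bump_dilation_integrable bb csin c1).
  by apply: eq_integrable => // xi _; rewrite /= cReM EFinB.
- have := @integrableD _ _ _ mu _ measurableT _ _
    (bump_dilation_integrable bb ccos c1) (bump_dilation_integrable ba csin c1).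
  by apply: eq_integrable => // xi _; rewrite /= cImM EFinD.
Qed.

Lemma inv_fourier_lp_multiplier k x : inv_fourier (lp_multiplier eta0 k) x =
  lp_kernel cutoff_Re k x +i* lp_kernel cutoff_Im k x.
Proof.
have pow1 n : (1 : R) <= 2 ^+ n by rewrite exprn_ege1// ler1n.
case: k => [|k].
  have := inv_fourier_dilation x (lexx 1); rewrite !mul1r /= => <-.
  by congr (inv_fourier _ x); apply/funext => xi; rewrite invr1 mul1r.
have -> : inv_fourier (lp_multiplier eta0 k.+1) x =
    inv_fourier (fun xi => eta0 ((2 ^+ k.+1)^-1 * xi)) x -
    inv_fourier (fun xi => eta0 ((2 ^+ k)^-1 * xi)) x.
  rewrite -[X in _ = _ + X]mulN1r /inv_fourier -cintegralZl; last exact: inv_fourier_dilation_integrable.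
  rewrite -cintegralD; last 2 first.
  - exact: inv_fourier_dilation_integrable.
  - have [ir ii] := inv_fourier_dilation_integrable x (pow1 k); split.
    + by apply: eq_integrable (@integrableN _ _ _ mu _ _ ir) => // xi _; rewrite /= !(cReM, cImM) /=; congr EFin; ring.
    + by apply: eq_integrable (@integrableN _ _ _ mu _ _ ii) => // xi _; rewrite /= !(cReM, cImM) /=; congr EFin; ring.
  by congr cintegral; apply/funext => xi; rewrite mulN1r -mulrBr.
by rewrite !inv_fourier_dilation.
Qed.

Lemma lp_multiplier_integrable k :
  [/\ cmeasurable (lp_multiplier eta0 k) &
  exists A : R -> R, mu.-integrable setT (EFin \o A) /\
    forall xi, normc (lp_multiplier eta0 k xi) <= A xi].
Proof.
have pow1 n : (1 : R) <= 2 ^+ n by rewrite exprn_ege1// ler1n.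
have c1 : continuous (cst 1 : R -> R) by move=> z; exact: cvg_cst.
have ii f n : bump f -> mu.-integrable setT (EFin \o (fun xi => f ((2 ^+ n)^-1 * xi))).
  move=> bf; apply: eq_integrable (bump_dilation_integrable bf c1 (pow1 n)) => // xi _.
  by rewrite /= mul1r.
have imk : cintegrable setT (lp_multiplier eta0 k).
  case: k => [|k]; first by split; [exact: bump_integrable|exact: bump_integrable].
  split.
  - apply: eq_integrable (@integrableB _ _ _ mu _ measurableT _ _ (ii a k.+1 ba) (ii a k ba)) => // xi _.
    by rewrite /= cReB EFinB.
  - apply: eq_integrable (@integrableB _ _ _ mu _ measurableT _ _ (ii b k.+1 bb) (ii b k bb)) => // xi _.
    by rewrite /= cImB EFinB.
have [ir im] := imk; split; first by split; exact: integrable_measurable.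
exists (fun xi => `|Re (lp_multiplier eta0 k xi)| + `|Im (lp_multiplier eta0 k xi)|); split.
  have := @integrableD _ _ _ mu _ measurableT _ _ (integrable_norm ir) (integrable_norm im).
  by apply: eq_integrable => // xi _; rewrite /= EFinD.
by move=> xi; exact: normc_le_ReIm.
Qed.

End CutoffKernel.

(** * Affine images of bumps *)

Section SmoothFunctions.
Context {R : realType}.
Implicit Types (a b f g : R -> R) (c d x : R) (n m : nat).

(** Smoothness to finite order, by recursion on the derivative: the Leibniz rule then
    lends itself to an induction on the order. *)
Fixpoint smooth_upto n f : Prop :=
  if n is n'.+1 then (forall x, derivable f x 1) /\ smooth_upto n' (derive1 f) else True.

Lemma smooth_uptoP f : smooth f <-> forall n, smooth_upto n f.
Proof.
split=> [sf n|sf n].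
  elim: n f sf => //= n IH f sf; split; first exact: smooth_derivable.
  by apply: IH; exact: smooth_derive1.
have : smooth_upto n.+1 f by exact: sf.
elim: n {sf} f => [|n IH] f [df sf] x; first exact: df.
by rewrite -derive1n_derive1; exact: IH.
Qed.

Lemma smooth_uptoW n f : smooth_upto n.+1 f -> smooth_upto n f.
Proof. by elim: n f => //= n IH f [df sf]; split => //; exact: IH. Qed.

Lemma smooth_uptoD n f g : smooth_upto n f -> smooth_upto n g ->
  smooth_upto n (fun x => f x + g x).
Proof.
elim: n f g => //= n IH f g [df sf] [dg sg]; split.
  by move=> x; apply: derivableD.
have -> : derive1 (fun x => f x + g x) = (fun x => derive1 f x + derive1 g x).
  by apply/funext => x; rewrite !derive1E deriveD.
exact: IH.
Qed.

Lemma smooth_uptoM n f g : smooth_upto n f -> smooth_upto n g ->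
  smooth_upto n (fun x => f x * g x).
Proof.
elim: n f g => //= n IH f g [df sf] [dg sg]; split.
  by move=> x; apply: derivableM.
have -> : derive1 (fun x => f x * g x) = (fun x => f x * derive1 g x + g x * derive1 f x).
  by apply/funext => x; rewrite !derive1E deriveM.
apply: smooth_uptoD.
- apply: IH => //; apply: smooth_uptoW; split => //.
- apply: IH => //; apply: smooth_uptoW; split => //.
Qed.

Lemma smoothD f g : smooth f -> smooth g -> smooth (fun x => f x + g x).
Proof.
move=> /smooth_uptoP sf /smooth_uptoP sg; apply/smooth_uptoP => n.
exact: smooth_uptoD.
Qed.

Lemma smoothM f g : smooth f -> smooth g -> smooth (fun x => f x * g x).
Proof.
move=> /smooth_uptoP sf /smooth_uptoP sg; apply/smooth_uptoP => n.
exact: smooth_uptoM.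
Qed.

Lemma bump_square a : bump a -> bump (fun x : R => a x * a x).
Proof. by move=> [sa a0]; split; [exact: smoothM|move=> x /a0 ->; rewrite mul0r]. Qed.

Lemma bumpD a b : bump a -> bump b -> bump (fun x : R => a x + b x).
Proof.
move=> [sa a0] [sb b0]; split; first exact: smoothD.
by move=> x x34; rewrite a0// b0// addr0.
Qed.

Lemma bump_derive1n a n : bump a -> bump (derive1n n a).
Proof. by elim: n a => // n IH a ba; rewrite -derive1n_derive1; exact/IH/bump_derive1. Qed.

Let is_derive_bump a c d x k : bump a ->
  is_derive x 1 (fun y => k * a (c * y + d)) (k * (derive1 a (c * x + d) * c)).
Proof.
move=> ba.
have da : is_derive (c * x + d) 1 a (derive1 a (c * x + d)).
  by rewrite derive1E; apply: DeriveDef => //; exact: bump_derivable.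
have h := is_derive_comp_affine da.
exact: is_deriveZ.
Qed.

Lemma derive1n_affine a c d n : bump a ->
  derive1n n (fun x => a (c * x + d)) = (fun x => c ^+ n * derive1n n a (c * x + d)).
Proof.
move=> ba; elim: n => [|n IH].
  by apply/funext => x; rewrite !derive1n0 expr0 mul1r.
rewrite derive1nS IH; apply/funext => x; rewrite derive1E.
have := is_derive_bump c d x (c ^+ n) (bump_derive1n n ba) => h.
by rewrite derive_val derive1nS exprSr mulrCA mulrC -!mulrA mulrC; ring.
Qed.

Lemma smooth_affine a c d : bump a -> smooth (fun x => a (c * x + d)).
Proof.
move=> ba n x; rewrite derive1n_affine//.
by case: (is_derive_bump c d x (c ^+ n) (bump_derive1n n ba)).
Qed.

Lemma derive1n_cst n k : derive1n n (cst k : R -> R) = cst (k *+ (n == 0%N)).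
Proof.
elim: n => [|n IH]; first by rewrite derive1n0 mulr1n.
rewrite derive1nS IH mulr0n; apply/funext => x.
by rewrite derive1E derive_cst.
Qed.

End SmoothFunctions.

(** * Uniqueness of a continuous representative *)

Section TestFunctions.
Context {R : realType}.
Local Open Scope complex_scope.
Local Notation C := R[i].
Local Notation mu := (@lebesgue_measure R).
Local Notation Re := (@complex.Re R).
Local Notation Im := (@complex.Im R).
Implicit Types (c d x : R) (k m n : nat).

Lemma bump_affine_schwartz (a : R -> R) c d : bump a -> 0 < c ->
  schwartz (fun x => (a (c * x + d))%:C : C).
Proof.
move=> ba c0.
pose phi x := (a (c * x + d))%:C : C.
have rE : Re \o phi = (fun x => a (c * x + d)) by apply/funext.
have iE : Im \o phi = cst 0 by apply/funext.
split.
  move=> n x; rewrite -/phi rE iE; split; first exact: smooth_affine.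
  by rewrite derive1n_cst; exact: derivable_cst.
move=> m n.
have [M hM] := bump_bounded (bump_derive1n n ba).
pose r := c^-1 * (1 + `|d|).
exists (r ^+ m * (c ^+ n * M)) => _ [x _ <-].
rewrite /cderive -/phi rE iE derive1n_affine// derive1n_cst /=.
rewrite mul0rn expr0n /= addr0 sqrtr_sqr normrM [X in _ * (X * _)]ger0_norm ?exprn_ge0 ?(ltW c0)//.
have M0 : 0 <= M by rewrite (le_trans _ (hM 0)).
have r0 : 0 <= r by rewrite mulr_ge0 ?invr_ge0 ?(ltW c0)// addr_ge0.
have [x1|x1] := leP 1 `|c * x + d|.
  rewrite (bump_eq0 (bump_derive1n n ba) x1) normr0 !mulr0.
  by rewrite !mulr_ge0// exprn_ge0// ltW.
rewrite ler_pM ?exprn_ge0 ?mulr_ge0 ?exprn_ge0 ?(ltW c0)//; last first.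
  by rewrite ler_wpM2l ?exprn_ge0 ?(ltW c0).
rewrite lerXn2r ?nnegrE// /r.
rewrite ler_pdivlMl// -[X in X * _](gtr0_norm c0) -normrM.
have -> : c * x = (c * x + d) - d by lra.
by rewrite (le_trans (ler_normB _ _))// lerD2r ltW.
Qed.

Variable eta0 : R -> C.
Hypothesis eta0_cutoff : lp_cutoff eta0.

Let chi x : R := Re (eta0 x) * Re (eta0 x) + Im (eta0 x) * Im (eta0 x).

Let chi_bump : bump chi.
Proof.
apply: bumpD; apply: bump_square.
- exact: bump_Re_cutoff.
- exact: bump_Im_cutoff.
Qed.

Let chi_ge0 x : 0 <= chi x.
Proof. by rewrite /chi -!expr2 addr_ge0// sqr_ge0. Qed.

Let chi1 x : `|x| <= 1 / 2 -> chi x = 1.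
Proof.
by have [_ _ one] := eta0_cutoff; move=> /one; rewrite /chi => ->; rewrite /= mulr1 mul0r addr0.
Qed.

(** The squared modulus of the cutoff is a nonnegative bump, whose dilates
    localize a continuous function at any point. *)
Lemma continuous_eq0_of_test (w : R -> R) : continuous w ->
  (forall c d, 0 < c ->
     mu.-integrable setT (EFin \o (fun x => w x * chi (c * x + d))) /\
     Rintegral mu setT (fun x => w x * chi (c * x + d)) = 0) ->
  forall x, w x = 0.
Proof.
suff main (v : R -> R) : continuous v ->
    (forall c d, 0 < c ->
     mu.-integrable setT (EFin \o (fun x => v x * chi (c * x + d))) /\
     Rintegral mu setT (fun x => v x * chi (c * x + d)) = 0) ->
    forall x, v x <= 0.
  move=> cw hw x; apply/eqP; rewrite eq_le (main w)//=.
  rewrite -oppr_le0; apply: (main (fun x => - w x)) => //.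
    by move=> y; apply: cvgN; exact: cw.
  move=> c d c0; have [iw w0] := hw c d c0.
  have E : (fun x => - w x * chi (c * x + d)) = (fun x => -1 * (w x * chi (c * x + d))).
    by apply/funext => y; rewrite mulN1r mulNr.
  rewrite E; split; last by rewrite RintegralZl// w0 mulr0.
  by apply: eq_integrable (@integrableZl _ _ _ mu _ measurableT (-1) _ iw) => // y _; rewrite /= EFinM.
move=> cv hv x0; rewrite leNgt; apply/negP => vx0.
pose de := v x0 / 2.
have de0 : 0 < de by rewrite divr_gt0.
have : \forall y \near x0, de < v y.
  by apply: (cvgr_gt _ (cv x0)); rewrite /de; lra.
move=> /nbhs_ballP[e /= e0 he].
have {}he y : `|y - x0| < e -> de < v y.
  by move=> ye; apply: he; rewrite /ball/= distrC.
have c0 : 0 < e^-1 by rewrite invr_gt0.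
have [iv v0] := hv e^-1 (- (e^-1 * x0)) c0.
have cE y : e^-1 * y + - (e^-1 * x0) = e^-1 * (y - x0) by rewrite mulrBr.
have nE y : `|e^-1 * y + - (e^-1 * x0)| = e^-1 * `|y - x0|.
  by rewrite cE normrM ger0_norm ?ltW.
pose I : set R := `[x0 - e / 2, x0 + e / 2]%classic.
have iI : mu.-integrable setT (EFin \o (fun y => de * \1_I y)).
  have := @integrableZl _ _ _ mu _ measurableT de _ (@integrable_indic_itv R (x0 - e / 2) (x0 + e / 2) true false).
  by apply: eq_integrable => // y _; rewrite /= EFinM.
have : Rintegral mu setT (fun y => de * \1_I y) <= 0.
  rewrite -v0; apply: le_Rintegral => // y _; rewrite indicE.
  case: (boolP (y \in I)) => yI.
    rewrite mulr1 chi1.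
      rewrite mulr1 ltW// he//.
      move: yI; rewrite inE /I /= in_itv/= => /andP[h1 h2].
      by rewrite ltr_norml; apply/andP; split; lra.
    rewrite nE ler_pdivrMl// ler_norml.
    move: yI; rewrite inE /I /= in_itv/= => /andP[h1 h2].
    by apply/andP; split; lra.
  rewrite mulr0; have [y1|y1] := ltP `|y - x0| e.
    by rewrite mulr_ge0 ?chi_ge0// ltW// (lt_trans de0)// he.
  rewrite (@bump_eq0 _ chi)// ?mulr0// nE.
  by rewrite ler_pdivlMl// mulr1.
rewrite RintegralZl//; last exact: integrable_indic_itv.
rewrite leNgt => /negP; apply.
rewrite mulr_gt0//.
have -> : Rintegral mu setT (\1_I) = e.
  rewrite /Rintegral /I integral_indic//= setIT [X in fine X]lebesgue_measure_itv/= lte_fin ifT; last lra.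
  by rewrite /=; lra.
by [].
Qed.

Lemma represents_unique (f : @tdistribution R) (g h : R -> C) :
  ccontinuous g -> represents g f -> ccontinuous h -> represents h f -> g = h.
Proof.
move=> [gr gi] fg [hr hi] fh.
have test c d : 0 < c -> schwartz (fun x => (chi (c * x + d))%:C : C).
  exact: bump_affine_schwartz.
have ReE (u : R -> C) c d : Re \o (fun x => u x * (chi (c * x + d))%:C) =
    (fun x => (Re \o u) x * chi (c * x + d)).
  by apply/funext => x; rewrite /= cReM /= mulr0 subr0.
have ImE (u : R -> C) c d : Im \o (fun x => u x * (chi (c * x + d))%:C) =
    (fun x => (Im \o u) x * chi (c * x + d)).
  by apply/funext => x; rewrite /= cImM /= mulr0 add0r.
have eqR x : Re (g x) - Re (h x) = 0.
  apply: (@continuous_eq0_of_test (fun x => Re (g x) - Re (h x))).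
    by move=> y; apply: cvgB; [exact: gr|exact: hr].
  move=> c d c0; have [[ig _] fgE] := fg _ (test c d c0); have [[ih _] fhE] := fh _ (test c d c0).
  rewrite ReE in ig; rewrite ReE in ih.
  have E : (fun x => (Re (g x) - Re (h x)) * chi (c * x + d)) =
    (fun x => (Re \o g) x * chi (c * x + d) - (Re \o h) x * chi (c * x + d)).
    by apply/funext => y; rewrite mulrBl.
  rewrite E; split.
    by apply: eq_integrable (@integrableB _ _ _ mu _ measurableT _ _ ig ih) => // y _; rewrite /= EFinB.
  rewrite RintegralB//; apply/eqP; rewrite subr_eq0; apply/eqP.
  have := fgE; rewrite fhE => /(congr1 Re) /=.
  by rewrite ReE ReE.
have eqI x : Im (g x) - Im (h x) = 0.
  apply: (@continuous_eq0_of_test (fun x => Im (g x) - Im (h x))).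
    by move=> y; apply: cvgB; [exact: gi|exact: hi].
  move=> c d c0; have [[_ ig] fgE] := fg _ (test c d c0); have [[_ ih] fhE] := fh _ (test c d c0).
  rewrite ImE in ig; rewrite ImE in ih.
  have E : (fun x => (Im (g x) - Im (h x)) * chi (c * x + d)) =
    (fun x => (Im \o g) x * chi (c * x + d) - (Im \o h) x * chi (c * x + d)).
    by apply/funext => y; rewrite mulrBl.
  rewrite E; split.
    by apply: eq_integrable (@integrableB _ _ _ mu _ measurableT _ _ ig ih) => // y _; rewrite /= EFinB.
  rewrite RintegralB//; apply/eqP; rewrite subr_eq0; apply/eqP.
  have := fgE; rewrite fhE => /(congr1 Im) /=.
  by rewrite ImE ImE.
apply/funext => x; apply: complex_ext.
- by apply/eqP; rewrite -subr_eq0 eqR.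
- by apply/eqP; rewrite -subr_eq0 eqI.
Qed.

End TestFunctions.

(** * Distributions given by integrable functions *)

Section FunctionDistributions.
Context {R : realType}.
Local Open Scope complex_scope.
Local Notation C := R[i].
Local Notation mu := (@lebesgue_measure R).
Local Notation Re := (@complex.Re R).
Local Notation Im := (@complex.Im R).
Implicit Types (x y xi : R) (k m n : nat) (phi : R -> C).

Lemma schwartz_bounded phi m : schwartz phi -> forall x,
  `|x| ^+ m * normc (phi x) <= schwartz_seminorm m 0 phi.
Proof.
move=> [_ /(_ m 0%N) ub] x; apply: sup_ubound => //.
by exists x => //; rewrite /cderive !derive1n0; congr (_ * normc _); rewrite [RHS]complexE.
Qed.

Lemma schwartz_ccontinuous phi : schwartz phi -> ccontinuous phi.
Proof.
move=> [sm _]; split; apply: derivable_continuous => x.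
- exact: (sm 0%N x).1.
- exact: (sm 0%N x).2.
Qed.

Lemma schwartz_decay phi : schwartz phi -> exists A : R -> R,
  mu.-integrable setT (EFin \o A) /\ forall x, normc (phi x) <= A x.
Proof.
move=> sp; pose K := schwartz_seminorm 0 0 phi + schwartz_seminorm 2 0 phi.
exists (fun x => K * (oneDsqr x)^-1); split.
  by apply: eq_integrable (@integrableZl _ _ _ mu _ measurableT K _ integrable_oneDsqrV) => // x _; rewrite /= EFinM.
move=> x; rewrite ler_pdivlMr// /oneDsqr mulrDr mulr1 /K.
have := schwartz_bounded 0 sp x; rewrite expr0 mul1r => h0.
have := schwartz_bounded 2 sp x; rewrite real_normK ?num_real// => h2.
by rewrite lerD// mulrC.
Qed.

Definition fun_dist (F : R -> R) : @tdistribution R :=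
  fun phi => cintegral setT (fun x => (F x)%:C * phi x).

Section FixedFunction.
Variable F : R -> R.
Hypothesis iF : mu.-integrable setT (EFin \o F).

Let cF : cmeasurable (fun x => (F x)%:C : C).
Proof.
split; first exact: (integrable_measurable iF).
exact: measurable_cst.
Qed.

Let normcF x : normc (F x)%:C = `|F x|.
Proof. by rewrite /= expr0n/= addr0 sqrtr_sqr. Qed.

Let iFM (M : R) : mu.-integrable setT (EFin \o (fun x => M * `|F x|)).
Proof.
have := @integrableZl _ _ _ mu _ measurableT M _ (integrable_norm iF).
by apply: eq_integrable => // x _; rewrite /= EFinM.
Qed.

Lemma fun_dist_integrable phi : schwartz phi ->
  cintegrable setT (fun x => (F x)%:C * phi x).
Proof.
move=> sp; apply: (cintegrable_dominated _ _ (iFM (schwartz_seminorm 0 0 phi))).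
  by apply: cmeasurableM => //; exact/ccontinuous_measurable/schwartz_ccontinuous.
move=> x; rewrite normcM normcF mulrC ler_wpM2r//.
by have := schwartz_bounded 0 sp x; rewrite expr0 mul1r.
Qed.

Lemma fun_dist_tempered : tempered (fun_dist F).
Proof.
split=> [a phi psi sphi spsi|].
  have i1 := fun_dist_integrable sphi; have i2 := fun_dist_integrable spsi.
  have E : (fun x => (F x)%:C * (a * phi x + psi x)) =
      (fun x => a * ((F x)%:C * phi x) + (F x)%:C * psi x).
    by apply/funext => x; rewrite mulrDr mulrCA.
  rewrite /fun_dist E cintegralD//; first by rewrite cintegralZl.
  have [A [iA hA]] := schwartz_decay sphi.
  apply: (cintegrable_dominated _ _ (iFM (normc a * schwartz_seminorm 0 0 phi))).
    apply: cmeasurableM; first by split; exact: measurable_cst.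
    by apply: cmeasurableM => //; exact/ccontinuous_measurable/schwartz_ccontinuous.
  move=> x; rewrite !normcM normcF -mulrA ler_wpM2l ?normc_ge0// mulrC ler_wpM2r//.
  by have := schwartz_bounded 0 sphi x; rewrite expr0 mul1r.
pose L := Rintegral mu setT (fun x => `|F x|).
exists 0%N, (2 * L) => phi sp; rewrite !big_ord1.
rewrite (le_trans (normc_le_ReIm _))//.
set S := schwartz_seminorm 0 0 phi.
have [ir im] := fun_dist_integrable sp.
have hS x : normc ((F x)%:C * phi x) <= S * `|F x|.
  rewrite normcM normcF mulrC ler_wpM2r//.
  by have := schwartz_bounded 0 sp x; rewrite expr0 mul1r.
have SL : Rintegral mu setT (fun x => S * `|F x|) = S * L.
  by rewrite RintegralZl//; exact: integrable_norm.
have -> : 2 * L * S = S * L + S * L by ring.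
rewrite lerD//= -SL; apply: normr_Rintegral_le (iFM S).
- exact: integrable_measurable ir.
- by move=> x; exact: le_trans (normr_Re_le _) (hS x).
- exact: integrable_measurable im.
- by move=> x; exact: le_trans (normr_Im_le _) (hS x).
Qed.

Variable eta0 : R -> C.
Hypothesis eta0_cutoff : lp_cutoff eta0.

Local Notation phir := (cutoff_Re eta0).
Local Notation phii := (cutoff_Im eta0).

Definition lp_fun k y : C := lp_conv phir F k y +i* lp_conv phii F k y.

Let Kc k x : C := lp_kernel phir k x +i* lp_kernel phii k x.

Let Kc_measurable k : cmeasurable (Kc k).
Proof.
apply: ccontinuous_measurable; split.
- exact: (@lp_kernel_continuous R phir (cutoff_Re_continuous eta0_cutoff) k).
- exact: (@lp_kernel_continuous R phii (cutoff_Im_continuous eta0_cutoff) k).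
Qed.

Let Kc_bounded k : exists M, forall x, normc (Kc k x) <= M.
Proof.
have [K1 h1] := cutoff_Re_decay eta0_cutoff; have [K2 h2] := cutoff_Im_decay eta0_cutoff.
exists (2 * 2 ^+ k * K1 + 2 * 2 ^+ k * K2) => x.
rewrite (le_trans (normc_le_ReIm _))//= lerD//.
  exact: lp_kernel_bounded h1 _ _.
exact: lp_kernel_bounded h2 _ _.
Qed.

Lemma lp_fun_ccontinuous k : ccontinuous (lp_fun k).
Proof.
have [K1 h1] := cutoff_Re_decay eta0_cutoff; have [K2 h2] := cutoff_Im_decay eta0_cutoff.
split.
- exact: (lp_conv_continuous (cutoff_Re_continuous eta0_cutoff) h1 iF).
- exact: (lp_conv_continuous (cutoff_Im_continuous eta0_cutoff) h2 iF).
Qed.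

Let lp_funE k y : lp_fun k y = cintegral setT (fun x => (F x)%:C * Kc k (y - x)).
Proof.
apply: complex_ext => /=.
- by apply: eq_Rintegral => x _; rewrite /= mul0r subr0.
- by apply: eq_Rintegral => x _; rewrite /= mul0r addr0.
Qed.

Lemma lp_fun_bounded k : exists M, forall y, normc (lp_fun k y) <= M.
Proof.
have [K1 h1] := cutoff_Re_decay eta0_cutoff; have [K2 h2] := cutoff_Im_decay eta0_cutoff.
pose L := Rintegral mu setT (fun x => `|F x|).
exists (2 * 2 ^+ k * K1 * L + 2 * 2 ^+ k * K2 * L) => y; rewrite (le_trans (normc_le_ReIm _))//= lerD//.
  exact: (lp_conv_bounded (cutoff_Re_continuous eta0_cutoff) h1 k y iF).
exact: (lp_conv_bounded (cutoff_Im_continuous eta0_cutoff) h2 k y iF).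
Qed.

Let measurable_phase : cmeasurable (fun z : R * R => cexpi (2 * pi * z.1 * z.2) : C).
Proof.
apply: (@cmeasurable_comp _ _ _ _ _ (@cexpi R)).
  exact: ccontinuous_measurable (@cexpi_continuous R).
apply: measurable_funM; last exact: measurable_snd.
by apply: measurable_funM => //; exact: measurable_fst.
Qed.

(** Fubini's theorem exchanges the two Fourier integrals; what multiplies [phi y] is
    the inverse transform of the multiplier at [y - x], that is the kernel [Kc k]. *)
Let fourier_multiplier k phi x : schwartz phi ->
  fourier (fun xi => lp_multiplier eta0 k xi * inv_fourier phi xi) x =
  cintegral setT (fun y => phi y * Kc k (y - x)).
Proof.
move=> sp; have [mm [Am [iAm hAm]]] := lp_multiplier_integrable eta0_cutoff k.
have [Ap [iAp hAp]] := schwartz_decay sp.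
have mphi := ccontinuous_measurable (schwartz_ccontinuous sp).
have mexp (c : R) : cmeasurable (fun t : R => cexpi (c * t) : C).
  apply: (@cmeasurable_comp _ _ _ _ _ (@cexpi R)).
    exact: ccontinuous_measurable (@cexpi_continuous R).
  exact: measurable_funM.
pose h (z : R * R) : C := cexpi (- (2 * pi * x) * z.1) * lp_multiplier eta0 k z.1 *
  (cexpi (2 * pi * z.1 * z.2) * phi z.2).
have mh : cmeasurable h.
  apply: cmeasurableM; apply: cmeasurableM => //.
  - exact: (cmeasurable_comp (mexp _) measurable_fst).
  - exact: (cmeasurable_comp mm measurable_fst).
  - exact: (cmeasurable_comp mphi measurable_snd).
have hh xi y : normc (h (xi, y)) <= Am xi * Ap y.
  rewrite /h /= !normcM !normc_cexpi !mul1r ler_pM ?normc_ge0//.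
transitivity (cintegral setT (fun xi => cintegral setT (fun y => h (xi, y)))).
  congr cintegral; apply/funext => xi; rewrite /h /= cintegralZl.
    by rewrite mulNr [LHS]mulrA [2 * pi * xi * x]mulrAC.
  apply: cintegrable_dominated iAp; first exact: cmeasurableM.
  by move=> y; rewrite normcM normc_cexpi mul1r.
rewrite (cintegral_swap mh iAm iAp hh); congr cintegral; apply/funext => y.
have -> : Kc k (y - x) = inv_fourier (lp_multiplier eta0 k) (y - x).
  by rewrite inv_fourier_lp_multiplier.
rewrite /inv_fourier -cintegralZl.
  congr cintegral; apply/funext => xi; rewrite /h /=.
  have -> : 2 * pi * (y - x) * xi = - (2 * pi * x) * xi + 2 * pi * xi * y by ring.
  by rewrite cexpiD; ring.
apply: cintegrable_dominated iAm; first exact: cmeasurableM.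
by move=> xi; rewrite normcM normc_cexpi mul1r.
Qed.

Lemma lp_dist_fun_dist k phi : schwartz phi ->
  cintegrable setT (fun y => lp_fun k y * phi y) /\
  lp_dist eta0 k (fun_dist F) phi = cintegral setT (fun y => lp_fun k y * phi y).
Proof.
move=> sp; have [Ap [iAp hAp]] := schwartz_decay sp.
have mphi := ccontinuous_measurable (schwartz_ccontinuous sp).
have [MK hMK] := Kc_bounded k.
have MK0 : 0 <= MK by rewrite (le_trans _ (hMK 0))// normc_ge0.
split.
  have [M hM] := lp_fun_bounded k.
  have M0 : 0 <= M by rewrite (le_trans _ (hM 0))// normc_ge0.
  have iMA : mu.-integrable setT (EFin \o (fun y => M * Ap y)).
    by apply: eq_integrable (@integrableZl _ _ _ mu _ measurableT M _ iAp) => // y _; rewrite /= EFinM.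
  apply: cintegrable_dominated iMA.
    by apply: cmeasurableM => //; exact/ccontinuous_measurable/lp_fun_ccontinuous.
  by move=> y; rewrite normcM ler_pM ?normc_ge0.
rewrite /lp_dist /dist_inv_fourier /dist_mul /dist_fourier /fun_dist.
pose h (z : R * R) : C := (F z.1)%:C * (phi z.2 * Kc k (z.2 - z.1)).
have mh : cmeasurable h.
  apply: cmeasurableM; first exact: (cmeasurable_comp cF measurable_fst).
  apply: cmeasurableM; first exact: (cmeasurable_comp mphi measurable_snd).
  apply: (@cmeasurable_comp _ _ _ _ _ (Kc k)) => //.
  by apply: measurable_funB; [exact: measurable_snd|exact: measurable_fst].
have hh x y : normc (h (x, y)) <= MK * `|F x| * Ap y.
  have -> : h (x, y) = (F x)%:C * (phi y * Kc k (y - x)) by [].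
  rewrite !normcM normcF.
  have -> : MK * `|F x| * Ap y = `|F x| * (Ap y * MK) by ring.
  by rewrite ler_wpM2l// ler_pM ?normc_ge0.
have mshift y : cmeasurable (fun x => Kc k (y - x)).
  apply: (@cmeasurable_comp _ _ _ _ _ (Kc k)) => //.
  by apply: measurable_funB.
have mshift2 x : cmeasurable (fun y => Kc k (y - x)).
  apply: (@cmeasurable_comp _ _ _ _ _ (Kc k)) => //.
  by apply: measurable_funB.
transitivity (cintegral setT (fun x => cintegral setT (fun y => h (x, y)))).
  congr cintegral; apply/funext => x; rewrite fourier_multiplier// /h /= cintegralZl//.
  have iMA : mu.-integrable setT (EFin \o (fun y => MK * Ap y)).
    by apply: eq_integrable (@integrableZl _ _ _ mu _ measurableT MK _ iAp) => // y _; rewrite /= EFinM.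
  apply: cintegrable_dominated iMA; first exact: cmeasurableM.
  by move=> y; rewrite normcM mulrC ler_pM ?normc_ge0.
rewrite (cintegral_swap mh (iFM MK) iAp hh); congr cintegral; apply/funext => y.
rewrite lp_funE mulrC -cintegralZl.
  by congr cintegral; apply/funext => x; rewrite /h /= mulrCA.
apply: (cintegrable_dominated _ _ (iFM MK)); first exact: cmeasurableM.
by move=> x; rewrite normcM normcF mulrC ler_wpM2r.
Qed.

(** The piece is picked among the continuous functions that represent [lp_dist]: the
    convolution is one of them, and there is only one. *)
Lemma lp_piece_fun_dist k : lp_piece eta0 k (fun_dist F) = lp_fun k.
Proof.
rewrite /lp_piece; apply: xget_subset1.
  split; first exact: lp_fun_ccontinuous.
  by move=> phi sp; exact: lp_dist_fun_dist.
move=> g h [cg rg] [ch rh].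
exact: (represents_unique eta0_cutoff cg rg ch rh).
Qed.

End FixedFunction.
End FunctionDistributions.

(** * Bounds on Lebesgue norms *)

Section LebesgueNorms.
Context {R : realType}.
Local Notation C := R[i].
Local Notation mu := (@lebesgue_measure R).
Implicit Types (g : R -> C) (p a s t Q : R).

Lemma normc_measurable g : cmeasurable g -> measurable_fun setT (fun x => normc (g x)).
Proof.
move=> [mr mi].
have -> : (fun x => normc (g x)) = Num.sqrt \o
    (fun x => (complex.Re (g x)) ^+ 2 + (complex.Im (g x)) ^+ 2).
  by apply/funext => x /=; case: (g x).
apply: measurableT_comp; first by apply: continuous_measurable_fun; exact: sqrt_continuous.
by apply: measurable_funD; apply: measurable_funX.
Qed.

Lemma cnormE g p : cnorm p%:E g =
  ((\int[mu]_x ((normc (g x)) `^ p)%:E) `^ p^-1)%E.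
Proof.
rewrite /cnorm unlock; congr poweR; apply: eq_integral => x _.
by rewrite abse_EFin ger0_norm ?normc_ge0// poweR_EFin.
Qed.

Let normc_powR_measurable g p : cmeasurable g ->
  measurable_fun setT (fun x => ((normc (g x)) `^ p)%:E).
Proof.
move=> mg; apply/measurable_EFinP.
by apply: (measurableT_comp (measurable_powR p)); exact: normc_measurable.
Qed.

(** As [normc (g x) / Q] is at most 1, its power of exponent [p >= 1] is at most itself,
    hence at most [H x / Q]. *)
Lemma cnorm_le g H p Q s : 1 <= p -> 0 < Q -> 0 <= s -> cmeasurable g ->
  measurable_fun setT H -> (forall x, normc (g x) <= H x) -> (forall x, H x <= Q) ->
  (\int[mu]_x (H x)%:E <= (Q * s)%:E)%E ->
  (cnorm p%:E g <= (Q * s `^ p^-1)%:E)%E.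
Proof.
move=> p1 Q0 s0 mg mH gH HQ iH; have p0 : 0 < p by exact: lt_le_trans p1.
have H0 x : 0 <= H x by rewrite (le_trans _ (gH x))// normc_ge0.
have powle x : (normc (g x)) `^ p <= (Q `^ p / Q) * H x.
  have e : normc (g x) = Q * (normc (g x) / Q) by rewrite mulrC divfK// gt_eqF.
  have q0 : 0 <= normc (g x) / Q by rewrite divr_ge0 ?normc_ge0// ltW.
  rewrite e powRM// ?(ltW Q0)// -mulrA ler_wpM2l ?powR_ge0//.
  rewrite (@le_trans _ _ (normc (g x) / Q))//; last by rewrite mulrC ler_pM2l ?invr_gt0.
  have [->|ne] := eqVneq (normc (g x) / Q) 0; first by rewrite powR0 ?gt_eqF.
  rewrite ge1r_powR// lt_neqAle eq_sym ne q0 /= ler_pdivrMr// mul1r.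
  exact: le_trans (gH x) (HQ x).
have key : (\int[mu]_x ((normc (g x)) `^ p)%:E <= (Q `^ p * s)%:E)%E.
  apply: (@le_trans _ _ (\int[mu]_x ((Q `^ p / Q)%:E * (H x)%:E))%E).
    apply: ge0_le_integral => //.
    - by move=> x _; rewrite lee_fin powR_ge0.
    - exact: normc_powR_measurable.
    - by apply: emeasurable_funM => //; exact/measurable_EFinP.
    - by move=> x _; rewrite -EFinM lee_fin.
  rewrite ge0_integralZl//; last 3 first.
  - exact/measurable_EFinP.
  - by move=> x _; rewrite lee_fin.
  - by rewrite lee_fin divr_ge0 ?powR_ge0// ltW.
  have -> : (Q `^ p * s = (Q `^ p / Q) * (Q * s)) by rewrite mulrA divfK// gt_eqF.
  by rewrite [leRHS]EFinM lee_wpmul2l// lee_fin divr_ge0 ?powR_ge0 ?ltW.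
rewrite cnormE (le_trans (gt0_ler_poweR _ _ _ key))//.
- by rewrite invr_ge0 ltW.
- by rewrite in_itv/= leey andbT integral_ge0// => x _; rewrite lee_fin powR_ge0.
- by rewrite in_itv/= leey andbT lee_fin mulr_ge0 ?powR_ge0.
rewrite poweR_EFin powRM ?powR_ge0//.
by rewrite -powRrM divff ?gt_eqF// powRr1// ltW.
Qed.

Lemma cnorm_ge g p a s t : 0 < p -> 0 <= a -> s <= t -> cmeasurable g ->
  (forall x, s <= x <= t -> a <= normc (g x)) ->
  ((a * (t - s) `^ p^-1)%:E <= cnorm p%:E g)%E.
Proof.
move=> p0 a0 st mg ag; have ts0 : 0 <= t - s by rewrite subr_ge0.
have mst : measurable `[s, t] by exact: measurable_itv.
have key : ((a `^ p * (t - s))%:E <= \int[mu]_x ((normc (g x)) `^ p)%:E)%E.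
  apply: (@le_trans _ _ (\int[mu]_(x in `[s, t]) ((normc (g x)) `^ p)%:E)%E); last first.
    apply: ge0_subset_integral => //.
    - exact: normc_powR_measurable.
    - by move=> x _; rewrite lee_fin powR_ge0.
  have <- : (\int[mu]_(x in `[s, t]) (cst (a `^ p)%:E) x)%E = (a `^ p * (t - s))%:E.
    rewrite integral_cst//= [X in (_ * X)%E]lebesgue_measure_itv/= lte_fin.
    case: ltP => [_|ts]; first by rewrite -EFinB -EFinM.
    by rewrite mule0 (_ : t - s = 0) ?mulr0//; lra.
  apply: ge0_le_integral => //.
  - by move=> x _; rewrite /= lee_fin powR_ge0.
  - by apply: measurable_funTS; exact: normc_powR_measurable.
  - move=> x /=; rewrite in_itv/= => /ag h; rewrite lee_fin ge0_ler_powR ?nnegrE ?normc_ge0//.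
    exact: ltW.
rewrite cnormE (le_trans _ (gt0_ler_poweR _ _ _ key))//.
- by rewrite poweR_EFin powRM ?powR_ge0// -powRrM divff ?gt_eqF// powRr1.
- by rewrite invr_ge0 ltW.
- by rewrite in_itv/= leey andbT lee_fin mulr_ge0 ?powR_ge0.
- by rewrite in_itv/= leey andbT integral_ge0// => x _; rewrite lee_fin powR_ge0.
Qed.

Lemma cnorm_oo_le g a : 0 <= a -> (forall x, normc (g x) <= a) ->
  (cnorm +oo%E g <= a%:E)%E.
Proof.
move=> a0 ga; rewrite /cnorm unlock; case: ifP => _; last by rewrite lee_fin.
apply/ess_supP; apply: nearW => x /=.
by rewrite ger0_norm ?normc_ge0// lee_fin.
Qed.

End LebesgueNorms.

(** * Dyadic and Besov norms of the Haar sums *)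

Section HaarDistributions.
Context {R : realType}.
Local Open Scope complex_scope.
Local Notation C := R[i].
Local Notation mu := (@lebesgue_measure R).
Variable eta0 : R -> C.
Hypothesis eta0_cutoff : lp_cutoff eta0.
Implicit Types (N : option nat) (k n : nat) (p : R).

Local Notation T N := (fun_dist (@haar_fun_of R N)).
Local Notation piece N := (lp_fun (@haar_fun_of R N) eta0).

Let pieceE N k : lp_piece eta0 k (T N) = piece N k.
Proof. by apply: lp_piece_fun_dist => //; exact: haar_fun_of_integrable. Qed.

(** The two parts of the kernel have integrals 1 and 0, so only the real part of the
    series survives. *)
Lemma pairing_ind_fun_dist N (s t : R) : s <= t ->
  pairing_ind eta0 (T N) `[s, t[ = (\int[mu]_(x in `[s, t]) haar_fun_of N x)%:C.
Proof.
move=> st; have iF := @haar_fun_of_integrable R N.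
have [K1 h1] := cutoff_Re_decay eta0_cutoff; have [K2 h2] := cutoff_Im_decay eta0_cutoff.
have c1 := cutoff_Re_continuous eta0_cutoff; have c2 := cutoff_Im_continuous eta0_cutoff.
have i1 := cutoff_Re_integral eta0_cutoff; have i2 := cutoff_Im_integral eta0_cutoff.
have v1 := cvg_sum_lp_conv c1 h1 i1 iF st.
have v2 := cvg_sum_lp_conv c2 h2 i2 iF st.
rewrite mul1r in v1; rewrite mul0r in v2.
have cl (f : R -> R) : continuous f -> \int[mu]_(x in `[s, t[) f x = \int[mu]_(x in `[s, t]) f x.
  move=> cf; apply: Rintegral_itv_bndo_bndc.
  apply: (@integrableS _ _ _ mu `[s, t] _ _ (measurable_itv _) (measurable_itv _)
    _ (continuous_integrable_itv _ _ cf)).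
  exact: subset_itv_co_cc.
rewrite /pairing_ind /cseries; congr (_ +i* _).
- rewrite (_ : series _ = (fun n => \sum_(0 <= k < n)
      \int[mu]_(y in `[s, t]) lp_conv (cutoff_Re eta0) (haar_fun_of N) k y)).
    exact: cvg_lim v1.
  apply/funext => n; rewrite /series /=; apply: eq_bigr => k _.
  rewrite pieceE /= -cl //; apply: (lp_conv_continuous c1 h1); exact: iF.
- rewrite (_ : series _ = (fun n => \sum_(0 <= k < n)
      \int[mu]_(y in `[s, t]) lp_conv (cutoff_Im eta0) (haar_fun_of N) k y)).
    exact: cvg_lim v2.
  apply/funext => n; rewrite /series /=; apply: eq_bigr => k _.
  rewrite pieceE /= -cl //; apply: (lp_conv_continuous c2 h2); exact: iF.
Qed.

Lemma pairing_haar N (j z : int) : -1 <= j ->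
  2 ^ j * normc (pairing eta0 (T N) (haar j z)) =
  [&& j != -1, in_depth N `|j|%N & z == 0]%:R :> R.
Proof.
have [-> _|j1 j_ge] := eqVneq j (-1).
  rewrite /haar eqxx /pairing big_seq1 mul1r pairing_ind_fun_dist ?lerDl//.
  by rewrite haar_fun_of_unit /= expr0n/= addr0 sqrtr0 mulr0.
have [m jm] : exists m : nat, j = m%:Z by exists `|j|%N; lia.
have pm : (2 : R) ^ (- j) = 2 ^- m by rewrite jm; case: m {jm} => [|m]; rewrite ?expr0 ?invr1.
have p0 : (0 : R) < 2 ^- m by rewrite invr_gt0 exprn_gt0.
have hm : 2 ^- m = 2 * 2 ^- m.+1 :> R by rewrite exprS invfM mulrA divff ?mul1r.
rewrite /haar (negbTE j1) /pairing big_cons big_seq1 pm.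
have e1 : 2 ^- m * (z%:~R + 1 / 2) = 2 ^- m * z%:~R + 2 ^- m.+1 :> R.
  by rewrite mulrDr {2}hm; congr (_ + _); field.
have e2 : 2 ^- m * (z%:~R + 1) = 2 ^- m * z%:~R + 2 * 2 ^- m.+1 :> R.
  by rewrite mulrDr mulr1 {2}hm.
have p1 : (0 : R) < 2 ^- m.+1 by rewrite invr_gt0 exprn_gt0.
rewrite e1 e2 [X in X + _]mul1r [X in _ + X]mulN1r !pairing_ind_fun_dist; [|lra|lra].
rewrite -rmorphB -/(haar_coef _ _ _) haar_fun_of_coef.
rewrite /= expr0n/= addr0 sqrtr_sqr ger0_norm ?mulr_ge0 ?(ltW p0)//.
rewrite jm /= mulrA -exprnP divff ?mul1r ?expf_neq0//.
Qed.

(** Each level [j] carries at most one nonzero coefficient, of normalized value 1. *)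
Lemma dyad_norm_haar N p : 0 < p -> in_depth N 0 -> dyad_norm eta0 p (T N) = 1%E.
Proof.
move=> p0 N0; have pn0 : p != 0 by rewrite gt_eqF.
rewrite /dyad_norm.
have E (j : int) : -1 <= j ->
    ((\esum_(z in [set: int]) ((2 ^ j * normc (pairing eta0 (T N) (haar j z))) `^ p)%:E) `^ p^-1
    = ((j != -1) && in_depth N `|j|%N)%:R%:E :> \bar R)%E.
  move=> j1; set b := (j != -1) && in_depth N `|j|%N.
  have -> : (\esum_(z in [set: int]) ((2 ^ j * normc (pairing eta0 (T N) (haar j z))) `^ p)%:E =
      \esum_(z in [set (0 : int)]) (b%:R)%:E :> \bar R)%E.
    rewrite [RHS]esum_mkcond; apply: eq_esum => z _.
    rewrite pairing_haar// andbA -/b.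
    have [->|z0] := eqVneq z 0.
      by rewrite mem_set// andbT; case: (b); rewrite ?powR0 ?powR1.
    by rewrite memNset ?andbF ?powR0//; exact/eqP.
  rewrite esum_set1 ?lee_fin// poweR_EFin.
  by case: (b); rewrite ?powR1 ?powR0 ?invr_eq0.
apply/eqP; rewrite eq_le; apply/andP; split.
- apply: ge_ereal_sup => _ [j /= j1 <-]; rewrite E// lee_fin.
  by case: (_ && _).
- apply: ereal_sup_ubound; exists 0 => //.
  by rewrite E//= N0.
Qed.

Let piece_measurable N k : cmeasurable (piece N k).
Proof.
apply: ccontinuous_measurable; apply: lp_fun_ccontinuous => //.
exact: haar_fun_of_integrable.
Qed.

Let step_decay (phi : R -> R) K : continuous phi ->
  (forall x, `|phi x| <= K / oneDsqr x ^+ 2) ->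
  exists B, forall u, `|lp_step phi u| <= B / oneDsqr u.
Proof.
move=> c h; exists (5 * (K * pi)) => u.
exact: (lp_step_decay c h erefl).
Qed.

(** The weight [2 ^ (k / p)] makes up exactly for the [p]-th root of the mass [2 ^- k]
    of a piece of a step function. *)
Lemma besov_haar_sum p n : 1 <= p -> besov eta0 p^-1 p%:E +oo%E (T (Some n)).
Proof.
move=> p1; split; first exact: fun_dist_tempered (haar_fun_of_integrable (Some n)).
have [K1 h1] := cutoff_Re_decay eta0_cutoff; have [K2 h2] := cutoff_Im_decay eta0_cutoff.
have c1 := cutoff_Re_continuous eta0_cutoff; have c2 := cutoff_Im_continuous eta0_cutoff.
have [B1 s1] := step_decay c1 h1.
have [B2 s2] := step_decay c2 h2.
have [M1 m1] := haar_sum_mass c1 h1 s1 n; have [M2 m2] := haar_sum_mass c2 h2 s2 n.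
pose Q := 1 + (`|M1| + `|M2|).
have Q0 : 0 < Q by rewrite ltr_pwDl// addr_ge0.
apply: (@le_lt_trans _ _ Q%:E); last exact: ltry.
apply: ge_ereal_sup => _ [k _ <-]; rewrite pieceE.
have [G1 [mG1 vG1 GM1 iG1]] := m1 k; have [G2 [mG2 vG2 GM2 iG2]] := m2 k.
have G10 x : 0 <= G1 x by rewrite (le_trans _ (vG1 x)).
have G20 x : 0 <= G2 x by rewrite (le_trans _ (vG2 x)).
have e0 : (0 : R) <= 2 ^- k by rewrite invr_ge0 exprn_ge0.
have iG : (\int[mu]_x (G1 x + G2 x)%:E <= (Q * 2 ^- k)%:E)%E.
  under eq_integral do rewrite EFinD.
  rewrite ge0_integralD//; last 4 first.
  - by move=> x _; rewrite lee_fin.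
  - exact/measurable_EFinP.
  - by move=> x _; rewrite lee_fin.
  - exact/measurable_EFinP.
  rewrite (le_trans (leeD iG1 iG2))// -EFinD lee_fin -mulrDl ler_wpM2r// /Q.
  by have := ler_norm M1; have := ler_norm M2; lra.
have le2 : (2 `^ (k%:R * p^-1) * (Q * (2 ^- k) `^ p^-1)) = Q.
  have -> : (2 ^- k : R) = 2 `^ (- k%:R) by rewrite powRN powR_mulrn.
  rewrite -powRrM mulrCA -powRD ?pnatr_eq0 ?implybT// mulNr subrr powRr0 mulr1//.
rewrite -[in leRHS]le2 EFinM lee_wpmul2l ?lee_fin ?powR_ge0//.
apply: (cnorm_le p1 Q0 e0 (piece_measurable _ _) (measurable_funD mG1 mG2)) => // x.
- by rewrite (le_trans (normc_le_ReIm _))//= lerD.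
- rewrite /Q /=; have := GM1 x; have := GM2 x; have := ler_norm M1; have := ler_norm M2; lra.
Qed.

(** The pieces grow at most linearly in [k], and [(k + 1) * 2 ^- k] is summable. *)
Lemma refspace_haar_fun N : refspace eta0 (T N).
Proof.
split; first exact: fun_dist_tempered (haar_fun_of_integrable N).
have [K1 h1] := cutoff_Re_decay eta0_cutoff; have [K2 h2] := cutoff_Im_decay eta0_cutoff.
have c1 := cutoff_Re_continuous eta0_cutoff; have c2 := cutoff_Im_continuous eta0_cutoff.
have [B1 s1] := step_decay c1 h1.
have [B2 s2] := step_decay c2 h2.
have [A1 a1] := lp_conv_haar_growth c1 h1 s1 N.
have [A2 a2] := lp_conv_haar_growth c2 h2 s2 N.
pose A := `|A1| + `|A2|; have A0 : 0 <= A by rewrite addr_ge0.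
have hA k y : normc (piece N k y) <= A * k.+1%:R.
  rewrite (le_trans (normc_le_ReIm _))//= mulrDl lerD//.
  - by rewrite (le_trans (a1 k y))// ler_wpM2r// ler_norm.
  - by rewrite (le_trans (a2 k y))// ler_wpM2r// ler_norm.
have sumE n : \sum_(0 <= k < n) (k.+1%:R * 2 ^- k : R) = 4 - (2 * n%:R + 4) * 2 ^- n.
  elim: n => [|n IH]; first by rewrite big_geq// mulr0 add0r expr0 invr1 mulr1 subrr.
  rewrite big_nat_recr//= IH exprS invfM -[n.+1%:R]natr1.
  by move: (2 ^- n) => e; field.
rewrite /besov_norm invr1 poweRe1; last by apply: nneseries_ge0 => k _ _; exact: poweR_ge0.
apply: (@le_lt_trans _ _ (A * 4)%:E); last exact: ltry.
apply: lime_le; first by apply: is_cvg_nneseries => k _ _; exact: poweR_ge0.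
apply: nearW => n; apply: (@le_trans _ _ (\sum_(0 <= k < n) (A * (k.+1%:R * 2 ^- k))%:E)%E).
  apply: lee_sum => k _; rewrite poweRe1; last by rewrite mule_ge0// ?lee_fin ?powR_ge0// Lnorm_ge0.
  have -> : A * (k.+1%:R * 2 ^- k) = 2 `^ (k%:R * -1) * (A * k.+1%:R).
    by rewrite mulrN1 powRN powR_mulrn//; ring.
  rewrite EFinM lee_wpmul2l ?lee_fin ?powR_ge0// pieceE.
  by apply: cnorm_oo_le => //; rewrite mulr_ge0.
by rewrite sumEFin -mulr_sumr sumE lee_fin ler_wpM2l// gerBl mulr_ge0// ?addr_ge0// ?mulr_ge0.
Qed.

(** On an interval of length comparable to [2 ^- k], chosen where [lp_step] does not
    vanish, the piece of order [k] has size [depth N k] up to a bounded error. The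
    weight [2 ^ (k / p)] makes up for the length of this interval. *)
Lemma besov_norm_haar_ge p : 0 < p -> exists c D : R, 0 < c /\ forall N k,
  ((c * (depth N k.+1)%:R - D)%:E <= besov_norm eta0 p^-1 p%:E +oo%E (T N))%E.
Proof.
move=> p0.
have [K h] := cutoff_Re_decay eta0_cutoff; have c1 := cutoff_Re_continuous eta0_cutoff.
have [B s1] := step_decay c1 h.
have q0 : Rintegral mu setT (cutoff_Re eta0) != 0.
  by rewrite cutoff_Re_integral// oner_eq0.
have [u0 nz] := lp_step_neq0 c1 h erefl q0.
set Psi := lp_step (cutoff_Re eta0) in nz s1.
have Psic : continuous Psi := lp_step_continuous c1 h.
pose m := `|Psi u0| / 2; have m0 : 0 < m by rewrite divr_gt0// normr_gt0.
have [d [d0 d1 hd]] : exists d, [/\ 0 < d, d <= 1 & forall u, `|u - u0| <= d -> m <= `|Psi u|].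
  have /cvgrPdist_lt/(_ m m0)/nbhs_ballP[e /= e0 he] := Psic u0.
  exists (Num.min (e / 2) 1); split; first by rewrite lt_min ltr01 andbT divr_gt0.
    by rewrite ge_min lexx orbT.
  move=> u; rewrite le_min => /andP[ue _].
  have /he : ball u0 e u by rewrite /ball /= distrC (le_lt_trans ue)// ltr_pdivrMr//; lra.
  move=> h1; have := ler_distD 0 (Psi u0) (Psi u); rewrite !subr0 add0r normrN /m.
  have := ler_normD (Psi u0 - Psi u) (Psi u); rewrite subrK; move: h1; rewrite /m; lra.
pose E := 10 * B * (1 + (`|u0| + 1) ^+ 2) + 4 * K.
pose w := (2 * d) `^ p^-1; have w0 : 0 < w by rewrite powR_gt0// mulr_gt0.
exists (m * w), (E * w); split; first exact: mulr_gt0.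
move=> N k; rewrite -mulrA [w * _]mulrC mulrA -mulrBl.
set r := m * _ - E.
apply: (@le_trans _ _ ((2 `^ (k.+1%:R * p^-1))%:E * cnorm p%:E (lp_piece eta0 k.+1 (T N)))%E); last first.
  by apply: ereal_sup_ubound; exists k.+1.
rewrite pieceE; have [r0|r0] := ltP r 0.
  apply: (@le_trans _ _ 0%E); first by rewrite lee_fin nmulr_rle0// ltW.
  by rewrite mule_ge0 ?lee_fin ?powR_ge0// Lnorm_ge0.
have e0 : (0 : R) < 2 ^+ k.+1 by rewrite exprn_gt0.
have -> : r * w = 2 `^ (k.+1%:R * p^-1) *
    (r * ((u0 + d) / 2 ^+ k.+1 - (u0 - d) / 2 ^+ k.+1) `^ p^-1).
  have -> : (u0 + d) / 2 ^+ k.+1 - (u0 - d) / 2 ^+ k.+1 = 2 `^ (- k.+1%:R) * (2 * d) :> R.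
    by rewrite powRN powR_mulrn// -mulrBl; ring.
  rewrite powRM ?powR_ge0//; last by rewrite mulr_ge0// ltW.
  rewrite -powRrM mulNr powRN mulrCA; congr (_ * _); rewrite mulVKf// gt_eqF// powR_gt0//.
rewrite EFinM lee_wpmul2l ?lee_fin ?powR_ge0//.
apply: cnorm_ge => //; first by rewrite ler_pM2r ?invr_gt0//; lra.
move=> y; rewrite ler_pdivrMr// ler_pdivlMr// mulrC => /andP[y1 y2].
set u := 2 ^+ k.+1 * y in y1 y2.
have hu : m <= `|Psi u| by apply: hd; rewrite ler_norml; lra.
have near := lp_conv_haar_near c1 h s1 N k y.
rewrite -/u -/Psi in near.
rewrite (le_trans _ (normr_Re_le _))//=.
have uE : oneDsqr u <= 1 + (`|u0| + 1) ^+ 2.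
  rewrite /oneDsqr lerD2l -[leLHS]real_normK ?num_real// ler_pXn2r ?nnegrE ?addr_ge0//.
  have -> : u = u0 + (u - u0) by ring.
  rewrite (le_trans (ler_normD _ _))// lerD2l ler_norml; lra.
have B0 : 0 <= B.
  have := s1 0; rewrite /oneDsqr expr0n/= addr0 divr1; exact: le_trans (normr_ge0 _).
have hE : 10 * B * oneDsqr u + 4 * K <= E by rewrite lerD2r ler_wpM2l// mulr_ge0.
have hm : (depth N k.+1)%:R * m <= `|(depth N k.+1)%:R * Psi u|.
  by rewrite normrM ger0_norm// ler_wpM2l.
rewrite /r; set v := lp_conv _ _ _ _ in near *; set z := _ * Psi u in near hm.
have := ler_normB v (v - z); rewrite opprB addrC subrK; lra.
Qed.

End HaarDistributions.

Theorem theorem1p10 (R : realType) (eta0 : R -> R[i])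
    (eta0_cutoff : lp_cutoff eta0) (p : R) (p_ge1 : 1 <= p) :
  (exists (c : R) (f : nat -> @tdistribution R), 0 < c /\
    forall N : nat, (1 <= N)%N ->
      [/\ besov eta0 p^-1 p%:E +oo%E (f N),
          dyad_norm eta0 p (f N) = 1%E &
          ((c * N%:R)%:E <= besov_norm eta0 p^-1 p%:E +oo%E (f N))%E]) /\
  (besov_dyad eta0 p `\` besov eta0 p^-1 p%:E +oo%E) !=set0.
Proof.
have p0 : 0 < p by exact: lt_le_trans p_ge1.
have [c [D [c0 lower]]] := besov_norm_haar_ge eta0_cutoff p0.
split.
- (* summing [M * N] Haar functions instead of [N] absorbs the loss [D] *)
  pose M := (Num.bound `|D / c|).+1.
  have DM : D <= c * (M%:R - 1).
    rewrite /M -[M%:R]natr1 addrK mulrC -ler_pdivrMr//.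
    by rewrite (le_trans (ler_norm _))// ltW// archi_boundP.
  exists c, (fun N => fun_dist (haar_fun_of (Some (M * N)%N))); split => // N N1.
  have MN : (0 < M * N)%N by rewrite muln_gt0.
  split.
  + exact: besov_haar_sum.
  + exact: dyad_norm_haar.
  + apply: le_trans (lower (Some (M * N)%N) (M * N).-1).
    rewrite /= prednK// minnn lee_fin natrM.
    have N1' : (1 : R) <= N%:R by rewrite ler1n.
    have M1 : (0 : R) <= M%:R - 1 by rewrite subr_ge0 ler1n.
    have : c * (M%:R - 1) <= c * (M%:R - 1) * N%:R by rewrite ler_peMr// mulr_ge0// ltW.
    lra.
- exists (fun_dist (haar_fun_of None)); split.
    by split; [exact: refspace_haar_fun|rewrite dyad_norm_haar ?ltry].
  move=> [_ fin].
  (* a finite Besov norm would bound [depth None k = k] *)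
  have [x xE] : exists x : R, (besov_norm eta0 p^-1 p%:E +oo%E (fun_dist (haar_fun_of None)) <= x%:E)%E.
    move: fin; case: besov_norm => [x| |] //; first by exists x.
    by exists 0; rewrite leNye.
  pose n := Num.bound `|(x + D) / c|.
  have := le_trans (lower None n) xE; rewrite /= lee_fin leNgt => /negP; apply.
  have : (x + D) / c < n%:R by rewrite (le_lt_trans (ler_norm _))// archi_boundP.
  rewrite ltr_pdivrMr// -[n.+1%:R]natr1; lra.
Qed.
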